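(* Let $X\neq\{0\}$ be a complex Banach space with open unit ball $\mathbb{B}$ and let $\frac12\le\lambda\le 1$. Let $F$ be a locally biholomorphic mapping on $\mathbb{B}$ such that, for each $k=1,2,3$, there is a complex-valued homogeneous polynomial $H_{F,k}:X\to\mathbb{C}$ of degree $k$ with $$\frac{D^{k+1}F(0)(x^{k+1})}{(k+1)!}=H_{F,k}(x)\,x\qquad\text{for all }x\in X .$$ If $F\in\widehat{\mathcal{F}}_{\lambda}(\mathbb{B})$, then for every $x_0\in X$ with $\|x_0\|=1$ (and every $T_{x_0}\in T(x_0)$), $$|J_{2,3}(F)|\le\frac{(1+2\lambda)(7+2\lambda)^{3/2}}{36\sqrt{3(9-4\lambda^2)}},\qquad\text{where } J_{2,3}(F)=A_2A_3-A_4 .$$ The inequality is sharp: for every $\lambda\in[\frac12,1]$ there exist such an $F$, $x_0$ and $T_{x_0}$ for which equality holds.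
   Context: $X$ is a complex Banach space with norm $\|\cdot\|$ and $\mathbb{B}=\{x\in X:\|x\|<1\}$. For $x\in X\setminus\{0\}$, $T(x)$ is the set of bounded linear functionals $T_x:X\to\mathbb{C}$ with $T_x(x)=\|x\|$ and $\|T_x\|=1$. $D^nF(x)$ denotes the $n$th Fréchet derivative of $F$ at $x$ (a bounded symmetric $n$-linear map $X^n\to X$), and $D^nF(0)(x^n)=D^nF(0)(x,\ldots,x)$. A holomorphic map $F:\mathbb{B}\to X$ is normalized if $F(0)=0$ and $DF(0)=I$; it is locally biholomorphic if $DF(x)$ is invertible with bounded inverse for every $x\in\mathbb{B}$. For $\frac12\le\lambda\le1$, $\widehat{\mathcal{F}}_{\lambda}(\mathbb{B})$ is the class of normalized locally biholomorphic maps $F:\mathbb{B}\to X$ such that $$\operatorname{Re}\left\{T_x\left(\frac{(DF(x))^{-1}\bigl(D^2F(x)(x,x)+DF(x)x\bigr)}{\|x\|}\right)\right\}\ge\frac12-\lambda$$ for every $x\in\mathbb{B}\setminus\{0\}$ and every $T_x\in T(x)$. For $\|x_0\|=1$ and $T_{x_0}\in T(x_0)$, put $A_n=\frac{1}{n!}T_{x_0}\bigl(D^nF(0)(x_0,\ldots,x_0)\bigr)$ for $n=2,3,4$. *)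

(* Defs.v *)
From Stdlib Require Import Reals Lra Factorial.
From Stdlib Require Fin.
From Stdlib Require Import FunctionalExtensionality ProofIrrelevance ClassicalEpsilon.
From Coquelicot Require Import Coquelicot.
Open Scope R_scope.

(* Stdlib reals with Coquelicot's normed modules over [C_AbsRing].  In Coquelicot
   [is_linear] means linear and bounded, and [filterdiff F (locally x) L] says that
   [L] is the (complex) Fréchet derivative of [F] at [x].  Coquelicot has no space
   of bounded operators, so it is built here; this makes the iterated derivatives
   D^n F : X -> L(X, L(X, ...)) derivatives for the operator norm. *)

Record Lin (U V : NormedModule C_AbsRing) : Type := mkLin {
  lin_fun :> U -> V;
  lin_prop : is_linear lin_fun }.

Arguments mkLin {U V} _ _.
Arguments lin_fun {U V} _ _.
Arguments lin_prop {U V} _.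

Section OperatorSpace.

Context {U V : NormedModule C_AbsRing}.

Lemma Lin_ext (f g : Lin U V) : (forall x, f x = g x) -> f = g.
Proof.
destruct f as [f Hf], g as [g Hg]; simpl; intros H.
assert (E : f = g) by (apply functional_extensionality; exact H).
subst g; f_equal; apply proof_irrelevance.
Qed.

Lemma is_linear_Lin_plus (f g : Lin U V) : is_linear (fun x => plus (f x) (g x)).
Proof.
apply (is_linear_comp (fun x => (f x, g x)) (fun p => plus (fst p) (snd p))).
- apply is_linear_prod; apply lin_prop.
- apply is_linear_plus.
Qed.

Lemma is_linear_Lin_opp (f : Lin U V) : is_linear (fun x => opp (f x)).
Proof.
apply (is_linear_comp f opp); [apply lin_prop | apply is_linear_opp].
Qed.

Lemma is_linear_Lin_scal (a : C) (f : Lin U V) :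
  is_linear (fun x => scal (a : C_AbsRing) (f x)).
Proof.
apply (is_linear_comp f (fun y => scal (a : C_AbsRing) y)); [apply lin_prop |].
apply is_linear_scal_r; exact Cmult_comm.
Qed.

Definition Lin_plus (f g : Lin U V) : Lin U V := mkLin _ (is_linear_Lin_plus f g).
Definition Lin_opp (f : Lin U V) : Lin U V := mkLin _ (is_linear_Lin_opp f).
Definition Lin_scal (a : C_AbsRing) (f : Lin U V) : Lin U V :=
  mkLin _ (is_linear_Lin_scal a f).
Definition Lin_zero : Lin U V := mkLin _ is_linear_zero.

Definition Lin_AbelianMonoid_mixin : AbelianMonoid.mixin_of (Lin U V).
Proof.
refine (AbelianMonoid.Mixin _ Lin_plus Lin_zero _ _ _);
  intros; apply Lin_ext; intros; simpl.
- apply plus_comm.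
- apply plus_assoc.
- apply plus_zero_r.
Defined.

Definition Lin_AbelianMonoid := AbelianMonoid.Pack _ Lin_AbelianMonoid_mixin (Lin U V).

Definition Lin_AbelianGroup_mixin : AbelianGroup.mixin_of Lin_AbelianMonoid.
Proof.
refine (AbelianGroup.Mixin Lin_AbelianMonoid Lin_opp _).
intros f; apply Lin_ext; intros x; exact (plus_opp_r (f x)).
Defined.

Definition Lin_AbelianGroup :=
  AbelianGroup.Pack _ (AbelianGroup.Class _ _ Lin_AbelianGroup_mixin) (Lin U V).

Definition Lin_ModuleSpace_mixin : ModuleSpace.mixin_of C_AbsRing Lin_AbelianGroup.
Proof.
refine (ModuleSpace.Mixin C_AbsRing Lin_AbelianGroup Lin_scal _ _ _ _);
  intros; apply Lin_ext; intros z.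
- exact (scal_assoc x y (u z)).
- exact (scal_one (u z)).
- exact (scal_distr_l x (u z) (v z)).
- exact (scal_distr_r x y (u z)).
Defined.

Definition Lin_ModuleSpace : ModuleSpace C_AbsRing :=
  ModuleSpace.Pack _ _ (ModuleSpace.Class _ _ _ Lin_ModuleSpace_mixin) (Lin U V).

Definition Lin_norm (f : Lin U V) : R :=
  real (Lub_Rbar (fun r => exists x : U, norm x <= 1 /\ r = norm (f x))).

Lemma Lin_norm_spec (f : Lin U V) :
  is_lub_Rbar (fun r => exists x : U, norm x <= 1 /\ r = norm (f x)) (Lin_norm f).
Proof.
unfold Lin_norm; set (E := fun r : R => _).
generalize (Lub_Rbar_correct E); destruct (Lub_Rbar E) as [l| |]; intros H.
- exact H.
- exfalso; destruct H as [_ H].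
  destruct (linear_norm _ (lin_prop f)) as [M [HM Hf]].
  apply (H (Finite M)); intros r [x [Hx ->]]; simpl.
  apply Rle_trans with (1 := Hf x).
  rewrite <- (Rmult_1_r M) at 2; apply Rmult_le_compat_l; lra.
- exfalso; destruct H as [H _].
  apply (H (norm (f zero))); exists zero; split; [|reflexivity].
  rewrite norm_zero; lra.
Qed.

Lemma Lin_norm_ub1 (f : Lin U V) (x : U) : norm x <= 1 -> norm (f x) <= Lin_norm f.
Proof. intros Hx; apply (proj1 (Lin_norm_spec f)); now exists x. Qed.

Lemma Lin_norm_least (f : Lin U V) (M : R) :
  (forall x : U, norm x <= 1 -> norm (f x) <= M) -> Lin_norm f <= M.
Proof.
intros H; apply (proj2 (Lin_norm_spec f) (Finite M)).
intros r [x [Hx ->]]; exact (H x Hx).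
Qed.

Lemma Lin_norm_ge_0 (f : Lin U V) : 0 <= Lin_norm f.
Proof.
apply Rle_trans with (1 := norm_ge_0 (f zero)).
apply Lin_norm_ub1; rewrite norm_zero; lra.
Qed.

Lemma Lin_norm_apply (f : Lin U V) (x : U) : norm (f x) <= Lin_norm f * norm x.
Proof.
destruct (Req_dec (norm x) 0) as [Hx|Hx].
- rewrite (norm_eq_zero _ Hx), (linear_zero _ (lin_prop f)), !norm_zero; lra.
- assert (Hp : 0 < norm x) by (generalize (norm_ge_0 x); lra).
  set (a := RtoC (/ norm x) : C_AbsRing); set (b := RtoC (norm x) : C_AbsRing).
  assert (Ha : abs a = / norm x).
  { change (Cmod (RtoC (/ norm x)) = / norm x).
    rewrite Cmod_R; apply Rabs_pos_eq; left; now apply Rinv_0_lt_compat. }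
  assert (Hb : abs b = norm x).
  { change (Cmod (RtoC (norm x)) = norm x); rewrite Cmod_R; apply Rabs_pos_eq; lra. }
  assert (H1 : norm (f (scal a x)) <= Lin_norm f).
  { apply Lin_norm_ub1; apply Rle_trans with (1 := norm_scal a x).
    rewrite Ha; right; now field. }
  assert (H2 : f x = scal b (f (scal a x))).
  { rewrite (linear_scal _ (lin_prop f)), scal_assoc.
    replace (mult b a) with (one : C_AbsRing).
    - now rewrite scal_one.
    - change (RtoC 1 = Cmult (RtoC (norm x)) (RtoC (/ norm x))).
      rewrite <- RtoC_mult; f_equal; now field. }
  rewrite H2; apply Rle_trans with (1 := norm_scal _ _).
  rewrite Hb, Rmult_comm; apply Rmult_le_compat_r; lra.
Qed.

Lemma Lin_norm_triangle (f g : Lin U V) :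
  Lin_norm (Lin_plus f g) <= Lin_norm f + Lin_norm g.
Proof.
apply Lin_norm_least; intros x Hx; apply Rle_trans with (1 := norm_triangle (f x) (g x)).
now apply Rplus_le_compat; apply Lin_norm_ub1.
Qed.

Lemma Lin_norm_scal_le (a : C_AbsRing) (f : Lin U V) :
  Lin_norm (Lin_scal a f) <= abs a * Lin_norm f.
Proof.
apply Lin_norm_least; intros x Hx; apply Rle_trans with (1 := norm_scal a (f x)).
apply Rmult_le_compat_l; [apply abs_ge_0 | now apply Lin_norm_ub1].
Qed.

Lemma Lin_norm_eq_zero (f : Lin U V) : Lin_norm f = 0 -> f = Lin_zero.
Proof.
intros H; apply Lin_ext; intros x; simpl; apply norm_eq_zero.
apply Rle_antisym; [|apply norm_ge_0].
apply Rle_trans with (1 := Lin_norm_apply f x); rewrite H; lra.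
Qed.

Definition Lin_ball (f : Lin U V) (e : R) (g : Lin U V) : Prop :=
  Lin_norm (Lin_plus g (Lin_opp f)) < e.

Definition Lin_UniformSpace_mixin : UniformSpace.mixin_of (Lin U V).
Proof.
refine (UniformSpace.Mixin _ Lin_zero Lin_ball _ _ _); unfold Lin_ball.
- intros f e; apply Rle_lt_trans with 0; [|apply cond_pos].
  apply Lin_norm_least; intros x _.
  change (norm (plus (f x) (opp (f x))) <= 0).
  replace (plus (f x) (opp (f x))) with (zero : V)
    by (symmetry; exact (plus_opp_r (f x))).
  rewrite norm_zero; lra.
- intros f g e; apply Rle_lt_trans; apply Lin_norm_least; intros x Hx.
  change (norm (plus (f x) (opp (g x))) <= Lin_norm (Lin_plus g (Lin_opp f))).
  replace (plus (f x) (opp (g x))) with (opp (minus (g x) (f x)))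
    by exact (opp_minus (g x) (f x)).
  rewrite norm_opp; exact (Lin_norm_ub1 (Lin_plus g (Lin_opp f)) x Hx).
- intros f g h e1 e2 H1 H2.
  apply Rle_lt_trans with
    (Lin_norm (Lin_plus g (Lin_opp f)) + Lin_norm (Lin_plus h (Lin_opp g))); [|lra].
  rewrite Rplus_comm; eapply Rle_trans; [right|apply Lin_norm_triangle].
  f_equal; apply Lin_ext; intros x.
  exact (minus_trans (g x) (h x) (f x)).
Defined.

Definition Lin_NormedModuleAux : NormedModuleAux C_AbsRing :=
  NormedModuleAux.Pack C_AbsRing (Lin U V)
    (NormedModuleAux.Class _ _ (ModuleSpace.class _ Lin_ModuleSpace)
       Lin_UniformSpace_mixin) (Lin U V).

Definition Lin_NormedModule_mixin : NormedModule.mixin_of C_AbsRing Lin_NormedModuleAux.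
Proof.
refine (NormedModule.Mixin C_AbsRing Lin_NormedModuleAux Lin_norm 1 _ _ _ _ _).
- exact Lin_norm_triangle.
- exact Lin_norm_scal_le.
- intros f g e H; exact H.
- intros f g e H; rewrite Rmult_1_l; exact H.
- exact Lin_norm_eq_zero.
Defined.

End OperatorSpace.

Canonical Lin_NormedModule (U V : NormedModule C_AbsRing) : NormedModule C_AbsRing :=
  NormedModule.Pack C_AbsRing (Lin U V)
    (NormedModule.Class C_AbsRing (Lin U V)
       (NormedModuleAux.class C_AbsRing Lin_NormedModuleAux) Lin_NormedModule_mixin)
    (Lin U V).

Definition Lin_id (U : NormedModule C_AbsRing) : Lin U U := mkLin _ is_linear_id.

(* The Fréchet derivative as a total function; unspecified where it does not exist. *)
Definition frechet {U V : NormedModule C_AbsRing} (F : U -> V) (x : U) : Lin U V :=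
  epsilon (inhabits Lin_zero) (fun L : Lin U V => filterdiff F (locally x) L).

(* L(U, L(U, ... L(U, V))) with n copies of U: the bounded n-linear maps, curried. *)
Fixpoint MLin (U V : NormedModule C_AbsRing) (n : nat) : NormedModule C_AbsRing :=
  match n with
  | O => V
  | S m => Lin_NormedModule U (MLin U V m)
  end.

(* A |-> A(x, ..., x) *)
Fixpoint MLin_diag {U V : NormedModule C_AbsRing} (n : nat) :
    MLin U V n -> U -> V :=
  match n return MLin U V n -> U -> V with
  | O => fun A _ => A
  | S m => fun A x => MLin_diag m (lin_fun A x) x
  end.

Fixpoint frechet_n {U V : NormedModule C_AbsRing} (F : U -> V) (n : nat) :
    U -> MLin U V n :=
  match n return U -> MLin U V n with
  | O => F
  | S m => frechet (frechet_n F m)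
  end.

Definition is_inverse {U V : NormedModule C_AbsRing} (A : Lin U V) (B : Lin V U) : Prop :=
  (forall x, B (A x) = x) /\ (forall y, A (B y) = y).

(* The bounded inverse, unspecified if there is none. *)
Definition Lin_inv {U V : NormedModule C_AbsRing} (A : Lin U V) : Lin V U :=
  epsilon (inhabits Lin_zero) (is_inverse A).

Section UnitBall.

Context {X : CompleteNormedModule C_AbsRing}.

Definition in_ball (x : X) : Prop := norm x < 1.

(* Mappings of the ball are total functions X -> X; only their restriction to the
   (open) ball is ever used. *)
Definition holomorphic (F : X -> X) : Prop :=
  forall x : X, in_ball x -> exists L : Lin X X, filterdiff F (locally x) L.

Definition normalized (F : X -> X) : Prop :=
  F zero = zero /\ frechet F zero = Lin_id X.

Definition locally_biholomorphic (F : X -> X) : Prop :=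
  holomorphic F /\
  forall x : X, in_ball x -> exists B : Lin X X, is_inverse (frechet F x) B.

Definition support_functional (x : X) (T : Lin X C_NormedModule) : Prop :=
  T x = RtoC (norm x) /\ norm T = 1.

Definition class_Fhat (lambda : R) (F : X -> X) : Prop :=
  normalized F /\ locally_biholomorphic F /\
  forall (x : X) (T : Lin X C_NormedModule),
    in_ball x -> x <> zero -> support_functional x T ->
    Re (T (scal (RtoC (/ norm x) : C_AbsRing)
             (Lin_inv (frechet F x)
                (plus (MLin_diag 2 (frechet_n F 2 x) x) (frechet F x x)))))
      >= 1 / 2 - lambda.

Definition slot {k : nat} (v : Fin.t k -> X) (i : Fin.t k) (x : X) : Fin.t k -> X :=
  fun j => if Fin.eq_dec i j then x else v j.

Definition k_linear {k : nat} (u : (Fin.t k -> X) -> C) : Prop :=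
  forall (v : Fin.t k -> X) (i : Fin.t k) (a : C_AbsRing) (x y : X),
    u (slot v i (plus (scal a x) y)) = (a * u (slot v i x) + u (slot v i y))%C.

Definition homogeneous_polynomial (k : nat) (H : X -> C) : Prop :=
  exists u : (Fin.t k -> X) -> C, k_linear u /\ forall x, H x = u (fun _ => x).

Definition scalar_type_expansion (F : X -> X) : Prop :=
  forall k : nat, (1 <= k <= 3)%nat ->
    exists H : X -> C, homogeneous_polynomial k H /\
      forall x : X,
        scal (RtoC (/ INR (fact (k + 1))) : C_AbsRing)
          (MLin_diag (k + 1) (frechet_n F (k + 1) zero) x)
        = scal (H x : C_AbsRing) x.

Definition coefA (F : X -> X) (x0 : X) (T : Lin X C_NormedModule) (n : nat) : C :=
  (RtoC (/ INR (fact n)) * T (MLin_diag n (frechet_n F n zero) x0))%C.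

Definition J23 (F : X -> X) (x0 : X) (T : Lin X C_NormedModule) : C :=
  (coefA F x0 T 2 * coefA F x0 T 3 - coefA F x0 T 4)%C.

End UnitBall.

Definition J23_bound (lambda : R) : R :=
  (1 + 2 * lambda) * Rpower (7 + 2 * lambda) (3 / 2)
  / (36 * sqrt (3 * (9 - 4 * lambda ^ 2))).

(* Main.v *)
(** Restricting to the complex line through [x0], the scalar-type expansion makes
    [p(z) = T(DF(z x0)^-1 (D^2F(z x0)(z x0, x0) + DF(z x0) x0))] equal to [P/N + o(z^3)] with
    [N = 1 + 2 A2 z + 3 A3 z^2 + 4 A4 z^3] and [P = 1 + 4 A2 z + 9 A3 z^2 + 16 A4 z^3].
    With [m = 1 + 2 lambda], the class condition says that [omega = (p - 1)/(p - 1 + m)] is a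
    Schwarz function, and [J = -(m/12)(w3 + (2 + m/2) w1 w2 - n w1^3)] in its first coefficients,
    [n = (m - 2)(m + 1)/2].  The coefficients are controlled by
    [|[z^k](omega a^2)| <= sum |a_j|^2] for polynomials [a] of degree [< k] (a circle mean), which
    leaves an optimisation in two real variables with maximum [(2/3) P t], [P = 3 + m/2],
    at [t^2 = P/(3 (P - n))].

    Equality forces [omega = z (t - z)/(1 - t z)], i.e. [1 + z h'/h = p] with
    [h = (1 - 2 t z + z^2)^(-m/2)].  The extremal map is [F x = g(T x) x] with [z g(z)] the
    primitive of [h]; [g] has no zero because [z g(z)] is close-to-convex.

    Fréchet derivatives of a holomorphic map are again holomorphic by Cauchy's formula on circles,
    which rests on Goursat's lemma for vector-valued functions. *)
Require Import Defs.
From Stdlib Require Import Reals Lra Lia List Factorial ClassicalEpsilon FunctionalExtensionality ProofIrrelevance.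
From Stdlib Require Import PropExtensionality.
From Coquelicot Require Import Coquelicot.
From mathcomp Require classical_sets.
Open Scope R_scope.

(** The scalar-type hypothesis concerns only the Taylor terms at 0, so [DF(z x0)^-1] is not a scalar
    along the line and [T (DF(z x0)^-1 x0)] is unknown. The reduction succeeds because [DF(z x0) x0]
    is itself the derivative along the line: [T (DF(z x0)^-1 (DF(z x0) x0)) = 1], and this
    eliminates the unknown to the order needed. The coefficient inequalities use only [|omega| <= 1]
    off 0 and the expansion at 0. The test polynomials enter squared, so that the majorant is a
    Parseval sum; the phase of the quantity to be bounded is built into them. For the extremal map,
    [DF(x)] is [g(T x)] times the identity plus a rank-one operator, with eigenvalue [g(T x)] on the
    kernel of [T] and [h(T x)] on [x]. In dimension one only the second occurs; in higher dimension
    local biholomorphy also requires that [g] has no zero, and this is the delicate point. The range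
    [2 <= m <= 3] keeps [Q^(1 - m/2)], with [Q = 1 - 2 t z + z^2], in the right half-plane. A
    functional [T] with [T x0 = norm T = 1] comes from the Hahn-Banach theorem, proved here by
    Zorn's lemma. *)

Notation CV := C_NormedModule.

Notation "a *: v" := (@scal C_AbsRing _ a%C v) (at level 40, left associativity).

(** * Identities between linear combinations *)

Section LinearCombinations.

Context {V : NormedModule C_AbsRing}.

(** A syntax for linear combinations of vectors: comparing the coefficients of each atom turns a
    vector identity into identities in [C], where [ring] and [field] apply. Atoms are positions in
    an environment. *)
Inductive vexpr : Type :=
  | vvar (i : nat) | vzero | vplus (a b : vexpr) | vminus (a b : vexpr)
  | vopp (a : vexpr) | vscal (c : C) (a : vexpr).

Fixpoint veval (env : list V) (e : vexpr) : V :=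
  match e with
  | vvar i => nth i env zero
  | vzero => zero
  | vplus a b => plus (veval env a) (veval env b)
  | vminus a b => minus (veval env a) (veval env b)
  | vopp a => opp (veval env a)
  | vscal c a => c *: (veval env a)
  end.

Fixpoint vcoef (e : vexpr) (j : nat) : C :=
  match e with
  | vvar i => if Nat.eqb i j then RtoC 1 else RtoC 0
  | vzero => RtoC 0
  | vplus a b => (vcoef a j + vcoef b j)%C
  | vminus a b => (vcoef a j - vcoef b j)%C
  | vopp a => (- vcoef a j)%C
  | vscal c a => (c * vcoef a j)%C
  end.

Fixpoint lincomb (env : list V) (c : nat -> C) : V :=
  match env with
  | nil => zero
  | v :: env' => plus ((c O) *: v) (lincomb env' (fun j => c (S j)))
  end.

Lemma lincomb_plus (env : list V) (c d : nat -> C) :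
  lincomb env (fun j => (c j + d j)%C) = plus (lincomb env c) (lincomb env d).
Proof.
revert c d; induction env as [|v env IH]; intros c d; simpl.
- now rewrite plus_zero_r.
- rewrite IH.
  replace ((c O + d O) *: v)
    with (plus ((c O) *: v) ((d O) *: v))
    by (symmetry; exact (scal_distr_r (c O : C_AbsRing) (d O : C_AbsRing) v)).
  rewrite <- !plus_assoc; f_equal; rewrite plus_comm, <- plus_assoc; f_equal.
  apply plus_comm.
Qed.

Lemma lincomb_scal (env : list V) (a : C) (c : nat -> C) :
  lincomb env (fun j => (a * c j)%C) = a *: (lincomb env c).
Proof.
revert c; induction env as [|v env IH]; intros c; simpl.
- symmetry; exact (@scal_zero_r C_AbsRing V a).
- rewrite IH, scal_distr_l; f_equal.
  symmetry; exact (scal_assoc (a : C_AbsRing) (c O : C_AbsRing) v).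
Qed.

Lemma lincomb_ext (env : list V) (c d : nat -> C) :
  (forall j, c j = d j) -> lincomb env c = lincomb env d.
Proof.
revert c d; induction env as [|v env IH]; intros c d H; simpl; auto.
now rewrite H, (IH _ (fun j => d (S j))).
Qed.

Lemma lincomb_zero (env : list V) : lincomb env (fun _ => RtoC 0) = zero.
Proof.
induction env as [|v env IH]; simpl; auto.
rewrite IH, plus_zero_r; exact (scal_zero_l v).
Qed.

Lemma lincomb_var (env : list V) (i : nat) :
  lincomb env (fun j => if Nat.eqb i j then RtoC 1 else RtoC 0) = nth i env zero.
Proof.
revert i; induction env as [|v env IH]; intros [|i]; simpl; auto.
- rewrite lincomb_zero, plus_zero_r; exact (scal_one v).
- rewrite IH.
  replace ((RtoC 0) *: v) with (zero : V)
    by (symmetry; exact (scal_zero_l v)).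
  apply plus_zero_l.
Qed.

Lemma opp_scal (x : V) : opp x = (RtoC (-1)) *: x.
Proof.
transitivity ((opp one) *: x); [symmetry; exact (scal_opp_one x)|f_equal].
change (Copp (RtoC 1) = RtoC (-1)); now rewrite <- RtoC_opp.
Qed.

Lemma veval_lincomb (env : list V) (e : vexpr) : veval env e = lincomb env (vcoef e).
Proof.
induction e as [i| |a IHa b IHb|a IHa b IHb|a IHa|c a IHa]; simpl.
- symmetry; apply lincomb_var.
- symmetry; apply lincomb_zero.
- now rewrite lincomb_plus, IHa, IHb.
- unfold minus; rewrite IHa, IHb, opp_scal, <- lincomb_scal, <- lincomb_plus.
  apply lincomb_ext; intros j.
  change (RtoC (-1)) with (RtoC (- (1))); rewrite RtoC_opp; ring.
- rewrite IHa, opp_scal, <- lincomb_scal.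
  apply lincomb_ext; intros j.
  change (RtoC (-1)) with (RtoC (- (1))); rewrite RtoC_opp; ring.
- now rewrite lincomb_scal, IHa.
Qed.

Fixpoint same_coefs (env : list V) (c d : nat -> C) : Prop :=
  match env with
  | nil => True
  | _ :: env' => c O = d O /\ same_coefs env' (fun j => c (S j)) (fun j => d (S j))
  end.

Lemma veval_eq (env : list V) (a b : vexpr) :
  same_coefs env (vcoef a) (vcoef b) -> veval env a = veval env b.
Proof.
rewrite !veval_lincomb; generalize (vcoef a) (vcoef b); clear a b.
induction env as [|v env IH]; intros c d; simpl; auto.
intros [H1 H2]; now rewrite H1, (IH _ _ H2).
Qed.

End LinearCombinations.

Ltac vmem x l :=
  lazymatch l with
  | nil => constr:(false)
  | cons ?y ?l' =>
      match constr:(tt) with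
      | _ => let _ := match constr:(tt) with _ => constr_eq x y end in constr:(true)
      | _ => vmem x l'
      end
  end.

Ltac vatoms V l t :=
  lazymatch t with
  | @plus _ ?a ?b => let l1 := vatoms V l a in vatoms V l1 b
  | @minus _ ?a ?b => let l1 := vatoms V l a in vatoms V l1 b
  | @opp _ ?a => vatoms V l a
  | @scal _ _ _ ?a => vatoms V l a
  | @zero _ => l
  | _ => let m := vmem t l in
         lazymatch m with
         | true => l
         | false => constr:(@cons V t l)
         end
  end.

Ltac vindex x l :=
  lazymatch l with
  | cons ?y ?l' =>
      match constr:(tt) with
      | _ => let _ := match constr:(tt) with _ => constr_eq x y end in constr:(O)
      | _ => let n := vindex x l' in constr:(S n)
      end
  end.

Ltac vreify l t :=
  lazymatch t with
  | @plus _ ?a ?b => let a' := vreify l a in let b' := vreify l b in constr:(vplus a' b')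
  | @minus _ ?a ?b => let a' := vreify l a in let b' := vreify l b in constr:(vminus a' b')
  | @opp _ ?a => let a' := vreify l a in constr:(vopp a')
  | @scal _ _ ?c ?a => let a' := vreify l a in constr:(vscal c a')
  | @zero _ => constr:(vzero)
  | _ => let n := vindex t l in constr:(vvar n)
  end.

(* Reduces an identity between linear combinations to the equality of the
   coefficients of each vector. *)
Ltac vcoefs :=
  lazymatch goal with
  | |- @eq ?T ?a ?b =>
    match goal with
    | V : NormedModule C_AbsRing |- _ => unify T (NormedModule.sort C_AbsRing V); vcoefs_in V a b
    | V : CompleteNormedModule C_AbsRing |- _ =>
        let V' := constr:(CompleteNormedModule.NormedModule C_AbsRing V) in
        unify T (NormedModule.sort C_AbsRing V'); vcoefs_in V' a b
    end
  end
with vcoefs_in V a b :=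
  let l := vatoms V (@nil V) a in
  let l := vatoms V l b in
  let a' := vreify l a in
  let b' := vreify l b in
  change (@veval V l a' = @veval V l b');
  apply veval_eq;
  cbn [same_coefs vcoef Nat.eqb]; repeat split.

Ltac vring := vcoefs; ring.

(** [C] seen as a module over itself carries module operations that are only convertible to those of
    the field; [ring] and [field] recognise the latter. *)
Ltac cfold :=
  try match goal with |- @eq _ ?a ?b => change (@eq C a b) end;
  repeat match goal with
  | |- context [@scal ?K ?V ?a ?b] => change (@scal K V a b) with (Cmult a b)
  | |- context [@plus ?K ?a ?b] => change (@plus K a b) with (Cplus a b)
  | |- context [@minus ?K ?a ?b] => change (@minus K a b) with (Cminus a b)
  | |- context [@opp ?K ?a] => change (@opp K a) with (Copp a)
  | |- context [@mult ?K ?a ?b] => change (@mult K a b) with (Cmult a b)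
  | |- context [@zero ?K] => change (@zero K) with (RtoC 0)
  | |- context [@one ?K] => change (@one K) with (RtoC 1)
  end.

(** * Fréchet and complex derivatives *)

Lemma lt_div_mult (a b c : R) : 0 < b -> a < c / b -> a * b < c.
Proof.
intros Hb H; apply Rmult_lt_reg_r with (/ b); [now apply Rinv_0_lt_compat|].
rewrite Rmult_assoc, Rinv_r, Rmult_1_r by lra; exact H.
Qed.

(** The norm axiom is an inequality; used once for [a] and once for [/ a], it becomes an
    equality. *)
Lemma norm_scalC {V : NormedModule C_AbsRing} (a : C) (x : V) :
  norm (a *: x) = Cmod a * norm x.
Proof.
apply Rle_antisym; [exact (norm_scal (a : C_AbsRing) x)|].
destruct (Ceq_dec a (RtoC 0)) as [->|Ha].
- rewrite Cmod_0, Rmult_0_l; apply norm_ge_0.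
- assert (Hp : 0 < Cmod a) by now apply Cmod_gt_0.
  replace x with ((/ a) *: (a *: x)) at 1.
  + apply Rle_trans with (Cmod a * (Cmod (/ a) * norm (a *: x))).
    * apply Rmult_le_compat_l; [lra|]; exact (norm_scal (/ a : C_AbsRing)%C _).
    * rewrite Cmod_inv by assumption; right; field; lra.
  + vcoefs; field; assumption.
Qed.

Lemma norm_sub_sym {V : NormedModule C_AbsRing} (x y : V) :
  norm (minus x y) = norm (minus y x).
Proof. rewrite <- norm_opp; f_equal; vring. Qed.

Lemma norm_sub_triangle {V : NormedModule C_AbsRing} (x y z : V) :
  norm (minus x z) <= norm (minus x y) + norm (minus y z).
Proof.
replace (minus x z) with (plus (minus x y) (minus y z)) by vring.
apply norm_triangle.
Qed.

Lemma norm_le_sub {V : NormedModule C_AbsRing} (x y : V) :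
  norm x <= norm y + norm (minus x y).
Proof.
replace x with (plus y (minus x y)) at 1 by vring.
apply norm_triangle.
Qed.

Section Frechet.

Context {U V : NormedModule C_AbsRing}.

(** [filterdiff] in epsilon-delta form, measured by [norm] and with the linearity of [L] left out,
    since [L] is usually bundled as a [Lin]. *)
Definition fder (F : U -> V) (x : U) (L : U -> V) : Prop :=
  forall eps, 0 < eps -> exists d, 0 < d /\ forall y, norm (minus y x) < d ->
    norm (minus (minus (F y) (F x)) (L (minus y x))) <= eps * norm (minus y x).

Lemma filterdiff_fder (F : U -> V) (x : U) (L : U -> V) :
  filterdiff F (locally x) L -> fder F x L.
Proof.
intros [HL H] eps He.
specialize (H x (fun P HP => HP) (mkposreal eps He)).
destruct (locally_norm_le_locally x _ H) as [d Hd].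
exists d; split; [apply cond_pos|]; intros y Hy; exact (Hd y Hy).
Qed.

Lemma fder_filterdiff (F : U -> V) (x : U) (L : U -> V) :
  is_linear L -> fder F x L -> filterdiff F (locally x) L.
Proof.
intros HL H; split; [exact HL|].
intros x' Hx' eps.
(* [filterdiff] quantifies over every limit [x'] of the filter; a neighbourhood filter has only
   one. *)
assert (E : x' = x).
{ symmetry; apply (is_filter_lim_locally_unique (K := C_AbsRing) (V := U) x x' Hx'). }
subst x'.
apply locally_le_locally_norm.
destruct (H eps (cond_pos eps)) as [d [Hd Hy]].
exists (mkposreal d Hd); intros y; apply Hy.
Qed.

Lemma fder_ext (F G : U -> V) (x : U) (L : U -> V) (r : R) : 0 < r ->
  (forall y, norm (minus y x) < r -> F y = G y) -> fder F x L -> fder G x L.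
Proof.
intros Hr E H eps He; destruct (H eps He) as [d [Hd K]].
exists (Rmin d r); split; [now apply Rmin_glb_lt|].
intros y Hy; rewrite <- !E.
- apply K; eapply Rlt_le_trans; [exact Hy|apply Rmin_l].
- replace (minus x x) with (zero : U) by vring; now rewrite norm_zero.
- eapply Rlt_le_trans; [exact Hy|apply Rmin_r].
Qed.

Lemma fder_continuous (F : U -> V) (x : U) (L : Lin U V) : fder F x L ->
  forall eps, 0 < eps -> exists d, 0 < d /\ forall y, norm (minus y x) < d ->
    norm (minus (F y) (F x)) < eps.
Proof.
intros H eps He; destruct (H 1 Rlt_0_1) as [d [Hd K]].
pose proof (norm_ge_0 L) as HL; set (M := norm L) in *.
assert (H0 : 0 < eps / (M + 2)) by (apply Rdiv_lt_0_compat; lra).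
exists (Rmin d (eps / (M + 2))); split; [now apply Rmin_glb_lt|].
intros y Hy.
apply Rle_lt_trans with (1 := norm_le_sub _ (L (minus y x))).
assert (H1 := K y (Rlt_le_trans _ _ _ Hy (Rmin_l _ _))).
assert (H2 := Rlt_le_trans _ _ _ Hy (Rmin_r _ _)).
assert (H3 := Lin_norm_apply L (minus y x)); change (Lin_norm L) with M in H3.
apply Rle_lt_trans with ((M + 1) * norm (minus y x)); [lra|].
apply Rle_lt_trans with ((M + 1) * (eps / (M + 2))); [apply Rmult_le_compat_l; lra|].
apply Rmult_lt_reg_r with (M + 2); [lra|].
replace ((M + 1) * (eps / (M + 2)) * (M + 2)) with ((M + 1) * eps) by (field; lra).
nra.
Qed.

End Frechet.

Lemma frechet_fder {U V : NormedModule C_AbsRing} (F : U -> V) (x : U) :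
  (exists L : Lin U V, fder F x L) -> fder F x (frechet F x).
Proof.
intros [L HL]; apply filterdiff_fder; unfold frechet.
apply (epsilon_spec (inhabits Lin_zero) (fun L : Lin U V => filterdiff F (locally x) L)).
exists L; apply fder_filterdiff; [apply lin_prop|exact HL].
Qed.

Lemma is_linear_smul {V : NormedModule C_AbsRing} (v : V) :
  is_linear (U := CV) (fun a : C => a *: v).
Proof.
split.
- intros a b; exact (scal_distr_r (a : C_AbsRing) (b : C_AbsRing) v).
- intros a b; symmetry; exact (scal_assoc (a : C_AbsRing) (b : C_AbsRing) v).
- exists (norm v + 1); split; [pose proof (norm_ge_0 v); lra|].
  intros a; change (norm (a *: v) <= (norm v + 1) * Cmod a).
  rewrite norm_scalC; pose proof (Cmod_ge_0 a); lra.
Qed.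

Definition lin_smul {V : NormedModule C_AbsRing} (v : V) : Lin C_NormedModule V :=
  mkLin (U := CV) _ (is_linear_smul v).

Section ComplexDerivative.

Context {V : NormedModule C_AbsRing}.

Definition cder (f : C -> V) (z : C) (l : V) : Prop :=
  forall eps, 0 < eps -> exists d, 0 < d /\ forall w : C, Cmod (w - z) < d ->
    norm (minus (minus (f w) (f z)) ((w - z) *: l)) <= eps * Cmod (w - z).

Lemma cder_is_derive (f : C -> V) (z : C) (l : V) :
  cder f z l <-> is_derive (K := C_AbsRing) f z l.
Proof.
split; intros H.
- apply (fder_filterdiff (U := AbsRing_NormedModule C_AbsRing)); [|exact H].
  apply (is_linear_scal_l (K := C_AbsRing) (V := V)).
- exact (filterdiff_fder (U := AbsRing_NormedModule C_AbsRing) _ _ _ H).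
Qed.

Lemma cder_eq (f : C -> V) (z : C) (l m : V) : cder f z l -> l = m -> cder f z m.
Proof. now intros H <-. Qed.

Lemma cder_const (v : V) (z : C) : cder (fun _ => v) z zero.
Proof. apply cder_is_derive; exact (is_derive_const (K := C_AbsRing) v z). Qed.

Lemma cder_plus (f g : C -> V) (z : C) (l m : V) :
  cder f z l -> cder g z m -> cder (fun w => plus (f w) (g w)) z (plus l m).
Proof.
rewrite !cder_is_derive; exact (is_derive_plus (K := C_AbsRing) f g z l m).
Qed.

Lemma cder_minus (f g : C -> V) (z : C) (l m : V) :
  cder f z l -> cder g z m -> cder (fun w => minus (f w) (g w)) z (minus l m).
Proof.
rewrite !cder_is_derive; exact (is_derive_minus (K := C_AbsRing) f g z l m).
Qed.

Lemma cder_ext (f g : C -> V) (z : C) (l : V) (r : R) : 0 < r ->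
  (forall w : C, Cmod (w - z) < r -> f w = g w) -> cder f z l -> cder g z l.
Proof.
intros Hr E; exact (fder_ext (U := AbsRing_NormedModule C_AbsRing) f g z
  (fun y : C_AbsRing => scal y l) r Hr E).
Qed.

Lemma cder_continuous (f : C -> V) (z : C) (l : V) : cder f z l ->
  forall eps, 0 < eps -> exists d, 0 < d /\ forall w : C, Cmod (w - z) < d ->
    norm (minus (f w) (f z)) < eps.
Proof.
intros H eps He.
exact (fder_continuous (U := CV) f z (lin_smul l) H eps He).
Qed.

(** Both candidates are tested on one real increment [t] below the two radii, which gives
    [t * norm (l - m) <= t * eps]. *)
Lemma cder_unique (f : C -> V) (z : C) (l m : V) : cder f z l -> cder f z m -> l = m.
Proof.
intros Hl Hm.
assert (E : minus l m = zero).
2:{ replace l with (plus m (minus l m)) by vring; rewrite E; vring. }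
apply norm_eq_zero, Rle_antisym; [|apply norm_ge_0].
apply le_epsilon; intros eps He.
destruct (Hl (eps / 2)) as [d1 [Hd1 K1]]; [lra|].
destruct (Hm (eps / 2)) as [d2 [Hd2 K2]]; [lra|].
set (t := Rmin d1 d2 / 2).
assert (Ht : 0 < Rmin d1 d2) by now apply Rmin_glb_lt.
assert (Et : Cmod ((z + RtoC t) - z) = t).
{ replace (z + RtoC t - z)%C with (RtoC t) by ring; rewrite Cmod_R; apply Rabs_pos_eq.
  unfold t; lra. }
pose proof (Rmin_l d1 d2); pose proof (Rmin_r d1 d2).
specialize (K1 (z + RtoC t)%C); specialize (K2 (z + RtoC t)%C); rewrite Et in K1, K2.
assert (Q1 := K1 ltac:(unfold t; lra)); assert (Q2 := K2 ltac:(unfold t; lra)).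
assert (Q : t * norm (minus l m) <= t * eps).
{ rewrite <- Et at 1; rewrite <- norm_scalC.
  set (df := minus (f (z + RtoC t)%C) (f z)) in *; set (s := (z + RtoC t - z)%C) in *.
  replace (s *: (minus l m))
    with (minus (minus df (s *: m)) (minus df (s *: l))) by vring.
  apply Rle_trans with (norm (minus df (s *: m)) + norm (minus df (s *: l))).
  - unfold minus at 1; rewrite <- (norm_opp (minus df (s *: l))); apply norm_triangle.
  - lra. }
rewrite Rplus_0_l; apply Rmult_le_reg_l with t; [unfold t; lra|exact Q].
Qed.

End ComplexDerivative.

Notation cderC := (cder (V := CV)).

Lemma cder_lin {V W : NormedModule C_AbsRing} (T : Lin V W) (f : C -> V) (z : C) (l : V) :
  cder f z l -> cder (fun w => T (f w)) z (T l).
Proof.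
intros H eps He.
pose proof (norm_ge_0 T) as HM; set (M := norm T) in *.
destruct (H (eps / (M + 1))) as [d [Hd K]]; [apply Rdiv_lt_0_compat; lra|].
exists d; split; [exact Hd|]; intros w Hw.
replace (minus (minus (T (f w)) (T (f z))) ((w - z) *: (T l)))
  with (T (minus (minus (f w) (f z)) ((w - z) *: l))).
2:{ unfold minus; rewrite !(linear_plus _ (lin_prop T)), !(linear_opp _ _ (lin_prop T)).
    now rewrite (linear_scal _ (lin_prop T)). }
apply Rle_trans with (1 := Lin_norm_apply T _); change (Lin_norm T) with M.
apply Rle_trans with (M * (eps / (M + 1) * Cmod (w - z))).
- apply Rmult_le_compat_l; auto.
- apply Rmult_le_reg_r with (M + 1); [lra|].
  replace (M * (eps / (M + 1) * Cmod (w - z)) * (M + 1)) with (M * (eps * Cmod (w - z))) by (field; lra).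
  pose proof (Cmod_ge_0 (w - z)); assert (0 <= eps * Cmod (w - z)) by nra; nra.
Qed.

Lemma Cmod_ball_sub (z w : C) : Cmod w <= Cmod z + Cmod (w - z).
Proof. replace w with (z + (w - z))%C at 1 by ring; apply Cmod_triangle. Qed.

Lemma cder_id (z : C) : cderC (fun w => w) z (RtoC 1).
Proof.
intros eps He; exists 1; split; [lra|]; intros w _.
change (Cmod ((w - z) - (w - z) * RtoC 1) <= eps * Cmod (w - z)).
replace ((w - z) - (w - z) * RtoC 1)%C with (RtoC 0) by ring.
rewrite Cmod_0; pose proof (Cmod_ge_0 (w - z)); nra.
Qed.

Lemma cder_scal {V : NormedModule C_AbsRing} (u : C -> C) (f : C -> V) (z u' : C) (l : V) :
  cderC u z u' -> cder f z l ->
  cder (fun w => (u w) *: (f w)) z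
    (plus (u' *: (f z)) ((u z) *: l)).
Proof.
intros Hu Hf.
assert (Hu' : is_derive (K := C_AbsRing) (V := AbsRing_NormedModule C_AbsRing) u z u').
{ apply cder_is_derive; exact Hu. }
apply cder_is_derive in Hf; apply cder_is_derive.
assert (Q := filterdiff_scal_fct (K := C_AbsRing) (U := AbsRing_NormedModule C_AbsRing) (V := V)
  z u f _ _ (Cmult_comm : forall n m : C_AbsRing, mult n m = mult m n) Hu' Hf).
unfold is_derive; eapply filterdiff_ext_lin; [exact Q|].
intros y; simpl.
change (plus ((y * u') *: (f z)) ((u z) *: (y *: l))
 = y *: (plus (u' *: (f z)) ((u z) *: l))).
vring.
Qed.

Lemma cder_comp {V : NormedModule C_AbsRing} (f : C -> V) (u : C -> C) (z u' : C) (l : V) :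
  cder f (u z) l -> cderC u z u' ->
  cder (fun w => f (u w)) z (u' *: l).
Proof.
intros Hf Hu; apply cder_is_derive; apply cder_is_derive in Hf.
apply (is_derive_comp (K := C_AbsRing) f u z l u' Hf).
apply cder_is_derive; exact Hu.
Qed.

Lemma cder_line {U V : NormedModule C_AbsRing} (F : U -> V) (x h : U) (z : C) (L : Lin U V) :
  fder F (plus x (z *: h)) L ->
  cder (fun w => F (plus x (w *: h))) z (L h).
Proof.
intros H eps He.
pose proof (norm_ge_0 h) as Hh.
destruct (H (eps / (norm h + 1))) as [d [Hd K]]; [apply Rdiv_lt_0_compat; lra|].
exists (d / (norm h + 1)); split; [apply Rdiv_lt_0_compat; lra|]; intros w Hw.
assert (E : minus (plus x (w *: h)) (plus x (z *: h))
   = (w - z) *: h) by vring.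
specialize (K (plus x (w *: h))); rewrite E, norm_scalC in K.
pose proof (Cmod_ge_0 (w - z)) as Hc.
assert (Hw' : Cmod (w - z) * (norm h + 1) < d).
{ apply lt_div_mult; [lra|exact Hw]. }
assert (Q := K ltac:(nra)).
rewrite (linear_scal _ (lin_prop L)) in Q.
apply Rle_trans with (1 := Q).
apply Rmult_le_reg_r with (norm h + 1); [lra|].
replace (eps / (norm h + 1) * (Cmod (w - z) * norm h) * (norm h + 1))
  with (eps * (Cmod (w - z) * norm h)) by (field; lra).
assert (0 <= eps * Cmod (w - z)) by nra; nra.
Qed.

(** * Integrals of vector-valued functions of a real variable *)

Section RealRestriction.

Variable V : NormedModule C_AbsRing.

(** Restriction of scalars: Riemann integrals of curves live in modules over [R], so [V] receives
    real scalars while its norm and uniform structure stay the same. *)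
Definition real_scal (r : R) (v : V) : V := (RtoC r) *: v.

Lemma real_ModuleSpace_mixin : ModuleSpace.mixin_of R_Ring (NormedModule.AbelianGroup C_AbsRing V).
Proof.
refine (ModuleSpace.Mixin R_Ring (NormedModule.AbelianGroup C_AbsRing V) real_scal _ _ _ _); unfold real_scal.
- intros x y u; change (mult x y) with (x * y); rewrite RtoC_mult.
  exact (scal_assoc (RtoC x : C_AbsRing) (RtoC y : C_AbsRing) (u : V)).
- intros u; exact (scal_one (u : V)).
- intros x u v; exact (scal_distr_l (RtoC x : C_AbsRing) (u : V) v).
- intros x y u; change (plus x y) with (x + y); rewrite RtoC_plus.
  exact (scal_distr_r (RtoC x : C_AbsRing) (RtoC y : C_AbsRing) (u : V)).
Defined.

Definition real_NormedModuleAux : NormedModuleAux R_AbsRing :=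
  NormedModuleAux.Pack R_AbsRing V
    (NormedModuleAux.Class R_AbsRing V
       (ModuleSpace.Class R_Ring V (AbelianGroup.class (NormedModule.AbelianGroup C_AbsRing V)) real_ModuleSpace_mixin)
       (UniformSpace.class (NormedModule.UniformSpace C_AbsRing V))) V.

Definition real_NormedModule_mixin : NormedModule.mixin_of R_AbsRing real_NormedModuleAux.
Proof.
refine (NormedModule.Mixin R_AbsRing real_NormedModuleAux (@norm C_AbsRing V) (@norm_factor C_AbsRing V) _ _ _ _ _).
- exact (@norm_triangle C_AbsRing V).
- intros r v; change (norm ((RtoC r) *: (v : V)) <= Rabs r * norm (v : V)).
  rewrite norm_scalC, Cmod_R; lra.
- exact (@norm_compat1 C_AbsRing V).
- exact (@norm_compat2 C_AbsRing V).
- exact (@norm_eq_zero C_AbsRing V).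
Defined.

Definition real_NormedModule : NormedModule R_AbsRing :=
  NormedModule.Pack R_AbsRing V
    (NormedModule.Class R_AbsRing V (NormedModuleAux.class R_AbsRing real_NormedModuleAux) real_NormedModule_mixin) V.

(** Completeness is carried as separate data, because the iterated operator spaces [MLin U V n] are
    plain normed modules whose completeness is proved in [MLin_complete]. *)
Definition completion_data : Type := CompleteSpace.mixin_of (NormedModule.UniformSpace C_AbsRing V).

Definition real_CompleteNormedModule (Vc : completion_data) : CompleteNormedModule R_AbsRing :=
  CompleteNormedModule.Pack R_AbsRing V
    (CompleteNormedModule.Class R_AbsRing V (NormedModule.class R_AbsRing real_NormedModule) Vc) V.

End RealRestriction.

Section Integral.

Context {V : NormedModule C_AbsRing}.

Definition is_int (f : R -> V) (a b : R) (l : V) : Prop :=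
  is_RInt (V := real_NormedModule V) f a b l.

Definition cont_at (f : R -> V) (t : R) : Prop :=
  forall eps, 0 < eps -> exists d, 0 < d /\ forall u, Rabs (u - t) < d -> norm (minus (f u) (f t)) < eps.

Lemma cont_at_continuous (f : R -> V) (t : R) :
  cont_at f t -> continuous (U := real_NormedModule V) f t.
Proof.
intros H P [eps HP].
destruct (H eps (cond_pos eps)) as [d [Hd K]].
exists (mkposreal d Hd); intros u Hu; apply HP.
apply (norm_compat1 (K := C_AbsRing) (V := V)); apply K; exact Hu.
Qed.

Lemma int_exists (Vc : completion_data V) (f : R -> V) (a b : R) :
  (forall t, Rmin a b <= t <= Rmax a b -> cont_at f t) -> exists l, is_int f a b l.
Proof.
intros H.
destruct (ex_RInt_continuous (V := real_CompleteNormedModule V Vc) f a b) as [l Hl].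
- intros t Ht; apply cont_at_continuous; auto.
- exists l; exact Hl.
Qed.

Lemma int_unique (Vc : completion_data V) (f : R -> V) (a b : R) (l m : V) :
  is_int f a b l -> is_int f a b m -> l = m.
Proof.
intros H1 H2.
rewrite <- (is_RInt_unique (V := real_CompleteNormedModule V Vc) f a b l H1).
exact (is_RInt_unique (V := real_CompleteNormedModule V Vc) f a b m H2).
Qed.

Lemma int_ext (f g : R -> V) (a b : R) (l : V) :
  (forall t, Rmin a b < t < Rmax a b -> f t = g t) -> is_int f a b l -> is_int g a b l.
Proof. exact (is_RInt_ext (V := real_NormedModule V) f g a b l). Qed.

Lemma int_plus (f g : R -> V) (a b : R) (l m : V) :
  is_int f a b l -> is_int g a b m -> is_int (fun t => plus (f t) (g t)) a b (plus l m).
Proof. exact (is_RInt_plus (V := real_NormedModule V) f g a b l m). Qed.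

Lemma int_minus (f g : R -> V) (a b : R) (l m : V) :
  is_int f a b l -> is_int g a b m -> is_int (fun t => minus (f t) (g t)) a b (minus l m).
Proof. exact (is_RInt_minus (V := real_NormedModule V) f g a b l m). Qed.

Lemma int_const (v : V) (a b : R) :
  is_int (fun _ => v) a b ((RtoC (b - a)) *: v).
Proof. exact (is_RInt_const (V := real_NormedModule V) a b v). Qed.

Lemma int_Chasles (f : R -> V) (a b c : R) (l m : V) :
  is_int f a b l -> is_int f b c m -> is_int f a c (plus l m).
Proof. exact (is_RInt_Chasles (V := real_NormedModule V) f a b c l m). Qed.

Lemma int_norm_le (f : R -> V) (a b M : R) (l : V) : a <= b ->
  (forall t, a <= t <= b -> norm (f t) <= M) -> is_int f a b l -> norm l <= (b - a) * M.
Proof. exact (norm_RInt_le_const (V := real_NormedModule V) f a b l M). Qed.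

Lemma cder_real (f : C -> V) (u : R -> C) (t : R) (c : C) (l : V) :
  (forall s, (u s = u t + RtoC (s - t) * c)%C) ->
  cder f (u t) l -> is_derive (V := real_NormedModule V) (fun s => f (u s)) t (c *: l).
Proof.
intros Hu H; split; [exact (is_linear_scal_l (K := R_AbsRing) (V := real_NormedModule V) _)|].
intros x Hx.
assert (E : x = t).
{ symmetry; exact (is_filter_lim_locally_unique (K := R_AbsRing) (V := R_NormedModule) t x Hx). }
subst x.
intros eps; pose proof (Cmod_ge_0 c) as Hc.
destruct (H (eps / (Cmod c + 1))) as [d [Hd K]].
{ apply Rdiv_lt_0_compat; [apply cond_pos|lra]. }
assert (Hd' : 0 < d / (Cmod c + 1)) by (apply Rdiv_lt_0_compat; lra).
exists (mkposreal _ Hd'); intros s Hs.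
assert (Hs' : Rabs (s - t) * (Cmod c + 1) < d).
{ apply lt_div_mult; [lra|exact Hs]. }
assert (E : (u s - u t = RtoC (s - t) * c)%C) by (rewrite (Hu s); ring).
specialize (K (u s)); rewrite E, Cmod_mult, Cmod_R in K.
pose proof (Rabs_pos (s - t)) as Hp.
change (norm (minus (minus (f (u s)) (f (u t))) ((RtoC (s - t)) *: (c *: l)))
  <= eps * Rabs (s - t)).
replace ((RtoC (s - t)) *: (c *: l))
  with ((RtoC (s - t) * c) *: l) by vring.
apply Rle_trans with (1 := K ltac:(nra)).
apply Rmult_le_reg_r with (Cmod c + 1); [lra|].
replace (eps / (Cmod c + 1) * (Rabs (s - t) * Cmod c) * (Cmod c + 1))
  with (eps * (Rabs (s - t) * Cmod c)) by (field; lra).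
pose proof (cond_pos eps); assert (0 <= eps * Rabs (s - t)) by nra; nra.
Qed.

Lemma cder_cont_at (f : C -> V) (u : R -> C) (t : R) (c : C) (l : V) :
  (forall s, (u s = u t + RtoC (s - t) * c)%C) -> cder f (u t) l -> cont_at (fun s => f (u s)) t.
Proof.
intros Hu H eps He; pose proof (Cmod_ge_0 c) as Hc.
destruct (cder_continuous f _ l H eps He) as [d [Hd K]].
exists (d / (Cmod c + 1)); split; [apply Rdiv_lt_0_compat; lra|].
intros s Hs; apply K.
replace (u s - u t)%C with (RtoC (s - t) * c)%C by (rewrite (Hu s); ring).
rewrite Cmod_mult, Cmod_R.
assert (Hs' : Rabs (s - t) * (Cmod c + 1) < d).
{ apply lt_div_mult; [lra|exact Hs]. }
pose proof (Rabs_pos (s - t)); nra.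
Qed.

(** Fundamental theorem of calculus along a path of constant velocity [c]; the differentiability of
    [g] supplies the continuity of the integrand. *)
Lemma int_derive (Vc : completion_data V) (f g : C -> V) (u : R -> C) (a b : R) (c : C) :
  (forall s t, (u s = u t + RtoC (s - t) * c)%C) ->
  (forall t, Rmin a b <= t <= Rmax a b -> cder f (u t) (g (u t))) ->
  (forall t, Rmin a b <= t <= Rmax a b -> exists l, cder g (u t) l) ->
  is_int (fun t => c *: (g (u t))) a b (minus (f (u b)) (f (u a))).
Proof.
intros Hu Hf Hg.
apply (is_RInt_derive (V := real_CompleteNormedModule V Vc) (fun t => f (u t)) (fun t => c *: (g (u t)))).
- intros t Ht; apply cder_real; auto.
- intros t Ht; apply cont_at_continuous; destruct (Hg t Ht) as [l Hl].
  apply (cder_cont_at (fun z => c *: (g z)) u t c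
     (plus ((RtoC 0) *: (g (u t))) (c *: l))); [auto|].
  apply (cder_scal (fun _ => c) g); [|exact Hl].
  exact (cder_const (V := CV) c (u t)).
Qed.

End Integral.

(** [T] commutes with every Riemann sum by linearity, and its boundedness carries this over to the
    limit. *)
Lemma int_lin {U V : NormedModule C_AbsRing} (T : Lin U V) (f : R -> U) (a b : R) (l : U) :
  is_int f a b l -> is_int (fun t => T (f t)) a b (T l).
Proof.
intros H.
assert (HT : forall r v, T ((RtoC r) *: v) = (RtoC r) *: (T v)).
{ intros r v; apply (linear_scal _ (lin_prop T)). }
assert (E : forall s : SF_seq, Riemann_sum (V := real_NormedModule V) (fun t => T (f t)) s
   = T (Riemann_sum (V := real_NormedModule U) f s)).
{ intros s; induction s as [x|h s IH] using SF_cons_ind.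
  - symmetry; exact (linear_zero _ (lin_prop T)).
  - rewrite !Riemann_sum_cons.
    transitivity (plus (T ((RtoC (SF_h s - fst h)) *: (f (snd h))))
                       (T (Riemann_sum (V := real_NormedModule U) f s))).
    + rewrite HT, <- IH; reflexivity.
    + symmetry; apply (linear_plus _ (lin_prop T)). }
unfold is_int, is_RInt.
eapply filterlim_ext; [intros s; symmetry|].
{ rewrite E; symmetry; exact (HT _ _). }
refine (filterlim_comp _ _ _ _ (fun v => T v) _ _ _ H _).
intros P [eps HP].
apply (locally_le_locally_norm (K := C_AbsRing) (V := U) l).
pose proof (norm_ge_0 T) as HM.
assert (He : 0 < eps / (norm T + 1)) by (apply Rdiv_lt_0_compat; [apply cond_pos|lra]).
exists (mkposreal _ He); intros y Hy; apply HP.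
apply (norm_compat1 (K := C_AbsRing) (V := V)).
change (norm (minus y l) < eps / (norm T + 1)) in Hy.
apply Rle_lt_trans with (norm T * norm (minus y l)).
- assert (E2 : minus (T y) (T l) = T (minus y l)).
  { unfold minus; rewrite (linear_plus _ (lin_prop T)), (linear_opp _ _ (lin_prop T)); reflexivity. }
  rewrite E2; apply Lin_norm_apply.
- assert (norm (minus y l) * (norm T + 1) < eps).
  { apply lt_div_mult; [lra|exact Hy]. }
  pose proof (norm_ge_0 (minus y l)); nra.
Qed.

Lemma is_linear_cscal {V : NormedModule C_AbsRing} (c : C) :
  is_linear (fun v : V => c *: v).
Proof. apply is_linear_scal_r; exact Cmult_comm. Qed.

Lemma int_scal {V : NormedModule C_AbsRing} (c : C) (f : R -> V) (a b : R) (l : V) :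
  is_int f a b l -> is_int (fun t => c *: (f t)) a b (c *: l).
Proof. exact (int_lin (mkLin _ (is_linear_cscal c)) f a b l). Qed.

(** * Bisection, the mean value inequality and Goursat's lemma *)

Lemma nested_point (x : nat -> R) (w : R) : 0 <= w ->
  (forall n, x (S n) = x n \/ x (S n) = x n + w / 2 ^ S n) ->
  exists p, forall n, x n <= p <= x n + w / 2 ^ n.
Proof.
intros Hw Hx.
assert (Hs : forall n, 0 <= w / 2 ^ n).
{ intros n; apply Rmult_le_pos; [lra|]; left; apply Rinv_0_lt_compat, pow_lt; lra. }
assert (Hh : forall n, w / 2 ^ n = 2 * (w / 2 ^ S n)).
{ intros n; simpl; field; apply pow_nonzero; lra. }
assert (Hn : forall n k, x n <= x (n + k)%nat /\ x (n + k)%nat + w / 2 ^ (n + k) <= x n + w / 2 ^ n).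
{ intros n k; induction k as [|k IH].
  - rewrite Nat.add_0_r; lra.
  - rewrite Nat.add_succ_r.
    generalize (Hx (n + k)%nat) (Hs (S (n + k))%nat) (Hh (n + k)%nat); intros [E|E] H1 H2; rewrite E; lra. }
assert (Hb : forall n m, x m <= x n + w / 2 ^ n).
{ intros n m; destruct (Nat.le_ge_cases n m) as [H|H].
  - replace m with (n + (m - n))%nat by lia.
    destruct (Hn n (m - n)%nat) as [_ H2]; generalize (Hs (n + (m - n))%nat); lra.
  - replace n with (m + (n - m))%nat by lia.
    destruct (Hn m (n - m)%nat) as [H2 _]; generalize (Hs (m + (n - m))%nat); lra. }
destruct (completeness (fun r => exists n, r = x n)) as [p [Hp1 Hp2]].
- exists (x O + w / 2 ^ O); intros r [n ->]; apply Hb.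
- exists (x O); now exists O.
- exists p; intros n; split.
  + apply Hp1; now exists n.
  + apply Hp2; intros r [m ->]; apply Hb.
Qed.

(** If [P] failed on a rectangle it would fail on one of its quarters, and so on; the nested bad
    rectangles shrink to a point [(p, q)], contradicting local validity there. A zero height turns
    this into bisection of an interval, so one principle serves both the mean value inequality and
    Goursat's lemma. *)
Lemma bisection (P : R -> R -> R -> R -> Prop) (a b w h : R) : 0 <= w -> 0 <= h ->
  (forall x y u v, a <= x -> 0 <= u -> x + 2 * u <= a + w -> b <= y -> 0 <= v -> y + 2 * v <= b + h ->
     P x y u v -> P (x + u) y u v -> P x (y + v) u v -> P (x + u) (y + v) u v ->
     P x y (2 * u) (2 * v)) ->
  (forall p q, a <= p <= a + w -> b <= q <= b + h -> exists d, 0 < d /\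
     forall x y u v, a <= x -> 0 <= u -> x + u <= a + w -> b <= y -> 0 <= v -> y + v <= b + h ->
       x <= p <= x + u -> y <= q <= y + v -> u < d -> v < d -> P x y u v) ->
  P a b w h.
Proof.
intros Hw Hh Hq Hl.
apply NNPP; intros HP.
assert (Hs : forall r n, 0 <= r -> 0 <= r / 2 ^ n).
{ intros r n Hr; apply Rmult_le_pos; [lra|]; left; apply Rinv_0_lt_compat, pow_lt; lra. }
assert (Hhalf : forall r n, r / 2 ^ n = 2 * (r / 2 ^ S n)).
{ intros r n; simpl; field; apply pow_nonzero; lra. }
(* [Q n s s']: [s'] is the corner of one of the four quarters at stage [n], and [P] fails on that
   quarter. Choosing such an [s'] iterates the subdivision. *)
pose (Q := fun (n : nat) (s s' : R * R) =>
  (fst s' = fst s \/ fst s' = fst s + w / 2 ^ S n) /\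
  (snd s' = snd s \/ snd s' = snd s + h / 2 ^ S n) /\
  ~ P (fst s') (snd s') (w / 2 ^ S n) (h / 2 ^ S n)).
pose (s := fix s (n : nat) : R * R :=
  match n with O => (a, b) | S m => epsilon (inhabits (a, b)) (Q m (s m)) end).
assert (Inv : forall n, (a <= fst (s n) /\ fst (s n) + w / 2 ^ n <= a + w) /\
   (b <= snd (s n) /\ snd (s n) + h / 2 ^ n <= b + h) /\ ~ P (fst (s n)) (snd (s n)) (w / 2 ^ n) (h / 2 ^ n)
   /\ Q n (s n) (s (S n))).
{ assert (Step : forall n, a <= fst (s n) -> fst (s n) + w / 2 ^ n <= a + w ->
    b <= snd (s n) -> snd (s n) + h / 2 ^ n <= b + h ->
    ~ P (fst (s n)) (snd (s n)) (w / 2 ^ n) (h / 2 ^ n) -> Q n (s n) (s (S n))).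
  { intros n H1 H2 H3 H4 H5.
    apply (epsilon_spec (inhabits (a, b)) (Q n (s n))).
    apply NNPP; intros HQ; apply H5.
    rewrite (Hhalf w), (Hhalf h); rewrite (Hhalf w) in H2; rewrite (Hhalf h) in H4.
    assert (HQ' : forall x y, (x = fst (s n) \/ x = fst (s n) + w / 2 ^ S n) ->
       (y = snd (s n) \/ y = snd (s n) + h / 2 ^ S n) -> P x y (w / 2 ^ S n) (h / 2 ^ S n)).
    { intros x y Ex Ey; apply NNPP; intros HPx; apply HQ; exists (x, y); unfold Q; simpl fst; simpl snd; tauto. }
    apply Hq; auto. }
  induction n as [|n IH].
  - assert (E : forall r, r / 2 ^ 0 = r) by (intros; simpl; field).
    assert (H0 : ~ P (fst (s O)) (snd (s O)) (w / 2 ^ 0) (h / 2 ^ 0)) by (rewrite !E; exact HP).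
    assert (K : a <= a /\ a + w / 2 ^ 0 <= a + w) by (rewrite E; lra).
    assert (K' : b <= b /\ b + h / 2 ^ 0 <= b + h) by (rewrite E; lra).
    repeat split; try apply K; try apply K'; try exact H0; apply Step; simpl fst; simpl snd; try apply K; try apply K'; exact H0.
  - destruct IH as [[H1 H2] [[H3 H4] [_ [Q1 [Q2 Q3]]]]].
    assert (G1 : a <= fst (s (S n)) /\ fst (s (S n)) + w / 2 ^ S n <= a + w).
    { generalize (Hhalf w n) (Hs w (S n) Hw); destruct Q1 as [-> | ->]; lra. }
    assert (G2 : b <= snd (s (S n)) /\ snd (s (S n)) + h / 2 ^ S n <= b + h).
    { generalize (Hhalf h n) (Hs h (S n) Hh); destruct Q2 as [-> | ->]; lra. }
    split; [exact G1|]; split; [exact G2|]; split; [exact Q3|].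
    apply Step; tauto. }
destruct (nested_point (fun n => fst (s n)) w Hw) as [p Hp].
{ intros n; apply (Inv n). }
destruct (nested_point (fun n => snd (s n)) h Hh) as [q Hq'].
{ intros n; apply (Inv n). }
destruct (Hl p q) as [d [Hd Hloc]].
{ generalize (Hp O); simpl; lra. }
{ generalize (Hq' O); simpl; lra. }
assert (Hsmall : exists n, w / 2 ^ n < d /\ h / 2 ^ n < d).
{ destruct (Pow_x_infinity 2 ltac:(rewrite Rabs_pos_eq; lra) ((w + h) / d + 1)) as [n Hn].
  exists n; specialize (Hn n (le_n n)).
  rewrite Rabs_pos_eq in Hn by (left; apply pow_lt; lra).
  assert (H2 : 0 < 2 ^ n) by (apply pow_lt; lra).
  assert (H3 : w + h < 2 ^ n * d).
  { replace (w + h) with ((w + h) / d * d) by (field; lra); nra. }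
  split; apply Rmult_lt_reg_r with (2 ^ n); auto.
  - replace (w / 2 ^ n * 2 ^ n) with w by (field; lra); lra.
  - replace (h / 2 ^ n * 2 ^ n) with h by (field; lra); lra. }
destruct Hsmall as [n [Hn1 Hn2]].
destruct (Inv n) as [[H1 H2] [[H3 H4] [H5 _]]].
apply H5, Hloc; auto.
Qed.

(** The bound [(M + eps) * u] on an increment is additive under halving. Near [p] it follows by
    comparing both end points with [p]: the errors [eps * (x + u - p)] and [eps * (p - x)] add up to
    [eps * u]. *)
Lemma cder_mean_value {V : NormedModule C_AbsRing} (f f' : C -> V) (M : R) :
  (forall s, 0 <= s <= 1 -> cder f (RtoC s) (f' (RtoC s)) /\ norm (f' (RtoC s)) <= M) ->
  norm (minus (f (RtoC 1)) (f (RtoC 0))) <= M.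
Proof.
intros H; apply le_epsilon; intros eps He.
pose (P := fun x (y : R) u (v : R) => norm (minus (f (RtoC (x + u))) (f (RtoC x))) <= (M + eps) * u).
assert (HP : P 0 0 1 0).
{ apply bisection; try lra.
  - intros x y u v _ Hu _ _ _ _ H1 H2 _ _; unfold P in *.
    replace (x + 2 * u) with (x + u + u) by ring.
    apply Rle_trans with (1 := norm_sub_triangle _ (f (RtoC (x + u))) _); lra.
  - intros p q Hp _; destruct (H p ltac:(lra)) as [Hf HM].
    destruct (Hf eps He) as [d [Hd K]]; exists d; split; [exact Hd|].
    intros x y u v _ Hu _ _ _ _ Hxp _ Hud _; unfold P.
    set (l := f' (RtoC p)) in *.
    assert (K1 := K (RtoC (x + u))); assert (K2 := K (RtoC x)).
    rewrite <- RtoC_minus, Cmod_R, Rabs_pos_eq in K1 by lra.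
    rewrite <- RtoC_minus, Cmod_R, Rabs_left1 in K2 by lra.
    specialize (K1 ltac:(lra)); specialize (K2 ltac:(lra)).
    set (F1 := f (RtoC (x + u))) in *; set (F2 := f (RtoC x)) in *; set (F0 := f (RtoC p)) in *.
    replace (minus F1 F2) with
     (plus (minus (minus (minus F1 F0) ((RtoC (x + u - p)) *: l))
                  (minus (minus F2 F0) ((RtoC (x - p)) *: l)))
           ((RtoC u) *: l)).
    2:{ vcoefs; rewrite ?RtoC_minus, ?RtoC_plus; ring. }
    apply Rle_trans with (1 := norm_triangle _ _).
    rewrite norm_scalC, Cmod_R, Rabs_pos_eq by lra.
    unfold minus at 1; apply Rle_trans with
      (norm (minus (minus F1 F0) ((RtoC (x + u - p)) *: l))
       + norm (minus (minus F2 F0) ((RtoC (x - p)) *: l)) + u * norm l).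
    + apply Rplus_le_compat_r.
      rewrite <- (norm_opp (minus (minus F2 F0) ((RtoC (x - p)) *: l))).
      apply norm_triangle.
    + assert (u * norm l <= u * M) by (apply Rmult_le_compat_l; lra); lra. }
unfold P in HP; replace (0 + 1) with 1 in HP by ring; lra.
Qed.

Section Goursat.

Context {V : NormedModule C_AbsRing} (Vc : completion_data V).

Let I := (Ci : C_AbsRing).

Lemma hline_affine (y s t : R) : ((s, y) = (t, y) + RtoC (s - t) * RtoC 1)%C.
Proof. unfold Cplus, Cmult, RtoC; simpl; f_equal; ring. Qed.

Lemma vline_affine (x s t : R) : ((x, s) = (x, t) + RtoC (s - t) * Ci)%C.
Proof. unfold Cplus, Cmult, RtoC, Ci; simpl; f_equal; ring. Qed.

Lemma int_hline (f : C -> V) (y a b : R) : a <= b ->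
  (forall t, a <= t <= b -> exists l, cder f (t, y) l) -> exists l, is_int (fun t => f (t, y)) a b l.
Proof.
intros Hab H; apply (int_exists Vc); intros t Ht; rewrite Rmin_left, Rmax_right in Ht by lra.
destruct (H t Ht) as [l Hl].
apply (cder_cont_at f (fun t => (t, y)) t (RtoC 1) l); [intros s; apply hline_affine|exact Hl].
Qed.

Lemma int_vline (f : C -> V) (x a b : R) : a <= b ->
  (forall t, a <= t <= b -> exists l, cder f (x, t) l) -> exists l, is_int (fun t => f (x, t)) a b l.
Proof.
intros Hab H; apply (int_exists Vc); intros t Ht; rewrite Rmin_left, Rmax_right in Ht by lra.
destruct (H t Ht) as [l Hl].
apply (cder_cont_at f (fun t => (x, t)) t Ci l); [intros s; apply vline_affine|exact Hl].
Qed.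

(** The bound is quadratic in the size so that the estimates for four quarters add up exactly to
    that for the whole. All sides are integrated in the direction of increasing coordinates, hence
    the signs. *)
Definition boundary_small (f : C -> V) (eps x y u v : R) : Prop :=
  forall l1 l2 l3 l4, is_int (fun t => f (t, y)) x (x + u) l1 -> is_int (fun t => f (x + u, t)) y (y + v) l2 ->
    is_int (fun t => f (t, y + v)) x (x + u) l3 -> is_int (fun t => f (x, t)) y (y + v) l4 ->
    norm (minus (plus l1 (scal I l2)) (plus l3 (scal I l4))) <= eps * ((u + v) * (u + v)).

(** The integrals over the inner edges [m1], [m2], [n1], [n2] occur in two quarters each, with
    opposite signs, and cancel. *)
Lemma boundary_small_split (f : C -> V) (eps x y u v : R) : 0 <= u -> 0 <= v ->
  (forall s t, x <= s <= x + 2 * u -> y <= t <= y + 2 * v -> exists l, cder f (s, t) l) ->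
  boundary_small f eps x y u v -> boundary_small f eps (x + u) y u v ->
  boundary_small f eps x (y + v) u v -> boundary_small f eps (x + u) (y + v) u v ->
  boundary_small f eps x y (2 * u) (2 * v).
Proof.
intros Hu Hv H S1 S2 S3 S4 l1 l2 l3 l4 H1 H2 H3 H4.
replace (x + 2 * u) with (x + u + u) in * by ring; replace (y + 2 * v) with (y + v + v) in * by ring.
destruct (int_hline f y x (x + u)) as [b1 B1]; [lra|intros; apply H; lra|].
destruct (int_hline f y (x + u) (x + u + u)) as [b2 B2]; [lra|intros; apply H; lra|].
destruct (int_hline f (y + v) x (x + u)) as [m1 M1]; [lra|intros; apply H; lra|].
destruct (int_hline f (y + v) (x + u) (x + u + u)) as [m2 M2]; [lra|intros; apply H; lra|].
destruct (int_hline f (y + v + v) x (x + u)) as [t1 T1]; [lra|intros; apply H; lra|].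
destruct (int_hline f (y + v + v) (x + u) (x + u + u)) as [t2 T2]; [lra|intros; apply H; lra|].
destruct (int_vline f x y (y + v)) as [c1 C1]; [lra|intros; apply H; lra|].
destruct (int_vline f x (y + v) (y + v + v)) as [c2 C2]; [lra|intros; apply H; lra|].
destruct (int_vline f (x + u) y (y + v)) as [n1 N1]; [lra|intros; apply H; lra|].
destruct (int_vline f (x + u) (y + v) (y + v + v)) as [n2 N2]; [lra|intros; apply H; lra|].
destruct (int_vline f (x + u + u) y (y + v)) as [r1 R1]; [lra|intros; apply H; lra|].
destruct (int_vline f (x + u + u) (y + v) (y + v + v)) as [r2 R2]; [lra|intros; apply H; lra|].
rewrite (int_unique Vc _ _ _ _ _ H1 (int_Chasles _ _ _ _ _ _ B1 B2)).
rewrite (int_unique Vc _ _ _ _ _ H2 (int_Chasles _ _ _ _ _ _ R1 R2)).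
rewrite (int_unique Vc _ _ _ _ _ H3 (int_Chasles _ _ _ _ _ _ T1 T2)).
rewrite (int_unique Vc _ _ _ _ _ H4 (int_Chasles _ _ _ _ _ _ C1 C2)).
specialize (S1 _ _ _ _ B1 N1 M1 C1); specialize (S2 _ _ _ _ B2 R1 M2 N1).
specialize (S3 _ _ _ _ M1 N2 T1 C2); specialize (S4 _ _ _ _ M2 R2 T2 N2).
match goal with |- norm ?X <= _ =>
 replace X with (plus (plus (minus (plus b1 (scal I n1)) (plus m1 (scal I c1)))
                            (minus (plus b2 (scal I r1)) (plus m2 (scal I n1))))
                      (plus (minus (plus m1 (scal I n2)) (plus t1 (scal I c2)))
                            (minus (plus m2 (scal I r2)) (plus t2 (scal I n2))))) by vring end.
repeat (apply Rle_trans with (1 := norm_triangle _ _)).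
replace (eps * ((2 * u + 2 * v) * (2 * u + 2 * v)))
  with ((eps * ((u + v) * (u + v)) + eps * ((u + v) * (u + v))) + (eps * ((u + v) * (u + v)) + eps * ((u + v) * (u + v)))) by ring.
apply Rplus_le_compat; (apply Rle_trans with (1 := norm_triangle _ _)); apply Rplus_le_compat; assumption.
Qed.

Lemma cder_quadratic (a l : V) (z0 z : C) :
  cder (fun w => plus ((w - z0) *: a)
                      (scal ((w - z0) * (w - z0))%C ((RtoC (/ 2)) *: l))) z
       (plus a ((z - z0) *: l)).
Proof.
assert (H1 : cderC (fun w => w - z0)%C z (RtoC 1)).
{ assert (Q := cder_minus (V := CV) (fun w => w) (fun _ => z0) z _ _ (cder_id z) (cder_const _ _)).
  replace (RtoC 1) with (minus (RtoC 1 : CV) zero); [exact Q|].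
  change (RtoC 1 - RtoC 0 = RtoC 1)%C; ring. }
assert (H2 := cder_scal (V := CV) _ _ _ _ _ H1 H1).
assert (H3 := cder_plus _ _ _ _ _ (cder_scal _ _ _ _ _ H1 (cder_const a z))
                (cder_scal _ _ _ _ _ H2 (cder_const ((RtoC (/ 2)) *: l) z))).
match type of H3 with cder _ _ ?X => replace (plus a ((z - z0) *: l)) with X end; [exact H3|].
vcoefs; cfold.
- replace (RtoC (/ 2)) with (/ RtoC 2)%C by (symmetry; apply RtoC_inv; lra).
  field; intros E; apply RtoC_inj in E; lra.
- ring.
Qed.

(** Up to an error [eps / 2 * (u + v)], [f] is the affine map [A], whose boundary integral vanishes
    because [Phi] is a primitive of it; the perimeter [2 * (u + v)] gives the rest. *)
Lemma boundary_small_local (f : C -> V) (z0 : C) (l : V) (eps : R) : 0 < eps -> cder f z0 l ->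
  exists d, 0 < d /\ forall x y u v, 0 <= u -> 0 <= v -> x <= fst z0 <= x + u -> y <= snd z0 <= y + v ->
    u < d -> v < d -> boundary_small f eps x y u v.
Proof.
intros He Hf.
destruct (Hf (eps / 2)) as [d [Hd K]]; [lra|].
(* Every point of the rectangle is within [u + v < d] of [z0]. *)
exists (d / 2); split; [lra|].
intros x y u v Hu Hv Hx Hy Hud Hvd l1 l2 l3 l4 H1 H2 H3 H4.
pose (A := fun z : C => plus (f z0) ((z - z0) *: l)).
pose (Phi := fun w : C => plus ((w - z0) *: (f z0))
                      (scal ((w - z0) * (w - z0))%C ((RtoC (/ 2)) *: l))).
assert (HA : forall z, exists m, cder A z m).
{ intros z; eexists; unfold A.
  apply cder_plus; [apply cder_const|].
  apply (cder_scal (fun w => w - z0)%C (fun _ => l)); [|apply cder_const].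
  apply (cder_minus (V := CV)); [apply cder_id|apply cder_const]. }
assert (Hr : forall s t, x <= s <= x + u -> y <= t <= y + v ->
   norm (minus (f (s, t)) (A (s, t))) <= eps / 2 * (u + v)).
{ intros s t Hs Ht.
  assert (Hm : Cmod ((s, t) - z0) <= u + v).
  { destruct z0 as [p q]; simpl in Hx, Hy.
    replace ((s, t) - (p, q))%C with (RtoC (s - p) + RtoC (t - q) * Ci)%C
      by (unfold Cminus, Cplus, Cmult, Copp, RtoC, Ci; simpl; f_equal; ring).
    apply Rle_trans with (1 := Cmod_triangle _ _).
    rewrite Cmod_mult, !Cmod_R, Cmod_Ci, Rmult_1_r.
    apply Rplus_le_compat; apply Rabs_le; lra. }
  replace (minus (f (s, t)) (A (s, t)))
    with (minus (minus (f (s, t)) (f z0)) (((s, t) - z0) *: l)) by (unfold A; vring).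
  apply Rle_trans with (1 := K (s, t) ltac:(lra)).
  apply Rmult_le_compat_l; lra. }
assert (Ih : forall t a b, is_int (fun s => A (s, t)) a b (minus (Phi (b, t)) (Phi (a, t)))).
{ intros t a b.
  apply (int_ext (fun s => (RtoC 1) *: (A (s, t)))); [intros; exact (scal_one (A _))|].
  apply (int_derive Vc Phi A (fun s => (s, t)) a b (RtoC 1)).
  - intros; apply hline_affine.
  - intros s _; apply cder_quadratic.
  - intros s _; apply HA. }
assert (Iv : forall s a b, is_int (fun t => scal I (A (s, t))) a b (minus (Phi (s, b)) (Phi (s, a)))).
{ intros s a b.
  apply (int_derive Vc Phi A (fun t => (s, t)) a b Ci).
  - intros; apply vline_affine.
  - intros t _; apply cder_quadratic.
  - intros t _; apply HA. }
assert (HI : forall w : V, norm (scal I w) = norm w).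
{ intros w; unfold I; rewrite norm_scalC, Cmod_Ci; ring. }
assert (Bh : forall t m, y <= t <= y + v -> is_int (fun s => f (s, t)) x (x + u) m ->
   norm (minus m (minus (Phi (x + u, t)) (Phi (x, t)))) <= u * (eps / 2 * (u + v))).
{ intros t m Ht Hm; replace u with (x + u - x) at 2 by ring.
  apply (int_norm_le (fun s => minus (f (s, t)) (A (s, t)))); [lra|intros; apply Hr; lra|].
  apply int_minus; auto. }
assert (Bv : forall s m, x <= s <= x + u -> is_int (fun t => f (s, t)) y (y + v) m ->
   norm (minus (scal I m) (minus (Phi (s, y + v)) (Phi (s, y)))) <= v * (eps / 2 * (u + v))).
{ intros s m Hs Hm; replace v with (y + v - y) at 2 by ring.
  apply (int_norm_le (fun t => minus (scal I (f (s, t))) (scal I (A (s, t))))); [lra| |].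
  - intros t Ht; replace (minus (scal I (f (s, t))) (scal I (A (s, t)))) with (scal I (minus (f (s, t)) (A (s, t)))) by vring.
    rewrite HI; apply Hr; lra.
  - apply int_minus; auto; apply int_scal; auto. }
assert (B1 := Bh y l1 ltac:(lra) H1); assert (B3 := Bh (y + v) l3 ltac:(lra) H3).
assert (B2 := Bv (x + u) l2 ltac:(lra) H2); assert (B4 := Bv x l4 ltac:(lra) H4).
set (P00 := Phi (x, y)) in *; set (P10 := Phi (x + u, y)) in *.
set (P01 := Phi (x, y + v)) in *; set (P11 := Phi (x + u, y + v)) in *.
rewrite <- norm_opp in B3; rewrite <- norm_opp in B4.
match goal with |- norm ?X <= _ =>
 replace X with (plus (plus (minus l1 (minus P10 P00)) (minus (scal I l2) (minus P11 P10)))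
   (plus (opp (minus l3 (minus P11 P01))) (opp (minus (scal I l4) (minus P01 P00))))) by vring end.
apply Rle_trans with (1 := norm_triangle _ _).
replace (eps * ((u + v) * (u + v))) with ((u * (eps / 2 * (u + v)) + v * (eps / 2 * (u + v))) + (u * (eps / 2 * (u + v)) + v * (eps / 2 * (u + v)))) by field.
apply Rplus_le_compat; (apply Rle_trans with (1 := norm_triangle _ _)); apply Rplus_le_compat; assumption.
Qed.

Lemma Goursat (f : C -> V) (a b w h : R) (l1 l2 l3 l4 : V) : 0 <= w -> 0 <= h ->
  (forall s t, a <= s <= a + w -> b <= t <= b + h -> exists l, cder f (s, t) l) ->
  is_int (fun t => f (t, b)) a (a + w) l1 -> is_int (fun t => f (a + w, t)) b (b + h) l2 ->
  is_int (fun t => f (t, b + h)) a (a + w) l3 -> is_int (fun t => f (a, t)) b (b + h) l4 ->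
  minus (plus l1 (scal I l2)) (plus l3 (scal I l4)) = zero.
Proof.
intros Hw Hh Hf H1 H2 H3 H4.
apply norm_eq_zero, Rle_antisym; [|apply norm_ge_0].
apply le_epsilon; intros e He; rewrite Rplus_0_l.
(* The added [1] keeps the divisor positive for a degenerate rectangle. *)
set (S := (w + h) * (w + h) + 1).
assert (HS : 0 < S) by (unfold S; nra).
assert (He' : 0 < e / S) by (apply Rdiv_lt_0_compat; auto).
assert (B : boundary_small f (e / S) a b w h).
{ apply bisection; auto.
  - intros x y u v Ha Hu Hx Hb Hv Hy; apply boundary_small_split; auto.
    intros s t Hs Ht; apply Hf; lra.
  - intros p q Hp Hq; destruct (Hf p q Hp Hq) as [l Hl].
    destruct (boundary_small_local f (p, q) l (e / S) He' Hl) as [d [Hd K]].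
    exists d; split; [exact Hd|]; intros; apply K; auto. }
apply Rle_trans with (1 := B _ _ _ _ H1 H2 H3 H4).
apply Rle_trans with (e / S * S); [|right; field; lra].
apply Rmult_le_compat_l; [left; exact He'|unfold S; lra].
Qed.

End Goursat.

(** * Circle means *)

Definition cexp (z : C) : C := (exp (fst z) * cos (snd z), exp (fst z) * sin (snd z)).

Lemma cexp_plus (z w : C) : (cexp (z + w) = cexp z * cexp w)%C.
Proof.
destruct z as [a b], w as [c d]; unfold cexp, Cplus, Cmult; simpl.
rewrite exp_plus, cos_plus, sin_plus; f_equal; ring.
Qed.

Lemma cexp_0 : cexp (RtoC 0) = RtoC 1.
Proof. unfold cexp, RtoC; simpl; rewrite exp_0, cos_0, sin_0; f_equal; ring. Qed.

Lemma Cmod_cexp (z : C) : Cmod (cexp z) = exp (fst z).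
Proof.
destruct z as [a b]; unfold cexp, Cmod; simpl fst; simpl snd.
replace ((exp a * cos b) ^ 2 + (exp a * sin b) ^ 2) with ((exp a) ^ 2).
- rewrite sqrt_pow2; [reflexivity|left; apply exp_pos].
- generalize (sin2_cos2 b); unfold Rsqr; intros H.
  replace ((exp a * cos b) ^ 2 + (exp a * sin b) ^ 2)
    with ((exp a) ^ 2 * (sin b * sin b + cos b * cos b)) by ring; rewrite H; ring.
Qed.

Lemma cexp_neq_0 (z : C) : cexp z <> RtoC 0.
Proof. apply Cmod_gt_0; rewrite Cmod_cexp; apply exp_pos. Qed.

Lemma cexp_opp (z : C) : cexp (- z) = (/ cexp z)%C.
Proof.
assert (H : (cexp (- z) * cexp z = RtoC 1)%C).
{ rewrite <- cexp_plus; replace (- z + z)%C with (RtoC 0) by ring; apply cexp_0. }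
rewrite <- (Cmult_1_r (cexp (- z))), <- (Cinv_r (cexp z)) by apply cexp_neq_0.
rewrite Cmult_assoc, H; ring.
Qed.

(** The upper estimate comes from [1 - x <= exp (- x)], that is [(1 - x) * exp x <= 1]. *)
Lemma exp_taylor1_bound (x : R) : Rabs x <= 1 / 2 -> 0 <= exp x - 1 - x <= 2 * x ^ 2.
Proof.
intros H; apply Rabs_le_between in H; split.
- generalize (exp_ineq1_le x); lra.
- assert (H1 := exp_ineq1_le (- x)); rewrite exp_Ropp in H1.
  assert (Hp := exp_pos x).
  assert (H2 : (1 - x) * exp x <= 1).
  { apply Rmult_le_reg_r with (/ exp x); [now apply Rinv_0_lt_compat|].
    rewrite Rmult_assoc, Rinv_r by lra; lra. }
  apply Rmult_le_reg_l with (1 - x); [lra|].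
  apply Rle_trans with (1 - (1 - x) * (1 + x)); [lra|]; nra.
Qed.

Lemma cos_lower_bound (y : R) : 0 <= 1 - cos y <= y ^ 2 / 2.
Proof.
split; [generalize (COS_bound y); lra|].
replace y with (2 * (y / 2)) at 1 by field; rewrite cos_2a_sin.
assert (H : Rabs (sin (y / 2)) <= Rabs (y / 2)).
{ destruct (Rle_dec 0 (y / 2)) as [Hy|Hy].
  - rewrite (Rabs_pos_eq (y / 2)) by lra.
    destruct (Req_dec (y / 2) 0) as [E|E]; [rewrite E, sin_0, Rabs_R0; lra|].
    destruct (Rle_dec (y / 2) 1) as [H1|H1].
    + rewrite Rabs_pos_eq; [left; apply sin_lt_x; lra|].
      apply sin_ge_0; [lra|]; generalize PI2_1; lra.
    + apply Rabs_le; generalize (SIN_bound (y / 2)); lra.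
  - rewrite <- Rabs_Ropp, <- sin_neg, <- (Rabs_Ropp (y / 2)), (Rabs_pos_eq (- (y / 2))) by lra.
    destruct (Rle_dec (- (y / 2)) 1) as [H1|H1].
    + rewrite Rabs_pos_eq; [left; apply sin_lt_x; lra|].
      apply sin_ge_0; [lra|]; generalize PI2_1; lra.
    + apply Rabs_le; generalize (SIN_bound (- (y / 2))); lra. }
apply Rsqr_le_abs_1 in H; unfold Rsqr in H; lra.
Qed.

Lemma sin_taylor1_bound (y : R) : Rabs (sin y - y) <= y ^ 2.
Proof.
destruct (MVT_gen (fun t => sin t - t) 0 y (fun t => cos t - 1)) as [c [Hc E]].
- intros t _; auto_derive; auto; ring.
- intros t _; apply continuity_pt_filterlim, (ex_derive_continuous (fun t => sin t - t)); auto_derive; auto.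
- rewrite sin_0 in E; replace (sin y - y) with ((cos c - 1) * (y - 0)) by lra.
  rewrite Rabs_mult, Rminus_0_r.
  assert (Hcy : Rabs c <= Rabs y).
  { revert Hc; unfold Rmin, Rmax; destruct (Rle_dec 0 y); intros; unfold Rabs; destruct (Rcase_abs c), (Rcase_abs y); lra. }
  assert (H1 : Rabs (cos c - 1) <= Rabs y).
  { rewrite Rabs_minus_sym, Rabs_pos_eq by apply cos_lower_bound.
    destruct (Rle_dec (Rabs c) 2) as [H|H].
    - apply Rle_trans with (Rabs c); auto.
      apply Rle_trans with (c ^ 2 / 2); [apply cos_lower_bound|].
      rewrite <- (pow2_abs c); pose proof (Rabs_pos c); nra.
    - generalize (COS_bound c); lra. }
  rewrite <- (pow2_abs y); simpl; rewrite Rmult_1_r.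
  apply Rmult_le_compat_r; [apply Rabs_pos|exact H1].
Qed.

Lemma Cmod_le_Rabs (x y : R) : Cmod (x, y) <= Rabs x + Rabs y.
Proof.
replace (x, y) with (RtoC x + RtoC y * Ci)%C by (unfold Cplus, Cmult, RtoC, Ci; simpl; f_equal; ring).
apply Rle_trans with (1 := Cmod_triangle _ _).
rewrite Cmod_mult, !Cmod_R, Cmod_Ci; lra.
Qed.

Lemma Cmod_sqr (z : C) : (Cmod z) ^ 2 = fst z ^ 2 + snd z ^ 2.
Proof. unfold Cmod; rewrite pow2_sqrt; [reflexivity|]; nra. Qed.

Lemma cexp_taylor1_bound (h : C) : Cmod h <= 1 / 2 -> Cmod (cexp h - RtoC 1 - h) <= 10 * (Cmod h) ^ 2.
Proof.
destruct h as [x y]; intros H.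
assert (Hx : Rabs x <= 1 / 2) by (apply Rle_trans with (2 := H); eapply Rle_trans; [apply Rmax_l|apply (Rmax_Cmod (x, y))]).
rewrite Cmod_sqr; simpl fst; simpl snd.
assert (E : (cexp (x, y) - RtoC 1 - (x, y))%C
  = ((exp x - 1 - x) - exp x * (1 - cos y), exp x * (sin y - y) + (exp x - 1) * y)).
{ unfold cexp, Cminus, Cplus, Copp, RtoC; simpl; f_equal; ring. }
rewrite E; apply Rle_trans with (1 := Cmod_le_Rabs _ _).
destruct (exp_taylor1_bound x Hx) as [E1 E2]; destruct (cos_lower_bound y) as [C1 C2].
assert (S1 := sin_taylor1_bound y).
assert (Hx' := proj1 (Rabs_le_between _ _) Hx).
assert (Ee : 0 < exp x <= 2) by (split; [apply exp_pos|nra]).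
assert (A1 : Rabs (exp x - 1 - x - exp x * (1 - cos y)) <= 2 * x ^ 2 + y ^ 2).
{ apply Rabs_le; split; nra. }
assert (A2 : Rabs (exp x * (sin y - y) + (exp x - 1) * y) <= 2 * y ^ 2 + 2 * (x ^ 2 + y ^ 2)).
{ apply Rle_trans with (1 := Rabs_triang _ _).
  rewrite !Rabs_mult, (Rabs_pos_eq (exp x)) by lra.
  apply Rplus_le_compat.
  - apply Rmult_le_compat; try apply Rabs_pos; lra.
  - assert (Hb : Rabs (exp x - 1) <= 2 * Rabs x).
    { apply Rle_trans with (Rabs (exp x - 1 - x) + Rabs x).
      - replace (exp x - 1) with ((exp x - 1 - x) + x) at 1 by ring; apply Rabs_triang.
      - rewrite (Rabs_pos_eq (exp x - 1 - x)) by lra.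
        rewrite <- (pow2_abs x) in E2; pose proof (Rabs_pos x); nra. }
    rewrite <- (pow2_abs x), <- (pow2_abs y); pose proof (Rabs_pos x); pose proof (Rabs_pos y).
    apply Rle_trans with (2 * Rabs x * Rabs y); [apply Rmult_le_compat_r; lra|].
    nra. }
nra.
Qed.

(** Multiplicativity reduces the increment at [z] to one at 0, where [cexp_taylor1_bound] is
    quadratic. *)
Lemma cder_cexp (z : C) : cderC cexp z (cexp z).
Proof.
intros eps He.
set (M := exp (fst z)); assert (HM : 0 < M) by apply exp_pos.
set (d := Rmin (1 / 2) (eps / (10 * M))).
assert (Hd : 0 < d) by (apply Rmin_glb_lt; [lra|apply Rdiv_lt_0_compat; lra]).
exists d; split; [exact Hd|]; intros w Hw.
change (Cmod (cexp w - cexp z - (w - z) * cexp z) <= eps * Cmod (w - z)).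
replace (cexp w - cexp z - (w - z) * cexp z)%C with (cexp z * (cexp (w - z) - RtoC 1 - (w - z)))%C.
2:{ replace (cexp w) with (cexp z * cexp (w - z))%C; [ring|].
    rewrite <- cexp_plus; f_equal; ring. }
rewrite Cmod_mult, Cmod_cexp; fold M.
assert (H1 : Cmod (w - z) <= 1 / 2) by (generalize (Rmin_l (1 / 2) (eps / (10 * M))); fold d; lra).
assert (H2 : Cmod (w - z) <= eps / (10 * M)) by (generalize (Rmin_r (1 / 2) (eps / (10 * M))); fold d; lra).
apply Rle_trans with (M * (10 * Cmod (w - z) ^ 2)).
- apply Rmult_le_compat_l; [lra|]; apply cexp_taylor1_bound; exact H1.
- assert (H3 : 10 * M * Cmod (w - z) <= eps).
  { apply Rmult_le_compat_l with (r := 10 * M) in H2; [|lra].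
    replace (10 * M * (eps / (10 * M))) with eps in H2 by (field; lra); exact H2. }
  pose proof (Cmod_ge_0 (w - z)); nra.
Qed.

Definition circle (r t : R) : C := (r * cos t, r * sin t).

Lemma circle_cexp (s t : R) : circle (exp s) t = cexp (s, t).
Proof. reflexivity. Qed.

Lemma Cmod_circle (r t : R) : 0 < r -> Cmod (circle r t) = r.
Proof.
intros Hr; rewrite <- (exp_ln r Hr) at 1; rewrite circle_cexp, Cmod_cexp; simpl.
now apply exp_ln.
Qed.

Section CircleMeans.

Context {V : NormedModule C_AbsRing} (Vc : completion_data V).

Lemma int_circle_exists (f : C -> V) (r : R) : 0 < r ->
  (forall z, Cmod z = r -> exists l, cder f z l) -> exists l, is_int (fun t => f (circle r t)) 0 (2 * PI) l.
Proof.
intros Hr H; apply (int_exists Vc); intros t _.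
destruct (H (circle r t) (Cmod_circle r t Hr)) as [l Hl].
assert (E : forall t, circle r t = cexp (ln r, t)) by (intros; rewrite <- circle_cexp, exp_ln; auto).
intros eps He.
destruct (cder_cont_at (fun z => f (cexp z)) (fun t => (ln r, t)) t Ci ((cexp (ln r, t)) *: l)
  (fun s => vline_affine _ _ _)) with (eps := eps) as [d [Hd K]]; auto.
- apply cder_comp; [rewrite <- E; exact Hl|apply cder_cexp].
- exists d; split; [exact Hd|]; intros u Hu; rewrite !E; apply K; exact Hu.
Qed.

(* Goursat's lemma for [f (cexp z)] on a rectangle of height [2 PI]: the horizontal sides
   cancel by periodicity. *)
Lemma int_circle_radius (f : C -> V) (R r1 r2 : R) (l1 l2 : V) : 0 < r1 -> r1 <= r2 -> r2 < R ->
  (forall z, 0 < Cmod z < R -> exists l, cder f z l) ->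
  is_int (fun t => f (circle r1 t)) 0 (2 * PI) l1 ->
  is_int (fun t => f (circle r2 t)) 0 (2 * PI) l2 -> l1 = l2.
Proof.
intros H1 H12 H2 Hf I1 I2.
set (g := fun z => f (cexp z)).
assert (Hln : ln r1 <= ln r2).
{ destruct H12 as [H|<-]; [left; apply ln_increasing; auto|lra]. }
assert (E1 : exp (ln r1) = r1) by (apply exp_ln; auto).
assert (E2 : exp (ln r2) = r2) by (apply exp_ln; lra).
assert (Hg : forall s t, s <= ln r2 -> exists l, cder g (s, t) l).
{ intros s t Hs.
  assert (Hm : Cmod (cexp (s, t)) <= r2).
  { rewrite Cmod_cexp; simpl; rewrite <- E2; destruct Hs as [Hs|Hs]; [left; now apply exp_increasing|rewrite Hs; lra]. }
  destruct (Hf (cexp (s, t))) as [l Hl]; [split; [rewrite Cmod_cexp; apply exp_pos|lra]|].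
  eexists; exact (cder_comp f cexp _ _ _ Hl (cder_cexp _)). }
pose proof PI_RGT_0 as HPI.
destruct (int_hline Vc g 0 (ln r1) (ln r2)) as [b Hb]; [exact Hln|intros; apply Hg; lra|].
assert (Hper : forall s, g (s, 0 + 2 * PI) = g (s, 0)).
{ intros s; unfold g, cexp; simpl; rewrite Rplus_0_l, cos_2PI, sin_2PI, cos_0, sin_0; reflexivity. }
assert (Hb' : is_int (fun t => g (t, 0 + 2 * PI)) (ln r1) (ln r2) b).
{ apply (int_ext (fun t => g (t, 0))); [intros; symmetry; apply Hper|exact Hb]. }
assert (G := Goursat Vc g (ln r1) 0 (ln r2 - ln r1) (2 * PI) b l2 b l1).
replace (ln r1 + (ln r2 - ln r1)) with (ln r2) in G by ring.
assert (I1' : is_int (fun t => g (ln r1, t)) 0 (2 * PI) l1).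
{ refine (int_ext _ _ _ _ _ _ I1); intros t _; unfold g; rewrite <- circle_cexp, E1; reflexivity. }
assert (I2' : is_int (fun t => g (ln r2, t)) 0 (2 * PI) l2).
{ refine (int_ext _ _ _ _ _ _ I2); intros t _; unfold g; rewrite <- circle_cexp, E2; reflexivity. }
rewrite !Rplus_0_l in G; rewrite Rplus_0_l in Hb'.
specialize (G ltac:(lra) ltac:(lra) (fun s t Hs _ => Hg s t ltac:(lra)) Hb I2' Hb' I1').
assert (N : minus l1 l2 = zero).
{ apply norm_eq_zero; rewrite norm_sub_sym.
  transitivity (norm (Ci *: (minus l2 l1))); [rewrite norm_scalC, Cmod_Ci; ring|].
  match type of G with ?X = _ => replace (Ci *: (minus l2 l1)) with X by vring end.
  rewrite G; apply norm_zero. }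
replace l1 with (plus l2 (minus l1 l2)) by vring; rewrite N; vring.
Qed.

End CircleMeans.

Lemma cder_inv (z : C) : z <> RtoC 0 -> cderC (fun w => / w)%C z (- (/ z * / z))%C.
Proof.
intros Hz eps He.
assert (Hp : 0 < Cmod z) by now apply Cmod_gt_0.
set (m := Cmod z) in *.
assert (Hm3 : 0 < m * m * m) by (apply Rmult_lt_0_compat; nra).
exists (Rmin (m / 2) (eps * (m * m * m) / 2)); split.
{ apply Rmin_glb_lt; [lra|]; nra. }
intros w Hw.
assert (H1 := Rlt_le_trans _ _ _ Hw (Rmin_l _ _)); assert (H2 := Rlt_le_trans _ _ _ Hw (Rmin_r _ _)).
assert (Hwm : m / 2 < Cmod w).
{ generalize (Cmod_ball_sub w z); replace (z - w)%C with (- (w - z))%C by ring; rewrite Cmod_opp; fold m; lra. }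
assert (Hw0 : w <> RtoC 0) by (apply Cmod_gt_0; lra).
change (Cmod (/ w - / z - (w - z) * - (/ z * / z)) <= eps * Cmod (w - z)).
replace (/ w - / z - (w - z) * - (/ z * / z))%C with ((w - z) * (w - z) * / (w * z * z))%C
  by (field; auto).
rewrite !Cmod_mult, Cmod_inv by (repeat apply Cmult_neq_0; auto); rewrite !Cmod_mult; fold m.
rewrite Rmult_assoc, (Rmult_comm eps).
apply Rmult_le_compat_l; [apply Cmod_ge_0|].
assert (Hden : m * m * m / 2 < Cmod w * m * m) by nra.
apply Rmult_le_reg_r with (Cmod w * m * m); [lra|].
rewrite Rmult_assoc, Rinv_l by lra; rewrite Rmult_1_r.
assert (eps * (m * m * m / 2) < eps * (Cmod w * m * m)) by (apply Rmult_lt_compat_l; lra).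
lra.
Qed.

Lemma inv_pow_cexp (z : C) (k : nat) : ((/ cexp z) ^ k)%C = cexp (- RtoC (INR k) * z).
Proof.
induction k as [|k IH].
- simpl; replace (- RtoC 0 * z)%C with (RtoC 0) by ring; symmetry; apply cexp_0.
- rewrite S_INR, RtoC_plus; change ((/ cexp z) ^ S k)%C with (/ cexp z * (/ cexp z) ^ k)%C.
  rewrite IH, <- cexp_opp, <- cexp_plus; f_equal; ring.
Qed.

Lemma scal_div_pos {V : NormedModule C_AbsRing} (k : R) (l : V) : 0 < k ->
  norm ((RtoC k) *: l) = k * norm l.
Proof. intros Hk; rewrite norm_scalC, Cmod_R, Rabs_pos_eq; lra. Qed.

Section CircleMeans2.

Context {V : NormedModule C_AbsRing} (Vc : completion_data V).

(** In the coordinate [cexp (ln r, t)] the integrand is an exponential [cexp (- K z)] with [K <> 0],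
    so it has a primitive of the same form, which takes equal values at heights [0] and [2 PI]. *)
Lemma int_circle_inv_pow (r : R) (k : nat) (d : V) : 0 < r -> (0 < k)%nat ->
  is_int (fun t => ((/ circle r t) ^ k) *: d) 0 (2 * PI) zero.
Proof.
intros Hr Hk.
set (K := RtoC (INR k)).
assert (HK : K <> RtoC 0).
{ intros E; apply RtoC_inj in E; apply (not_0_INR k); lia || exact E. }
assert (Hc : forall z, cderC (fun z => cexp (- K * z)) z (- K * cexp (- K * z))%C).
{ intros z.
  assert (Q := cder_scal (V := CV) (fun _ => - K)%C (fun w => w) z _ _ (cder_const (V := CV) (- K)%C z) (cder_id z)).
  assert (Q2 := cder_comp (V := CV) cexp (fun w => (- K * w)%C) z _ _ (cder_cexp _) Q).
  apply (cder_eq _ _ _ _ Q2); cfold; ring. }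
pose (f := fun z : C => (cexp (- K * z)) *: d).
pose (g := fun z : C => (- K * cexp (- K * z)) *: d).
assert (Hf : forall z, cder f z (g z)).
{ intros z; unfold f, g.
  assert (Q := cder_scal _ _ _ _ _ (Hc z) (cder_const d z)).
  apply (cder_eq _ _ _ _ Q); vring. }
assert (Hg : forall z, exists l, cder g z l).
{ intros z; eexists; unfold g.
  apply (cder_scal (fun z => (- K * cexp (- K * z))%C) (fun _ => d)); [|apply cder_const].
  apply (cder_scal (V := CV) (fun _ => - K)%C); [apply (cder_const (V := CV))|apply Hc]. }
assert (Q0 := int_derive Vc f g (fun t => (ln r, t)) 0 (2 * PI) Ci (fun s t => vline_affine _ _ _) (fun t _ => Hf _) (fun t _ => Hg _)).
assert (Ez : minus (f (ln r, 2 * PI)) (f (ln r, 0)) = zero).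
{ replace (f (ln r, 2 * PI)) with (f (ln r, 0)); [vring|].
  unfold f, K; rewrite <- !inv_pow_cexp; unfold cexp; simpl fst; simpl snd.
  rewrite cos_2PI, sin_2PI, cos_0, sin_0; reflexivity. }
assert (Q : is_int (fun t => Ci *: (g (ln r, t))) 0 (2 * PI) zero) by exact (eq_ind _ (fun l : V => is_int _ 0 (2 * PI) l) Q0 _ Ez).
apply (int_scal (/ (Ci * - K))) in Q.
assert (HCi : Ci <> RtoC 0) by (intros E; apply (f_equal snd) in E; simpl in E; lra).
assert (HnK : (- K)%C <> RtoC 0).
{ intros E; apply HK; replace K with (- - K)%C by ring; rewrite E; ring. }
replace ((/ (Ci * - K)) *: (zero : V)) with (zero : V) in Q by vring.
refine (int_ext _ _ _ _ _ _ Q); intros t _; unfold g.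
rewrite <- (exp_ln r Hr) at 2; rewrite circle_cexp, inv_pow_cexp; fold K.
vcoefs; field; split; auto.
Qed.

(** The integral does not depend on the radius, so it may be computed on an arbitrarily small
    circle. There [f] is [c] plus three polar terms, which integrate to zero, up to an arbitrarily
    small error. Poles of order three suffice to reach the third coefficient of [omega]. *)
Lemma circle_mean (f : C -> V) (R r : R) (c d1 d2 d3 : V) : 0 < r < R ->
  (forall z, 0 < Cmod z < R -> exists l, cder f z l) ->
  (forall eps, 0 < eps -> exists d, 0 < d /\ forall z, 0 < Cmod z < d ->
     norm (minus (f z) (plus c (plus (((/ z) ^ 1) *: d1)
        (plus (((/ z) ^ 2) *: d2) (((/ z) ^ 3) *: d3))))) <= eps) ->
  is_int (fun t => f (circle r t)) 0 (2 * PI) ((RtoC (2 * PI)) *: c).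
Proof.
intros Hr Hf Hlim; pose proof PI_RGT_0 as HPI.
destruct (int_circle_exists Vc f r) as [l Hl]; [lra|intros z Hz; apply Hf; lra|].
replace ((RtoC (2 * PI)) *: c) with l; [exact Hl|].
assert (N : norm (minus l ((RtoC (2 * PI)) *: c)) = 0).
{ apply Rle_antisym; [|apply norm_ge_0]; apply le_epsilon; intros e He; rewrite Rplus_0_l.
  destruct (Hlim (e / (2 * PI))) as [d [Hd K]]; [apply Rdiv_lt_0_compat; lra|].
  set (r' := Rmin r (d / 2)).
  assert (Hr' : 0 < r') by (apply Rmin_glb_lt; lra).
  assert (Hr1 : r' <= r) by apply Rmin_l; assert (Hr2 : r' <= d / 2) by apply Rmin_r.
  destruct (int_circle_exists Vc f r') as [l' Hl']; [lra|intros z Hz; apply Hf; lra|].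
  rewrite <- (int_circle_radius Vc f R r' r l' l Hr' Hr1 (proj2 Hr) Hf Hl' Hl).
  assert (I := int_plus _ _ _ _ _ _ (int_const c 0 (2 * PI))
    (int_plus _ _ _ _ _ _ (int_circle_inv_pow r' 1 d1 Hr' ltac:(lia))
      (int_plus _ _ _ _ _ _ (int_circle_inv_pow r' 2 d2 Hr' ltac:(lia)) (int_circle_inv_pow r' 3 d3 Hr' ltac:(lia))))).
  assert (I2 := int_minus _ _ _ _ _ _ Hl' I).
  match type of I2 with is_int _ _ _ ?X => replace (minus l' ((RtoC (2 * PI)) *: c)) with X end.
  2:{ rewrite Rminus_0_r; vring. }
  replace e with ((2 * PI - 0) * (e / (2 * PI))) by (field; lra).
  refine (int_norm_le _ _ _ _ _ _ _ I2); [lra|].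
  intros t _; apply K; rewrite Cmod_circle by auto; lra. }
assert (E := norm_eq_zero _ N).
replace l with (plus ((RtoC (2 * PI)) *: c) (minus l ((RtoC (2 * PI)) *: c))) by vring.
rewrite E; vring.
Qed.

(** Cauchy's formula: [f z / z] is [f 0 / z + l + o(1)], so its mean is the constant term [l]. *)
Lemma circle_derivative (f : C -> V) (R r : R) (l : V) : 0 < r < R ->
  (forall z, Cmod z < R -> exists l, cder f z l) -> cder f (RtoC 0) l ->
  is_int (fun t => (/ circle r t) *: (f (circle r t))) 0 (2 * PI)
    ((RtoC (2 * PI)) *: l).
Proof.
intros Hr Hf H0.
apply (circle_mean (fun z => (/ z) *: (f z)) R r l (f (RtoC 0)) zero zero Hr).
- intros z Hz; destruct (Hf z) as [m Hm]; [lra|].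
  eexists; apply (cder_scal (fun z => / z)%C); [apply cder_inv, Cmod_gt_0; lra|exact Hm].
- intros eps He; destruct (H0 eps He) as [d [Hd K]]; exists d; split; [exact Hd|].
  intros z Hz; assert (Hz0 : z <> RtoC 0) by (apply Cmod_gt_0; lra).
  specialize (K z); replace (z - RtoC 0)%C with z in K by ring.
  match goal with |- norm ?X <= _ =>
    replace X with ((/ z) *: (minus (minus (f z) (f (RtoC 0))) (z *: l))) end.
  2:{ vcoefs; simpl; field; auto. }
  rewrite norm_scalC, Cmod_inv by auto.
  apply Rmult_le_reg_l with (Cmod z); [lra|].
  rewrite <- Rmult_assoc, Rinv_r, Rmult_1_l by lra.
  rewrite (Rmult_comm (Cmod z)); apply K; lra.
Qed.

Lemma circle_mean_bound (phi : R -> V) (r M : R) (l : V) : 0 < r ->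
  (forall t, norm (phi t) <= M) ->
  is_int (fun t => (/ circle r t) *: (phi t)) 0 (2 * PI) ((RtoC (2 * PI)) *: l) ->
  norm l <= M / r.
Proof.
intros Hr Hphi HI; pose proof PI_RGT_0 as HPI.
assert (H : norm ((RtoC (2 * PI)) *: l) <= (2 * PI - 0) * (M / r)).
{ refine (int_norm_le _ _ _ _ _ _ _ HI); [lra|]; intros t _.
  assert (Hc : Cmod (circle r t) = r) by (apply Cmod_circle; auto).
  rewrite norm_scalC, Cmod_inv, Hc by (apply Cmod_gt_0; lra).
  unfold Rdiv; rewrite Rmult_comm; apply Rmult_le_compat_r; [left; now apply Rinv_0_lt_compat|apply Hphi]. }
rewrite scal_div_pos in H by lra.
apply Rmult_le_reg_l with (2 * PI); [lra|]; lra.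
Qed.

Lemma circle_mean_unique (phi : R -> V) (l m : V) :
  is_int phi 0 (2 * PI) ((RtoC (2 * PI)) *: l) ->
  is_int phi 0 (2 * PI) ((RtoC (2 * PI)) *: m) -> l = m.
Proof.
intros H1 H2; assert (E := int_unique Vc _ _ _ _ _ H1 H2).
pose proof PI_RGT_0 as HPI.
assert (HP : RtoC (2 * PI) <> RtoC 0) by (intros E'; apply RtoC_inj in E'; lra).
replace l with ((/ RtoC (2 * PI)) *: ((RtoC (2 * PI)) *: l)).
- rewrite E; vcoefs; field; auto.
- vcoefs; field; auto.
Qed.

End CircleMeans2.

(** * Derivatives of holomorphic maps between Banach spaces *)

Lemma norm_convex_lt {V : NormedModule C_AbsRing} (x a b : V) (s r : R) : 0 <= s <= 1 ->
  norm (minus a x) < r -> norm (minus b x) < r ->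
  norm (minus (plus a ((RtoC s) *: (minus b a))) x) < r.
Proof.
intros Hs Ha Hb.
replace (minus (plus a ((RtoC s) *: (minus b a))) x)
  with (plus ((RtoC (1 - s)) *: (minus a x)) ((RtoC s) *: (minus b x)))
  by (rewrite RtoC_minus; vring).
apply Rle_lt_trans with (1 := norm_triangle _ _).
rewrite !norm_scalC, !Cmod_R, !Rabs_pos_eq by lra.
destruct (Rle_lt_or_eq_dec 0 s) as [H|H]; [lra| |]; [|subst s; lra].
assert (s * norm (minus b x) < s * r) by (apply Rmult_lt_compat_l; lra).
assert ((1 - s) * norm (minus a x) <= (1 - s) * r) by (apply Rmult_le_compat_l; lra).
lra.
Qed.

Definition holo {U V : NormedModule C_AbsRing} (G : U -> V) : Prop :=
  forall x : U, norm x < 1 -> exists L : Lin U V, fder G x L.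

Lemma holo_frechet {U V : NormedModule C_AbsRing} (G : U -> V) (x : U) :
  holo G -> norm x < 1 -> fder G x (frechet G x).
Proof. intros HG Hx; apply frechet_fder, HG, Hx. Qed.

Section Holomorphic.

Context {U V : NormedModule C_AbsRing} (Vc : completion_data V) (G : U -> V) (HG : holo G).

Let D := frechet G.

Lemma cauchy_derivative (x h : U) (r R : R) : 0 < r < R ->
  (forall z : C, Cmod z < R -> norm (plus x (z *: h)) < 1) ->
  is_int (fun t => (/ circle r t) *: (G (plus x ((circle r t) *: h)))) 0 (2 * PI)
    ((RtoC (2 * PI)) *: (D x h)).
Proof.
intros Hr Hx.
assert (Hd : forall z : C, Cmod z < R -> cder (fun z => G (plus x (z *: h))) z
   (D (plus x (z *: h)) h)).
{ intros z Hz; apply cder_line; apply holo_frechet; auto. }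
apply (circle_derivative Vc (fun z => G (plus x (z *: h))) R r (D x h) Hr).
- intros z Hz; eexists; apply Hd; exact Hz.
- apply (cder_eq _ _ _ _ (Hd (RtoC 0) ltac:(rewrite Cmod_0; lra))).
  replace (plus x ((RtoC 0) *: h)) with x by vring; reflexivity.
Qed.

Context (x : U) (rho M : R) (Hrho : 0 < rho)
  (Hb : forall y : U, norm (minus y x) < 3 * rho -> norm y < 1 /\ norm (G y) <= M).

Lemma bound_nonneg : 0 <= M.
Proof.
apply Rle_trans with (norm (G x)); [apply norm_ge_0|apply Hb].
replace (minus x x) with (zero : U) by vring; rewrite norm_zero; lra.
Qed.

Lemma in_tube (y h : U) (z : C) (r1 r2 : R) : norm (minus y x) < r1 -> norm h <= 1 -> Cmod z <= r2 ->
  norm (minus (plus y (z *: h)) x) < r1 + r2.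
Proof.
intros Hy Hh Hz.
replace (minus (plus y (z *: h)) x) with (plus (minus y x) (z *: h)) by vring.
apply Rle_lt_trans with (1 := norm_triangle _ _); rewrite norm_scalC.
pose proof (norm_ge_0 h); pose proof (Cmod_ge_0 z); nra.
Qed.

Lemma cauchy_derivative_tube (y h : U) (r : R) : 0 < r <= rho -> norm (minus y x) < 2 * rho -> norm h <= 1 ->
  is_int (fun t => (/ circle r t) *: (G (plus y ((circle r t) *: h)))) 0 (2 * PI)
    ((RtoC (2 * PI)) *: (D y h)).
Proof.
intros Hr Hy Hh; apply cauchy_derivative with (3 * rho - norm (minus y x)); [lra|].
intros z Hz; apply Hb.
pose proof (norm_ge_0 h); pose proof (Cmod_ge_0 z).
replace (minus (plus y (z *: h)) x) with (plus (minus y x) (z *: h)) by vring.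
apply Rle_lt_trans with (1 := norm_triangle _ _); rewrite norm_scalC; nra.
Qed.

(** Cauchy's estimate. [G] is bounded within [3 * rho] of [x]; circles of radius [rho] cost one
    [rho], so this estimate holds within [2 * rho], and the one for differences of [D] within
    [rho]. *)
Lemma derivative_bound (y h : U) : norm (minus y x) < 2 * rho -> norm (D y h) <= M / rho * norm h.
Proof.
intros Hy; apply Rle_trans with (1 := Lin_norm_apply (D y) h).
apply Rmult_le_compat_r; [apply norm_ge_0|].
apply Lin_norm_least; clear h; intros h Hh.
apply (circle_mean_bound (fun t => G (plus y ((circle rho t) *: h))) rho M); auto.
- intros t; apply Hb.
  replace (3 * rho) with (2 * rho + rho) by ring; apply in_tube; auto; rewrite Cmod_circle; lra.
- apply cauchy_derivative_tube; auto; lra.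
Qed.

Lemma lipschitz_bound (y y' : U) : norm (minus y x) < 2 * rho -> norm (minus y' x) < 2 * rho ->
  norm (minus (G y') (G y)) <= M / rho * norm (minus y' y).
Proof.
intros Hy Hy'.
assert (Q := cder_mean_value (fun z => G (plus y (z *: (minus y' y))))
  (fun z => D (plus y (z *: (minus y' y))) (minus y' y)) (M / rho * norm (minus y' y))).
cbv beta in Q.
replace (plus y ((RtoC 1) *: (minus y' y))) with y' in Q by vring.
replace (plus y ((RtoC 0) *: (minus y' y))) with y in Q by vring.
apply Q; intros s Hs.
assert (Hn := norm_convex_lt x y y' s (2 * rho) Hs Hy Hy'); split.
- apply cder_line, holo_frechet; auto; apply Hb; lra.
- apply derivative_bound; exact Hn.
Qed.

(** The difference of the derivatives is the Cauchy mean of [G (y' + z h) - G (y + z h)], already of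
    size [M / rho * norm (y' - y)] by [lipschitz_bound]; this is uniform over unit vectors [h], as
    the operator norm requires. *)
Lemma derivative_lipschitz (y y' h : U) : norm (minus y x) < rho -> norm (minus y' x) < rho ->
  norm (minus (D y' h) (D y h)) <= M / (rho * rho) * norm (minus y' y) * norm h.
Proof.
intros Hy Hy'.
replace (minus (D y' h) (D y h)) with (Lin_plus (D y') (Lin_opp (D y)) h) by reflexivity.
apply Rle_trans with (1 := Lin_norm_apply _ _); apply Rmult_le_compat_r; [apply norm_ge_0|].
apply Lin_norm_least; clear h; intros h Hh.
replace (M / (rho * rho) * norm (minus y' y)) with (M / rho * norm (minus y' y) / rho) by (field; lra).
change (norm (minus (D y' h) (D y h)) <= M / rho * norm (minus y' y) / rho).
apply (circle_mean_bound (fun t => minus (G (plus y' ((circle rho t) *: h)))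
   (G (plus y ((circle rho t) *: h)))) rho); auto.
- intros t.
  replace (minus y' y) with (minus (plus y' ((circle rho t) *: h)) (plus y ((circle rho t) *: h))) by vring.
  replace (2 * rho) with (rho + rho) by ring.
  apply lipschitz_bound; replace (2 * rho) with (rho + rho) by ring; apply in_tube; auto; rewrite Cmod_circle; lra.
- assert (Q := int_minus _ _ _ _ _ _ (cauchy_derivative_tube y' h rho ltac:(lra) ltac:(lra) Hh)
    (cauchy_derivative_tube y h rho ltac:(lra) ltac:(lra) Hh)).
  replace ((RtoC (2 * PI)) *: (minus (D y' h) (D y h)))
    with (minus ((RtoC (2 * PI)) *: (D y' h)) ((RtoC (2 * PI)) *: (D y h))) by vring.
  refine (int_ext _ _ _ _ _ _ Q); intros t _; vring.
Qed.

(** Mean value inequality for [z |-> G (y + z k) - z D(y) k], whose derivative is controlled by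
    [derivative_lipschitz]. The constant is the same on the whole ball, so the estimate can be
    averaged over circles. *)
Lemma taylor1_bound (y k : U) : norm (minus y x) < rho -> norm (minus (plus y k) x) < rho ->
  norm (minus (minus (G (plus y k)) (G y)) (D y k)) <= M / (rho * rho) * norm k ^ 2.
Proof.
intros Hy Hk.
assert (Ek : minus (plus y k) y = k) by vring.
pose (g := fun z : C => minus (G (plus y (z *: k))) (z *: (D y k))).
pose (g' := fun z : C => minus (D (plus y (z *: k)) k) (D y k)).
assert (Q := cder_mean_value g g' (M / (rho * rho) * norm k ^ 2)).
replace (minus (minus (G (plus y k)) (G y)) (D y k)) with (minus (g (RtoC 1)) (g (RtoC 0))).
2:{ unfold g; replace (plus y ((RtoC 1) *: k)) with (plus y k) by vring.
    replace (plus y ((RtoC 0) *: k)) with y by vring; vring. }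
apply Q; intros s Hs.
assert (Hn := norm_convex_lt x y (plus y k) s rho Hs Hy Hk); rewrite Ek in Hn.
split.
- unfold g, g'; apply cder_minus.
  + apply cder_line, holo_frechet; auto; apply Hb; lra.
  + apply (cder_eq _ _ _ _ (cder_scal _ _ _ _ _ (cder_id (RtoC s)) (cder_const (D y k) (RtoC s)))); vring.
- unfold g'; apply Rle_trans with (1 := derivative_lipschitz y _ k Hy Hn).
  replace (minus (plus y ((RtoC s) *: k)) y) with ((RtoC s) *: k) by vring.
  rewrite norm_scalC, Cmod_R, Rabs_pos_eq by lra.
  pose proof (norm_ge_0 k); pose proof bound_nonneg.
  assert (0 <= M / (rho * rho)) by (apply Rmult_le_pos; [lra|left; apply Rinv_0_lt_compat; nra]).
  replace (M / (rho * rho) * norm k ^ 2) with (M / (rho * rho) * (1 * norm k) * norm k) by ring.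
  apply Rmult_le_compat_r; [lra|]; apply Rmult_le_compat_l; [lra|]; nra.
Qed.

(** It shrinks with [norm h], so that points of the circle times [h] have norm below [rho / 2] for
    every [h], and the circle stays in the [rho]-ball even after a shift of norm below [rho / 2]. *)
Definition second_radius (h : U) : R := rho / (2 * (1 + norm h)).

Lemma second_radius_pos (h : U) : 0 < second_radius h.
Proof. unfold second_radius; apply Rdiv_lt_0_compat; [lra|]; pose proof (norm_ge_0 h); lra. Qed.

Lemma second_radius_ball (h : U) (z : C) (y : U) : Cmod z <= second_radius h -> norm (minus y x) < rho / 2 ->
  norm (minus (plus y (z *: h)) x) < rho.
Proof.
intros Hz Hy; pose proof (norm_ge_0 h) as Hh; pose proof (second_radius_pos h) as Hp.
replace (minus (plus y (z *: h)) x) with (plus (minus y x) (z *: h)) by vring.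
apply Rle_lt_trans with (1 := norm_triangle _ _); rewrite norm_scalC.
assert (E : second_radius h * (1 + norm h) = rho / 2) by (unfold second_radius; field; lra).
pose proof (Cmod_ge_0 z); nra.
Qed.

(* The candidate for the second derivative is the Cauchy mean of [z |-> D (x + z h) k]: linear in
   [k] by construction, and linear in [h] because it approximates [D (x + k) h - D x h]. *)
Definition is_second (k h : U) (b : V) : Prop :=
  is_int (fun t => (/ circle (second_radius h) t) *:
     (D (plus x ((circle (second_radius h) t) *: h)) k)) 0 (2 * PI) ((RtoC (2 * PI)) *: b).

Lemma is_second_exists (k h : U) : exists b, is_second k h b.
Proof.
pose proof PI_RGT_0 as HPI.
pose proof (second_radius_pos h) as Hp; set (r := second_radius h) in *.
destruct (int_exists Vc (fun t => (/ circle r t) *: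
   (D (plus x ((circle r t) *: h)) k)) 0 (2 * PI)) as [l Hl].
2:{ exists ((/ RtoC (2 * PI)) *: l).
    unfold is_second; fold r.
    replace ((RtoC (2 * PI)) *: ((/ RtoC (2 * PI)) *: l)) with l; [exact Hl|].
    vcoefs; field; intros E; apply RtoC_inj in E; lra. }
assert (HM := bound_nonneg).
intros t _.
assert (Hin : forall t, norm (minus (plus x ((circle r t) *: h)) x) < rho).
{ intros u; apply second_radius_ball; [rewrite Cmod_circle; auto; unfold r; lra|].
  replace (minus x x) with (zero : U) by vring; rewrite norm_zero; lra. }
assert (E : forall t, circle r t = cexp (ln r, t)) by (intros; rewrite <- circle_cexp, exp_ln; auto).
assert (Hc : forall eps, 0 < eps -> exists d, 0 < d /\ forall u, Rabs (u - t) < d -> Cmod (circle r u - circle r t) < eps).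
{ intros eps He.
  destruct (cder_cont_at (V := CV) cexp (fun t => (ln r, t)) t Ci (cexp (ln r, t)) (fun s => vline_affine _ _ _) (cder_cexp _) eps He) as [d [Hd K]].
  exists d; split; [exact Hd|]; intros u Hu; rewrite !E; exact (K u Hu). }
intros eps He.
(* [A] and [B] are Lipschitz constants of the integrand as a function of the point of the circle:
   [A] from the factor [1 / circle], [B] from [D]. *)
set (A := / r * / r * (M / rho * norm k)).
set (B := / r * (M / (rho * rho) * norm h * norm k)).
assert (H1r : 0 < / r) by now apply Rinv_0_lt_compat.
assert (HA : 0 <= A).
{ unfold A; repeat apply Rmult_le_pos; try lra; try apply norm_ge_0; left; now apply Rinv_0_lt_compat. }
assert (HB : 0 <= B).
{ unfold B; repeat apply Rmult_le_pos; try lra; try apply norm_ge_0; left; apply Rinv_0_lt_compat; nra. }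
destruct (Hc (eps / (A + B + 1))) as [d [Hd K]]; [apply Rdiv_lt_0_compat; lra|].
exists d; split; [exact Hd|]; intros u Hu.
set (cu := circle r u) in *; set (ct := circle r t) in *.
set (Du := D (plus x (cu *: h)) k); set (Dt := D (plus x (ct *: h)) k).
assert (Hcu : Cmod cu = r) by (apply Cmod_circle; auto); assert (Hct : Cmod ct = r) by (apply Cmod_circle; auto).
assert (Hu0 : cu <> RtoC 0) by (apply Cmod_gt_0; lra); assert (Ht0 : ct <> RtoC 0) by (apply Cmod_gt_0; lra).
change (norm (minus ((/ cu) *: Du) ((/ ct) *: Dt)) < eps).
replace (minus ((/ cu) *: Du) ((/ ct) *: Dt))
  with (plus ((/ cu - / ct) *: Du) ((/ ct) *: (minus Du Dt))) by vring.
apply Rle_lt_trans with (1 := norm_triangle _ _); rewrite !norm_scalC.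
replace (/ cu - / ct)%C with (/ cu * / ct * (ct - cu))%C by (field; auto).
rewrite !Cmod_mult, !Cmod_inv, Hcu, Hct by auto.
replace (ct - cu)%C with (- (cu - ct))%C by ring; rewrite Cmod_opp.
set (q := Cmod (cu - ct)) in *.
assert (Hq : 0 <= q) by apply Cmod_ge_0.
assert (B1 : norm Du <= M / rho * norm k) by (apply derivative_bound; generalize (Hin u); fold cu; lra).
assert (B2 : norm (minus Du Dt) <= M / (rho * rho) * (q * norm h) * norm k).
{ unfold Du, Dt; eapply Rle_trans; [apply derivative_lipschitz; [apply Hin|apply Hin]|].
  right; f_equal; f_equal; unfold q; rewrite <- norm_scalC; f_equal; unfold cu, ct; vring. }
apply Rle_lt_trans with (A * q + B * q).
- apply Rplus_le_compat.
  + apply Rle_trans with (/ r * / r * q * (M / rho * norm k)); [|unfold A; right; ring].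
    apply Rmult_le_compat_l; [|exact B1]; repeat apply Rmult_le_pos; lra.
  + apply Rle_trans with (/ r * (M / (rho * rho) * (q * norm h) * norm k)); [|unfold B; right; ring].
    apply Rmult_le_compat_l; [lra|exact B2].
- assert (Kq : q * (A + B + 1) < eps).
  { apply lt_div_mult; [lra|apply K; exact Hu]. }
  nra.
Qed.

Definition second (k h : U) : V := epsilon (inhabits zero) (is_second k h).

Lemma second_spec (k h : U) : is_second k h (second k h).
Proof. apply (epsilon_spec (inhabits zero) (is_second k h)), is_second_exists. Qed.

Lemma second_plus_l (k k' h : U) : second (plus k k') h = plus (second k h) (second k' h).
Proof.
apply (circle_mean_unique Vc _ _ _ (second_spec (plus k k') h)).
replace ((RtoC (2 * PI)) *: (plus (second k h) (second k' h)))
  with (plus ((RtoC (2 * PI)) *: (second k h)) ((RtoC (2 * PI)) *: (second k' h))) by vring.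
refine (int_ext _ _ _ _ _ _ (int_plus _ _ _ _ _ _ (second_spec k h) (second_spec k' h))).
intros t _; rewrite (linear_plus _ (lin_prop _)); vring.
Qed.

Lemma second_scal_l (c : C) (k h : U) : second (c *: k) h = c *: (second k h).
Proof.
apply (circle_mean_unique Vc _ _ _ (second_spec _ h)).
replace ((RtoC (2 * PI)) *: (c *: (second k h)))
  with (c *: ((RtoC (2 * PI)) *: (second k h))) by vring.
refine (int_ext _ _ _ _ _ _ (int_scal c _ _ _ _ (second_spec k h))).
intros t _; rewrite (linear_scal _ (lin_prop _)); vring.
Qed.

(** The left-hand vector is the Cauchy mean of [G (y + k) - G y - D(y) k] over [y = x + z h], and
    [taylor1_bound] makes this quadratic in [k]. First-order information on [G] thus yields the
    derivative of [D]. *)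
Lemma second_estimate (k h : U) : norm k < rho / 2 ->
  norm (minus (minus (D (plus x k) h) (D x h)) (second k h)) <= M / (rho * rho) * norm k ^ 2 / second_radius h.
Proof.
intros Hk; pose proof (second_radius_pos h) as Hp; pose proof (norm_ge_0 h) as Hh; pose proof (norm_ge_0 k) as Hk0.
set (r := second_radius h).
assert (Exx : norm (minus x x) = 0) by (replace (minus x x) with (zero : U) by vring; apply norm_zero).
assert (Hxk : norm (minus (plus x k) x) < rho / 2) by (replace (minus (plus x k) x) with k by vring; exact Hk).
assert (Hc : forall y : U, norm (minus y x) < rho / 2 ->
  is_int (fun t => (/ circle r t) *: (G (plus y ((circle r t) *: h)))) 0 (2 * PI)
    ((RtoC (2 * PI)) *: (D y h))).
{ intros y Hy; apply cauchy_derivative with (2 * r); [unfold r; lra|].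
  intros z Hz; apply Hb.
  replace (minus (plus y (z *: h)) x) with (plus (minus y x) (z *: h)) by vring.
  apply Rle_lt_trans with (1 := norm_triangle _ _); rewrite norm_scalC.
  assert (E : r * (1 + norm h) = rho / 2) by (unfold r, second_radius; field; lra).
  pose proof (Cmod_ge_0 z); nra. }
apply (circle_mean_bound (fun t => minus (minus (G (plus (plus x ((circle r t) *: h)) k))
   (G (plus x ((circle r t) *: h)))) (D (plus x ((circle r t) *: h)) k)) r); auto.
- intros t; apply taylor1_bound.
  + apply second_radius_ball; [rewrite Cmod_circle; auto; unfold r; lra|lra].
  + replace (plus (plus x ((circle r t) *: h)) k) with (plus (plus x k) ((circle r t) *: h)) by vring.
    apply second_radius_ball; [rewrite Cmod_circle; auto; unfold r; lra|lra].
- assert (Q := int_minus _ _ _ _ _ _ (int_minus _ _ _ _ _ _ (Hc (plus x k) Hxk) (Hc x ltac:(lra))) (second_spec k h)).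
  match goal with |- is_int _ _ _ ?X => match type of Q with is_int _ _ _ ?Y => replace X with Y by vring end end.
  refine (int_ext _ _ _ _ _ _ Q); intros t _; fold r.
  replace (plus (plus x k) ((circle r t) *: h))
    with (plus (plus x ((circle r t) *: h)) k) by vring.
  vring.
Qed.

Lemma zero_of_quadratic_bound (v : V) (d K : R) : 0 < d ->
  (forall t, 0 < t < d -> norm ((RtoC t) *: v) <= K * t ^ 2) -> v = zero.
Proof.
intros Hd H; apply norm_eq_zero, Rle_antisym; [|apply norm_ge_0].
apply le_epsilon; intros e He; rewrite Rplus_0_l.
set (t := Rmin (d / 2) (e / (Rabs K + 1))).
pose proof (Rabs_pos K) as HK.
assert (Ht : 0 < t) by (apply Rmin_glb_lt; [lra|apply Rdiv_lt_0_compat; lra]).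
assert (Ht1 : t <= d / 2) by apply Rmin_l; assert (Ht2 : t <= e / (Rabs K + 1)) by apply Rmin_r.
specialize (H t ltac:(lra)); rewrite scal_div_pos in H by lra.
assert (H1 : norm v <= K * t) by (apply Rmult_le_reg_l with t; [lra|]; lra).
assert (H2 : t * (Rabs K + 1) <= e).
{ apply Rmult_le_compat_r with (r := Rabs K + 1) in Ht2; [|lra].
  replace (e / (Rabs K + 1) * (Rabs K + 1)) with e in Ht2 by (field; lra); exact Ht2. }
generalize (Rle_abs K); nra.
Qed.

Definition second_error (k h : U) : V := minus (minus (D (plus x k) h) (D x h)) (second k h).

Lemma second_error_small (k h : U) : exists d K, 0 < d /\ forall t, 0 < t < d ->
  norm (second_error ((RtoC t) *: k) h) <= K * t ^ 2.
Proof.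
pose proof (norm_ge_0 k) as Hk; pose proof (second_radius_pos h) as Hp.
exists (rho / 2 / (norm k + 1)), (M / (rho * rho) * norm k ^ 2 / second_radius h).
split; [apply Rdiv_lt_0_compat; lra|]; intros t Ht.
assert (E : norm ((RtoC t) *: k) = t * norm k) by (apply scal_div_pos; lra).
apply Rle_trans with (1 := second_estimate ((RtoC t) *: k) h ltac:(rewrite E;
  replace (rho / 2) with (rho / 2 / (norm k + 1) * (norm k + 1)) by (field; lra); nra)).
rewrite E; right; field; lra.
Qed.

(** [D (x + t k)] and [D x] are additive, so the defect of additivity of [second (t k)] is a
    combination of three errors and is [O(t^2)]. By [second_scal_l] it is also [t] times the defect
    for [k], which must therefore vanish. *)
Lemma second_plus_r (k h h' : U) : second k (plus h h') = plus (second k h) (second k h').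
Proof.
destruct (second_error_small k (plus h h')) as [d1 [K1 [Hd1 H1]]].
destruct (second_error_small k h) as [d2 [K2 [Hd2 H2]]].
destruct (second_error_small k h') as [d3 [K3 [Hd3 H3]]].
assert (E : minus (second k (plus h h')) (plus (second k h) (second k h')) = zero).
{ apply (zero_of_quadratic_bound _ (Rmin d1 (Rmin d2 d3)) (K1 + (K2 + K3))).
  { repeat apply Rmin_glb_lt; auto. }
  intros t Ht.
  assert (Ht1 : t < d1) by (apply Rlt_le_trans with (1 := proj2 Ht), Rmin_l).
  assert (Ht2 : t < d2) by (apply Rlt_le_trans with (1 := proj2 Ht); eapply Rle_trans; [apply Rmin_r|apply Rmin_l]).
  assert (Ht3 : t < d3) by (apply Rlt_le_trans with (1 := proj2 Ht); eapply Rle_trans; [apply Rmin_r|apply Rmin_r]).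
  specialize (H1 t ltac:(lra)); specialize (H2 t ltac:(lra)); specialize (H3 t ltac:(lra)).
  match goal with |- norm ?X <= _ => replace X with
    (plus (opp (second_error ((RtoC t) *: k) (plus h h')))
      (plus (second_error ((RtoC t) *: k) h) (second_error ((RtoC t) *: k) h'))) end.
  2:{ unfold second_error; rewrite !second_scal_l, !(linear_plus _ (lin_prop _) h h'); vring. }
  apply Rle_trans with (1 := norm_triangle _ _); rewrite norm_opp.
  rewrite Rmult_plus_distr_r; apply Rplus_le_compat; [exact H1|].
  apply Rle_trans with (1 := norm_triangle _ _); lra. }
replace (second k (plus h h')) with (plus (plus (second k h) (second k h'))
  (minus (second k (plus h h')) (plus (second k h) (second k h')))) by vring.
rewrite E; vring.
Qed.

Lemma second_scal_r (c : C) (k h : U) : second k (c *: h) = c *: (second k h).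
Proof.
destruct (second_error_small k (c *: h)) as [d1 [K1 [Hd1 H1]]].
destruct (second_error_small k h) as [d2 [K2 [Hd2 H2]]].
assert (E : minus (second k (c *: h)) (c *: (second k h)) = zero).
{ apply (zero_of_quadratic_bound _ (Rmin d1 d2) (K1 + Cmod c * K2)).
  { repeat apply Rmin_glb_lt; auto. }
  intros t Ht.
  assert (Ht1 : t < d1) by (apply Rlt_le_trans with (1 := proj2 Ht), Rmin_l).
  assert (Ht2 : t < d2) by (apply Rlt_le_trans with (1 := proj2 Ht), Rmin_r).
  specialize (H1 t ltac:(lra)); specialize (H2 t ltac:(lra)).
  match goal with |- norm ?X <= _ => replace X with
    (plus (opp (second_error ((RtoC t) *: k) (c *: h)))
      (c *: (second_error ((RtoC t) *: k) h))) end.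
  2:{ unfold second_error; rewrite !second_scal_l, !(linear_scal _ (lin_prop _) c h); vring. }
  apply Rle_trans with (1 := norm_triangle _ _); rewrite norm_opp, norm_scalC.
  pose proof (Cmod_ge_0 c); nra. }
replace (second k (c *: h)) with (plus (c *: (second k h))
  (minus (second k (c *: h)) (c *: (second k h)))) by vring.
rewrite E; vring.
Qed.

Lemma second_radius_unit (h : U) : norm h <= 1 -> rho / 4 <= second_radius h.
Proof.
intros Hh; pose proof (norm_ge_0 h); unfold second_radius.
apply Rmult_le_compat_l; [lra|]; apply Rinv_le_contravar; lra.
Qed.

Lemma second_bound_unit (k h : U) : norm h <= 1 -> norm (second k h) <= 4 * M / (rho * rho) * norm k.
Proof.
intros Hh; pose proof (second_radius_pos h) as Hp; pose proof (norm_ge_0 k) as Hk.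
assert (H := second_radius_unit h Hh); pose proof bound_nonneg as HM.
apply Rle_trans with (M / rho * norm k / second_radius h).
- refine (circle_mean_bound _ _ _ _ Hp _ (second_spec k h)).
  intros t; apply derivative_bound.
  apply Rlt_trans with rho; [|lra]; apply second_radius_ball; [rewrite Cmod_circle; lra|].
  replace (minus x x) with (zero : U) by vring; rewrite norm_zero; lra.
- replace (4 * M / (rho * rho) * norm k) with (M / rho * norm k * / (rho / 4)) by (field; lra).
  apply Rmult_le_compat_l; [|apply Rinv_le_contravar; lra].
  repeat apply Rmult_le_pos; try lra; left; now apply Rinv_0_lt_compat.
Qed.

Lemma second_bound (k h : U) : norm (second k h) <= 4 * M / (rho * rho) * norm k * norm h.
Proof.
destruct (Req_dec (norm h) 0) as [E|E].
- rewrite E, Rmult_0_r; rewrite (norm_eq_zero _ E).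
  replace (zero : U) with ((RtoC 0) *: (zero : U)) by vring.
  rewrite second_scal_r, norm_scalC, Cmod_0; lra.
- assert (Hp : 0 < norm h) by (generalize (norm_ge_0 h); lra).
  assert (H0 : RtoC (norm h) <> RtoC 0) by (intros E'; apply RtoC_inj in E'; lra).
  replace h with ((RtoC (norm h)) *: ((/ RtoC (norm h)) *: h)) at 1
    by (vcoefs; field; auto).
  rewrite second_scal_r, scal_div_pos by lra.
  rewrite (Rmult_comm _ (norm h)); apply Rmult_le_compat_l; [lra|].
  apply second_bound_unit; rewrite norm_scalC, Cmod_inv, Cmod_R, Rabs_pos_eq by (auto; lra).
  right; field; lra.
Qed.

Lemma is_linear_second (k : U) : is_linear (second k).
Proof.
split; [apply second_plus_r|intros c h; apply second_scal_r|].
assert (HM := bound_nonneg); pose proof (norm_ge_0 k).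
assert (0 <= 4 * M / (rho * rho) * norm k).
{ repeat apply Rmult_le_pos; try lra; left; apply Rinv_0_lt_compat; nra. }
exists (4 * M / (rho * rho) * norm k + 1); split; [lra|].
intros h; apply Rle_trans with (1 := second_bound k h).
apply Rmult_le_compat_r; [apply norm_ge_0|lra].
Qed.

Definition second_lin (k : U) : Lin U V := mkLin (second k) (is_linear_second k).

Lemma is_linear_second_lin : is_linear second_lin.
Proof.
split.
- intros k k'; apply Lin_ext; intros h; apply second_plus_l.
- intros c k; apply Lin_ext; intros h; apply second_scal_l.
- assert (HM := bound_nonneg).
  assert (0 <= 4 * M / (rho * rho)).
  { repeat apply Rmult_le_pos; try lra; left; apply Rinv_0_lt_compat; nra. }
  exists (4 * M / (rho * rho) + 1); split; [lra|]; intros k.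
  apply Rle_trans with (4 * M / (rho * rho) * norm k).
  + apply Lin_norm_least; intros h Hh; apply second_bound_unit; exact Hh.
  + apply Rmult_le_compat_r; [apply norm_ge_0|lra].
Qed.

(** Unit vectors [h] have [second_radius h >= rho / 4], so [second_estimate] is uniform over them
    and gives differentiability in the operator norm. *)
Lemma fder_frechet_local : fder D x second_lin.
Proof.
intros eps He; assert (HM := bound_nonneg).
set (K := 4 * M / (rho * rho * rho)).
assert (HK : 0 <= K).
{ unfold K; repeat apply Rmult_le_pos; try lra; left; apply Rinv_0_lt_compat; repeat apply Rmult_lt_0_compat; lra. }
set (d := Rmin (rho / 2) (eps / (K + 1))).
assert (Hd : 0 < d) by (apply Rmin_glb_lt; [lra|apply Rdiv_lt_0_compat; lra]).
exists d; split; [exact Hd|]; intros y Hy.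
set (k := minus y x) in *.
assert (Ey : y = plus x k) by (unfold k; vring).
assert (H1 : norm k < rho / 2) by (apply Rlt_le_trans with (1 := Hy), Rmin_l).
assert (H2 : norm k < eps / (K + 1)) by (apply Rlt_le_trans with (1 := Hy), Rmin_r).
pose proof (norm_ge_0 k) as Hk.
apply Rle_trans with (K * norm k ^ 2).
- apply Lin_norm_least; intros h Hh; rewrite Ey.
  change (norm (second_error k h) <= K * norm k ^ 2).
  apply Rle_trans with (1 := second_estimate k h H1).
  pose proof (second_radius_pos h); pose proof (second_radius_unit h Hh).
  replace (K * norm k ^ 2) with (M / (rho * rho) * norm k ^ 2 * / (rho / 4)) by (unfold K; field; lra).
  apply Rmult_le_compat_l; [|apply Rinv_le_contravar; lra].
  repeat apply Rmult_le_pos; try lra; left; apply Rinv_0_lt_compat; nra.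
- assert (H3 : norm k * (K + 1) < eps).
  { apply lt_div_mult; [lra|exact H2]. }
  nra.
Qed.

End Holomorphic.

(** Differentiability at [x] makes [G] continuous, hence bounded near [x]; dividing the available
    radius by 3 makes room for the nested balls of the local construction. *)
Lemma frechet_holo {U V : NormedModule C_AbsRing} (Vc : completion_data V) (G : U -> V) :
  holo G -> holo (frechet G).
Proof.
intros HG x Hx.
destruct (fder_continuous G x _ (holo_frechet G x HG Hx) 1 Rlt_0_1) as [d [Hd K]].
set (rho := Rmin d (1 - norm x) / 3).
assert (Hm : 0 < Rmin d (1 - norm x)) by (apply Rmin_glb_lt; lra).
assert (Hrho : 0 < rho) by (unfold rho; lra).
assert (Hb : forall y : U, norm (minus y x) < 3 * rho -> norm y < 1 /\ norm (G y) <= norm (G x) + 1).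
{ intros y Hy; replace (3 * rho) with (Rmin d (1 - norm x)) in Hy by (unfold rho; field).
  assert (H1 := Rlt_le_trans _ _ _ Hy (Rmin_l _ _)); assert (H2 := Rlt_le_trans _ _ _ Hy (Rmin_r _ _)).
  split.
  - generalize (norm_le_sub y x); lra.
  - generalize (norm_le_sub (G y) (G x)) (K y H1); lra. }
exists (mkLin _ (is_linear_second_lin Vc G HG x rho _ Hrho Hb)).
exact (fder_frechet_local Vc G HG x rho _ Hrho Hb).
Qed.

(** * Completeness of the operator spaces *)

Section LinComplete.

Context {U V : NormedModule C_AbsRing} (Vc : completion_data V).

(** The limit is taken pointwise, [v u] being the limit of the image filter [Fu u]. Linearity and
    boundedness pass to [v] by choosing one [f] that is close to it at the finitely many vectors
    concerned. *)
Lemma Lin_cauchy_limit (F : (Lin_NormedModule U V -> Prop) -> Prop) : ProperFilter F ->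
  cauchy (T := Lin_NormedModule U V) F ->
  exists L : Lin U V, forall eps : posreal, F (ball (M := Lin_NormedModule U V) L eps).
Proof.
intros FF HF.
assert (HF' : forall eps, 0 < eps -> exists f0 : Lin U V, F (fun f => Lin_norm (Lin_plus f (Lin_opp f0)) < eps)).
{ intros eps He; exact (HF (mkposreal eps He)). }
assert (Hev : forall (f g : Lin U V) (u : U), norm (minus (f u) (g u)) <= Lin_norm (Lin_plus f (Lin_opp g)) * norm u).
{ intros f g u; exact (Lin_norm_apply (Lin_plus f (Lin_opp g)) u). }
pose (Fu := fun (u : U) (P : V -> Prop) => F (fun f : Lin U V => P (f u))).
assert (HFu : forall u, ProperFilter (Fu u)).
{ intros u; split.
  - intros P HP; destruct (filter_ex (F := F) _ HP) as [f Hf]; now exists (lin_fun f u).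
  - split.
    + exact (filter_true (F := F)).
    + intros P Q HP HQ; exact (filter_and (F := F) _ _ HP HQ).
    + intros P Q HPQ HP; refine (filter_imp (F := F) _ _ _ HP); intros f; apply HPQ. }
assert (HCu : forall u, cauchy (T := NormedModule.UniformSpace C_AbsRing V) (Fu u)).
{ intros u eps; pose proof (norm_ge_0 u) as Hu; pose proof (cond_pos eps) as He.
  destruct (HF' (eps / (norm u + 1))) as [f0 Hf0]; [apply Rdiv_lt_0_compat; lra|].
  exists (f0 u); refine (filter_imp (F := F) _ _ _ Hf0); intros f Hf.
  apply (norm_compat1 (K := C_AbsRing) (V := V)).
  apply Rle_lt_trans with (1 := Hev f f0 u).
  assert (Hq : Lin_norm (Lin_plus f (Lin_opp f0)) * (norm u + 1) < eps).
  { apply lt_div_mult; [lra|exact Hf]. }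
  pose proof (Lin_norm_ge_0 (Lin_plus f (Lin_opp f0))); nra. }
pose (v := fun u : U => CompleteSpace.lim _ Vc (Fu u)).
assert (Hv : forall u eps, 0 < eps -> F (fun f => norm (minus (f u) (v u)) < eps)).
{ intros u eps He.
  assert (Hnf := norm_factor_gt_0 (K := C_AbsRing) (V := V)).
  assert (He' : 0 < eps / @norm_factor C_AbsRing V) by now apply Rdiv_lt_0_compat.
  assert (Q := CompleteSpace.ax1 _ Vc (Fu u) (HFu u) (HCu u) (mkposreal _ He')).
  refine (filter_imp (F := F) _ _ _ Q); intros f Hf.
  assert (Q2 := norm_compat2 (K := C_AbsRing) (V := V) _ _ _ Hf); simpl in Q2.
  replace eps with (@norm_factor C_AbsRing V * (eps / @norm_factor C_AbsRing V)) by (field; lra); exact Q2. }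
assert (Hzero : forall w : V, (forall eps, 0 < eps -> norm w <= eps) -> w = zero).
{ intros w Hw; apply norm_eq_zero, Rle_antisym; [|apply norm_ge_0].
  apply le_epsilon; intros e He; rewrite Rplus_0_l; auto. }
assert (Hplus : forall a b, v (plus a b) = plus (v a) (v b)).
{ intros a b; assert (E : minus (v (plus a b)) (plus (v a) (v b)) = zero).
  { apply Hzero; intros eps He.
    destruct (filter_ex (F := F) _ (filter_and (F := F) _ _ (Hv (plus a b) (eps / 3) ltac:(lra))
      (filter_and (F := F) _ _ (Hv a (eps / 3) ltac:(lra)) (Hv b (eps / 3) ltac:(lra))))) as [f [H1 [H2 H3]]].
    rewrite norm_sub_sym in H1.
    replace (minus (v (plus a b)) (plus (v a) (v b))) with
      (plus (minus (v (plus a b)) (f (plus a b))) (plus (minus (f a) (v a)) (minus (f b) (v b)))).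
    2:{ rewrite (linear_plus _ (lin_prop f)); vring. }
    apply Rle_trans with (1 := norm_triangle _ _).
    apply Rle_trans with (eps / 3 + (eps / 3 + eps / 3)); [|lra].
    apply Rplus_le_compat; [left; exact H1|].
    apply Rle_trans with (1 := norm_triangle _ _); apply Rplus_le_compat; left; [exact H2|exact H3]. }
  replace (v (plus a b)) with (plus (plus (v a) (v b)) (minus (v (plus a b)) (plus (v a) (v b)))) by vring.
  rewrite E; vring. }
assert (Hscal : forall (c : C) a, v (c *: a) = c *: (v a)).
{ intros c a; assert (E : minus (v (c *: a)) (c *: (v a)) = zero).
  { apply Hzero; intros eps He; pose proof (Cmod_ge_0 c) as Hc.
    assert (He2 : 0 < eps / 2 / (Cmod c + 1)) by (apply Rdiv_lt_0_compat; lra).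
    destruct (filter_ex (F := F) _ (filter_and (F := F) _ _ (Hv (c *: a) (eps / 2) ltac:(lra)) (Hv a _ He2))) as [f [H1 H2]].
    rewrite norm_sub_sym in H1.
    replace (minus (v (c *: a)) (c *: (v a))) with
      (plus (minus (v (c *: a)) (f (c *: a))) (c *: (minus (f a) (v a)))).
    2:{ rewrite (linear_scal _ (lin_prop f)); vring. }
    apply Rle_trans with (1 := norm_triangle _ _); rewrite norm_scalC.
    assert (Hq : norm (minus (f a) (v a)) * (Cmod c + 1) < eps / 2).
    { apply lt_div_mult; [lra|exact H2]. }
    pose proof (norm_ge_0 (minus (f a) (v a))); nra. }
  replace (v (c *: a)) with (plus (c *: (v a)) (minus (v (c *: a)) (c *: (v a)))) by vring.
  rewrite E; vring. }
assert (Hbound : exists M, 0 < M /\ forall u, norm (v u) <= M * norm u).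
{ destruct (HF' 1 Rlt_0_1) as [f0 Hf0]; pose proof (Lin_norm_ge_0 f0) as H0.
  exists (Lin_norm f0 + 1); split; [lra|]; intros u.
  apply le_epsilon; intros e He.
  destruct (filter_ex (F := F) _ (filter_and (F := F) _ _ Hf0 (Hv u e He))) as [f [H1 H2]].
  rewrite norm_sub_sym in H2.
  assert (H3 := norm_le_sub (v u) (f u)); assert (H4 := norm_le_sub (f u) (f0 u)).
  assert (H5 := Hev f f0 u); assert (H6 := Lin_norm_apply f0 u); pose proof (norm_ge_0 u).
  assert (Lin_norm (Lin_plus f (Lin_opp f0)) * norm u <= 1 * norm u) by (apply Rmult_le_compat_r; lra).
  lra. }
exists (mkLin v (Build_is_linear v Hplus Hscal Hbound)).
intros eps; pose proof (cond_pos eps) as He.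
destruct (HF' (eps / 4)) as [f0 Hf0]; [lra|].
refine (filter_imp (F := F) _ _ _ Hf0); intros f Hf.
apply Rle_lt_trans with (3 / 4 * eps); [|lra].
apply Lin_norm_least; intros u Hu.
change (norm (minus (f u) (v u)) <= 3 / 4 * eps).
(* The auxiliary [g] depends on [u], but the resulting bound [3 / 4 * eps] does not, since [f] and
   [g] are both compared in norm with the fixed [f0]. *)
destruct (filter_ex (F := F) _ (filter_and (F := F) _ _ Hf0 (Hv u (eps / 4) ltac:(lra)))) as [g [H1 H2]].
assert (H3 := norm_sub_triangle (f u) (f0 u) (v u)); assert (H4 := norm_sub_triangle (f0 u) (g u) (v u)).
rewrite (norm_sub_sym (f0 u) (g u)) in H4.
assert (H5 := Hev f f0 u); assert (H6 := Hev g f0 u); pose proof (norm_ge_0 u).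
pose proof (Lin_norm_ge_0 (Lin_plus f (Lin_opp f0))); pose proof (Lin_norm_ge_0 (Lin_plus g (Lin_opp f0))).
nra.
Qed.

Definition Lin_complete : completion_data (Lin_NormedModule U V).
Proof.
refine (CompleteSpace.Mixin (NormedModule.UniformSpace C_AbsRing (Lin_NormedModule U V))
  (fun F => epsilon (inhabits Lin_zero) (fun L : Lin U V => forall eps : posreal, F (ball (M := Lin_NormedModule U V) L eps))) _ _).
- intros F FF HF.
  apply (epsilon_spec (inhabits Lin_zero) (fun L : Lin U V => forall eps : posreal, F (ball (M := Lin_NormedModule U V) L eps))).
  exact (Lin_cauchy_limit F FF HF).
- intros F1 F2 H12 H21.
  replace F2 with F1; [intros eps; apply ball_center|].
  apply functional_extensionality; intros P; apply propositional_extensionality; split; [apply H21|apply H12].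
Defined.

End LinComplete.

(** Each further derivative takes values in the next operator space, and the Cauchy integrals there
    rely on its completeness. *)
Fixpoint MLin_complete {U V : NormedModule C_AbsRing} (Vc : completion_data V) (n : nat) :
    completion_data (MLin U V n) :=
  match n return completion_data (MLin U V n) with
  | O => Vc
  | S m => Lin_complete (MLin_complete Vc m)
  end.

Lemma frechet_n_holo {U V : NormedModule C_AbsRing} (Vc : completion_data V) (F : U -> V) (n : nat) :
  holo F -> holo (frechet_n F n).
Proof.
intros HF; induction n as [|n IH]; [exact HF|].
exact (frechet_holo (MLin_complete Vc n) (frechet_n F n) IH).
Qed.

Lemma is_linear_eval {U V : NormedModule C_AbsRing} (x : U) : is_linear (fun A : Lin U V => A x).
Proof.
split; [reflexivity|reflexivity|].
pose proof (norm_ge_0 x).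
exists (norm x + 1); split; [lra|]; intros A.
apply Rle_trans with (1 := Lin_norm_apply A x).
rewrite Rmult_comm; apply Rmult_le_compat_r; [apply Lin_norm_ge_0|lra].
Qed.

Lemma is_linear_MLin_diag {U V : NormedModule C_AbsRing} (n : nat) (x : U) :
  is_linear (fun A : MLin U V n => MLin_diag n A x).
Proof.
induction n as [|n IH]; [apply is_linear_id|].
exact (is_linear_comp (fun A : Lin U (MLin U V n) => A x) (fun A => MLin_diag n A x) (is_linear_eval x) IH).
Qed.

(* The n-th derivative of z |-> F (z x). *)
Definition line_deriv {U V : NormedModule C_AbsRing} (F : U -> V) (x : U) (n : nat) (z : C) : V :=
  MLin_diag n (frechet_n F n (z *: x)) x.

Lemma cder_frechet_n_line {U V : NormedModule C_AbsRing} (Vc : completion_data V) (F : U -> V) (x : U) (n : nat) (z : C) :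
  holo F -> Cmod z * norm x < 1 ->
  cder (fun w => frechet_n F n (w *: x)) z (lin_fun (frechet_n F (S n) (z *: x)) x).
Proof.
intros HF Hz.
assert (E : forall w : C, plus zero (w *: x) = w *: x) by (intros; apply plus_zero_l).
apply (cder_ext (fun w => frechet_n F n (plus zero (w *: x))) _ _ _ 1 Rlt_0_1); [intros; now rewrite E|].
apply cder_line; rewrite E.
apply holo_frechet; [apply frechet_n_holo; auto|rewrite norm_scalC; exact Hz].
Qed.

Lemma cder_line_deriv {U V : NormedModule C_AbsRing} (Vc : completion_data V) (F : U -> V) (x : U) (n : nat) (z : C) :
  holo F -> Cmod z * norm x < 1 -> cder (line_deriv F x n) z (line_deriv F x (S n) z).
Proof.
intros HF Hz.
exact (cder_lin (mkLin _ (is_linear_MLin_diag n x)) _ _ _ (cder_frechet_n_line Vc F x n z HF Hz)).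
Qed.

(** * Coefficients of Schwarz functions *)

(** [f = o(|z|^n)] at 0, with the point 0 included, so that [f 0 = zero]. *)
Definition small {V : NormedModule C_AbsRing} (n : nat) (f : C -> V) : Prop :=
  forall eps, 0 < eps -> exists d, 0 < d /\ forall z, Cmod z < d -> norm (f z) <= eps * Cmod z ^ n.

Definition C_complete : completion_data C_NormedModule := C_CompleteSpace_mixin.

Definition quad (a0 a1 a2 z : C) : C := (a0 + a1 * z + a2 * z * z)%C.

(** Parseval's identity for a quadratic polynomial, checked through the explicit trigonometric
    primitive [Phi]. *)
Lemma int_quad_sqr (a0 a1 a2 : C) (r : R) :
  is_RInt (fun t => Cmod (quad a0 a1 a2 (circle r t)) ^ 2) 0 (2 * PI)
    (2 * PI * (Cmod a0 ^ 2 + Cmod a1 ^ 2 * r ^ 2 + Cmod a2 ^ 2 * r ^ 4)).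
Proof.
destruct a0 as [p0 q0], a1 as [p1 q1], a2 as [p2 q2].
set (S := Cmod (p0, q0) ^ 2 + Cmod (p1, q1) ^ 2 * r ^ 2 + Cmod (p2, q2) ^ 2 * r ^ 4).
set (K1 := 2 * r * (p0 * p1 + q0 * q1) + 2 * r ^ 3 * (p1 * p2 + q1 * q2)).
set (K2 := 2 * r * (q0 * p1 - p0 * q1) + 2 * r ^ 3 * (q1 * p2 - p1 * q2)).
set (K3 := 2 * r ^ 2 * (p0 * p2 + q0 * q2)).
set (K4 := 2 * r ^ 2 * (q0 * p2 - p0 * q2)).
pose (Phi := fun t => S * t + K1 * sin t - K2 * cos t + K3 / 2 * sin (2 * t) - K4 / 2 * cos (2 * t)).
apply (is_RInt_ext (fun t => S + K1 * cos t + K2 * sin t + K3 * cos (2 * t) + K4 * sin (2 * t))).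
{ intros t _; match goal with |- ?a = ?b => change (@eq R a b) end; rewrite cos_2a, sin_2a; unfold S; rewrite !Cmod_sqr.
  unfold quad, circle, Cplus, Cmult; simpl fst; simpl snd; unfold K1, K2, K3, K4.
  generalize (sin2_cos2 t); unfold Rsqr; generalize (sin t) (cos t); intros s c H.
  replace (p0 ^ 2 + q0 ^ 2 + (p1 ^ 2 + q1 ^ 2) * r ^ 2 + (p2 ^ 2 + q2 ^ 2) * r ^ 4)
    with (p0 ^ 2 + q0 ^ 2 + (p1 ^ 2 + q1 ^ 2) * r ^ 2 * (s * s + c * c) + (p2 ^ 2 + q2 ^ 2) * r ^ 4 * (s * s + c * c) ^ 2)
    by (rewrite H; ring).
  replace (2 * r * (p0 * p1 + q0 * q1) + 2 * r ^ 3 * (p1 * p2 + q1 * q2))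
    with (2 * r * (p0 * p1 + q0 * q1) + 2 * r ^ 3 * (p1 * p2 + q1 * q2) * (s * s + c * c)) by (rewrite H; ring).
  replace (2 * r * (q0 * p1 - p0 * q1) + 2 * r ^ 3 * (q1 * p2 - p1 * q2))
    with (2 * r * (q0 * p1 - p0 * q1) + 2 * r ^ 3 * (q1 * p2 - p1 * q2) * (s * s + c * c)) by (rewrite H; ring).
  ring. }
replace (2 * PI * S) with (minus (Phi (2 * PI)) (Phi 0)).
2:{ match goal with |- minus ?a ?b = ?c => change (a - b = c) end; unfold Phi; rewrite !Rmult_0_r.
    replace (2 * (2 * PI)) with (0 + 2 * INR 2 * PI) by (simpl; ring).
    rewrite cos_period, sin_period, cos_2PI, sin_2PI, cos_0, sin_0; ring. }
apply (is_RInt_derive Phi).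
- intros t _; unfold Phi; auto_derive; auto; field.
- intros t _; apply (ex_derive_continuous (fun t => S + K1 * cos t + K2 * sin t + K3 * cos (2 * t) + K4 * sin (2 * t))).
  auto_derive; auto.
Qed.

(** The coefficient of [z^n] is the mean of [g z / z^n] on the circle of radius [r], so [r^n] times
    its modulus is at most the mean of the squared modulus of the quadratic, a Parseval sum. Then
    [r] tends to 1. *)
Lemma coefficient_bound (g : C -> C) (n : nat) (e1 e2 e3 a0 a1 a2 : C) : (n = 2%nat \/ n = 3%nat) ->
  (forall z, 0 < Cmod z < 1 -> exists l, cderC g z l) ->
  (forall z, 0 < Cmod z < 1 -> Cmod (g z) <= Cmod (quad a0 a1 a2 z) ^ 2) ->
  small (V := CV) 3 (fun z => g z - (e1 * z + e2 * z * z + e3 * z * z * z))%C ->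
  Cmod (if Nat.eqb n 2 then e2 else e3) <= Cmod a0 ^ 2 + Cmod a1 ^ 2 + Cmod a2 ^ 2.
Proof.
intros Hn Hg Hb Hs; pose proof PI_RGT_0 as HPI.
set (e := if Nat.eqb n 2 then e2 else e3).
set (S := Cmod a0 ^ 2 + Cmod a1 ^ 2 + Cmod a2 ^ 2).
assert (HS : 0 <= S) by (unfold S; pose proof (pow2_ge_0 (Cmod a0)); pose proof (pow2_ge_0 (Cmod a1)); pose proof (pow2_ge_0 (Cmod a2)); lra).
(* Polar coefficients of [g z / z^n]: only [e1 / z] for [n = 2], both [e2 / z] and [e1 / z^2] for
   [n = 3]. *)
set (d1 := if Nat.eqb n 2 then e1 else e2).
set (d2 := if Nat.eqb n 2 then RtoC 0 else e1).
assert (Hr : forall r, 0 < r < 1 -> r ^ n * Cmod e <= S).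
{ intros r Hr0.
  assert (Hrn : 0 < r ^ n) by (apply pow_lt; lra).
  assert (I : is_int (V := CV) (fun t => ((/ circle r t) ^ n * g (circle r t))%C) 0 (2 * PI)
     ((RtoC (2 * PI)) *: (e : CV))).
  { apply (circle_mean (V := CV) C_complete (fun z => ((/ z) ^ n * g z)%C) 1 r e d1 d2 (RtoC 0)); [lra| |].
    - intros z Hz; destruct (Hg z Hz) as [l Hl].
      assert (Hz0 : z <> RtoC 0) by (apply Cmod_gt_0; lra).
      assert (Hpow : forall m, exists l, cderC (fun z => (/ z) ^ m)%C z l).
      { induction m as [|m [l' IH]]; [exists (RtoC 0); exact (cder_const (V := CV) (RtoC 1) z)|].
        eexists; exact (cder_scal (V := CV) (fun z => / z)%C (fun z => (/ z) ^ m)%C z _ _ (cder_inv z Hz0) IH). }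
      destruct (Hpow n) as [l' Hl'].
      eexists; exact (cder_scal (V := CV) _ g z _ _ Hl' Hl).
    - intros eps He; pose proof (Cmod_ge_0 e3) as He3.
      destruct (Hs (eps / 2) ltac:(lra)) as [d [Hd K]].
      set (d' := eps / 2 / (Cmod e3 + 1)).
      assert (Hd' : 0 < d') by (apply Rdiv_lt_0_compat; lra).
      assert (Ed' : d' * (Cmod e3 + 1) = eps / 2) by (unfold d'; field; lra).
      exists (Rmin d (Rmin 1 d')); split; [repeat apply Rmin_glb_lt; lra|]; intros z Hz.
      assert (Hz1 : Cmod z < d) by (apply Rlt_le_trans with (1 := proj2 Hz), Rmin_l).
      assert (Hz2 : Cmod z < 1) by (apply Rlt_le_trans with (1 := proj2 Hz); eapply Rle_trans; [apply Rmin_r|apply Rmin_l]).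
      assert (Hz3 : Cmod z < d') by (apply Rlt_le_trans with (1 := proj2 Hz); eapply Rle_trans; [apply Rmin_r|apply Rmin_r]).
      assert (Hz0 : z <> RtoC 0) by (apply Cmod_gt_0; lra).
      specialize (K z Hz1).
      change (Cmod (g z - (e1 * z + e2 * z * z + e3 * z * z * z)) <= eps / 2 * Cmod z ^ 3) in K.
      set (h := (g z - (e1 * z + e2 * z * z + e3 * z * z * z))%C) in *.
      assert (Eg : g z = (h + (e1 * z + e2 * z * z + e3 * z * z * z))%C) by (unfold h; ring).
      rewrite Eg.
      assert (Hm : 0 < Cmod z) by lra.
      destruct Hn as [-> | ->]; unfold e, d1, d2; simpl Nat.eqb; cbv iota.
      + match goal with |- norm ?X <= _ => change (Cmod X <= eps) end.
        match goal with |- Cmod ?X <= _ => replace X with (/ z * / z * h + e3 * z)%C by (cfold; simpl; field; auto) end.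
        apply Rle_trans with (1 := Cmod_triangle _ _); rewrite !Cmod_mult, !Cmod_inv by auto.
        assert (Q1 : / Cmod z * / Cmod z * Cmod h <= eps / 2).
        { apply Rmult_le_reg_l with (Cmod z ^ 2); [apply pow_lt; lra|].
          replace (Cmod z ^ 2 * (/ Cmod z * / Cmod z * Cmod h)) with (Cmod h) by (field; lra).
          apply Rle_trans with (1 := K).
          replace (eps / 2 * Cmod z ^ 3) with (Cmod z ^ 2 * (eps / 2) * Cmod z) by ring.
          rewrite <- (Rmult_1_r (Cmod z ^ 2 * (eps / 2))) at 2.
          apply Rmult_le_compat_l; [|lra]; apply Rmult_le_pos; [apply pow_le|]; lra. }
        nra.
      + match goal with |- norm ?X <= _ => change (Cmod X <= eps) end.
        match goal with |- Cmod ?X <= _ => replace X with (/ z * / z * / z * h)%C by (cfold; simpl; field; auto) end.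
        rewrite !Cmod_mult, !Cmod_inv by auto.
        apply Rmult_le_reg_l with (Cmod z ^ 3); [apply pow_lt; lra|].
        replace (Cmod z ^ 3 * (/ Cmod z * / Cmod z * / Cmod z * Cmod h)) with (Cmod h) by (field; lra).
        assert (0 < Cmod z ^ 3) by (apply pow_lt; lra); nra. }
  assert (Hnorm : norm ((RtoC (2 * PI)) *: (e : CV))
     <= scal (/ r ^ n) (2 * PI * (Cmod a0 ^ 2 + Cmod a1 ^ 2 * r ^ 2 + Cmod a2 ^ 2 * r ^ 4))).
  { apply (norm_RInt_le (V := real_NormedModule C_NormedModule)
      (fun t => ((/ circle r t) ^ n * g (circle r t))%C) (fun t => scal (/ r ^ n) (Cmod (quad a0 a1 a2 (circle r t)) ^ 2)) 0 (2 * PI)).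
    - lra.
    - intros t _.
      change (Cmod ((/ circle r t) ^ n * g (circle r t)) <= / r ^ n * Cmod (quad a0 a1 a2 (circle r t)) ^ 2).
      assert (Hc : Cmod (circle r t) = r) by (apply Cmod_circle; lra).
      assert (Hc0 : circle r t <> RtoC 0) by (apply Cmod_gt_0; lra).
      rewrite Cmod_mult, Cmod_pow, Cmod_inv, Hc, pow_inv by auto.
      apply Rmult_le_compat_l; [left; now apply Rinv_0_lt_compat|]; apply Hb; lra.
    - exact I.
    - apply (is_RInt_scal (V := R_NormedModule)); apply int_quad_sqr. }
  rewrite (scal_div_pos (V := CV)) in Hnorm by lra.
  change (2 * PI * Cmod e <= / r ^ n * (2 * PI * (Cmod a0 ^ 2 + Cmod a1 ^ 2 * r ^ 2 + Cmod a2 ^ 2 * r ^ 4))) in Hnorm.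
  apply Rmult_le_reg_l with (2 * PI); [lra|].
  apply Rle_trans with (2 * PI * (Cmod a0 ^ 2 + Cmod a1 ^ 2 * r ^ 2 + Cmod a2 ^ 2 * r ^ 4)).
  - apply Rmult_le_compat_l with (r := r ^ n) in Hnorm; [|lra].
    replace (r ^ n * (/ r ^ n * (2 * PI * (Cmod a0 ^ 2 + Cmod a1 ^ 2 * r ^ 2 + Cmod a2 ^ 2 * r ^ 4))))
      with (2 * PI * (Cmod a0 ^ 2 + Cmod a1 ^ 2 * r ^ 2 + Cmod a2 ^ 2 * r ^ 4)) in Hnorm by (field; lra).
    lra.
  - apply Rmult_le_compat_l; [lra|]; unfold S.
    pose proof (pow2_ge_0 (Cmod a1)); pose proof (pow2_ge_0 (Cmod a2)).
    assert (r ^ 2 <= 1 ^ 2) by (apply pow_incr; lra); assert (r ^ 4 <= 1 ^ 4) by (apply pow_incr; lra).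
    rewrite !pow1 in *; nra. }
apply le_epsilon; intros eta Heta.
pose proof (Cmod_ge_0 e) as He0.
(* This makes [3 k |e| <= eta], which is enough because [(1 - k)^n >= 1 - 3 k] by Bernoulli's
   inequality. *)
set (k := eta / (3 * (Cmod e + eta + 1))).
assert (Hk0 : 0 < k) by (apply Rdiv_lt_0_compat; lra).
assert (Hk1 : k * (3 * (Cmod e + eta + 1)) = eta) by (unfold k; field; lra).
assert (Hk2 : k < 1 / 3) by nra.
specialize (Hr (1 - k) ltac:(lra)).
assert (Hpow : 1 - 3 * k <= (1 - k) ^ n) by (destruct Hn as [-> | ->]; simpl; nra).
nra.
Qed.

Definition smallC (n : nat) (f : C -> C) : Prop := small (V := CV) n f.

Definition bounded_near0 (h : C -> C) : Prop :=
  exists d K, 0 < d /\ 0 <= K /\ forall z, Cmod z < d -> Cmod (h z) <= K.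

Lemma bounded_near0_const (c : C) : bounded_near0 (fun _ => c).
Proof. exists 1, (Cmod c); repeat split; [lra|apply Cmod_ge_0|intros; lra]. Qed.

Lemma bounded_near0_id : bounded_near0 (fun z => z).
Proof. exists 1, 1; repeat split; [lra|lra|intros; lra]. Qed.

Lemma bounded_near0_plus (f g : C -> C) :
  bounded_near0 f -> bounded_near0 g -> bounded_near0 (fun z => f z + g z)%C.
Proof.
intros [d1 [K1 [H1 [H2 H3]]]] [d2 [K2 [H4 [H5 H6]]]].
exists (Rmin d1 d2), (K1 + K2); repeat split; [now apply Rmin_glb_lt|lra|].
intros z Hz; apply Rle_trans with (1 := Cmod_triangle _ _); apply Rplus_le_compat.
- apply H3, Rlt_le_trans with (1 := Hz), Rmin_l.
- apply H6, Rlt_le_trans with (1 := Hz), Rmin_r.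
Qed.

Lemma bounded_near0_mult (f g : C -> C) :
  bounded_near0 f -> bounded_near0 g -> bounded_near0 (fun z => f z * g z)%C.
Proof.
intros [d1 [K1 [H1 [H2 H3]]]] [d2 [K2 [H4 [H5 H6]]]].
exists (Rmin d1 d2), (K1 * K2); repeat split; [now apply Rmin_glb_lt|nra|].
intros z Hz; rewrite Cmod_mult; apply Rmult_le_compat; try apply Cmod_ge_0.
- apply H3, Rlt_le_trans with (1 := Hz), Rmin_l.
- apply H6, Rlt_le_trans with (1 := Hz), Rmin_r.
Qed.

Lemma small_plus {V : NormedModule C_AbsRing} (n : nat) (f g : C -> V) :
  small n f -> small n g -> small n (fun z => plus (f z) (g z)).
Proof.
intros Hf Hg eps He.
destruct (Hf (eps / 2) ltac:(lra)) as [d1 [H1 K1]]; destruct (Hg (eps / 2) ltac:(lra)) as [d2 [H2 K2]].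
exists (Rmin d1 d2); split; [now apply Rmin_glb_lt|]; intros z Hz.
apply Rle_trans with (1 := norm_triangle _ _).
assert (A := K1 z (Rlt_le_trans _ _ _ Hz (Rmin_l _ _))); assert (B := K2 z (Rlt_le_trans _ _ _ Hz (Rmin_r _ _))).
lra.
Qed.

Lemma smallC_plus (n : nat) (f g : C -> C) : smallC n f -> smallC n g -> smallC n (fun z => f z + g z)%C.
Proof. exact (small_plus (V := CV) n f g). Qed.

Lemma small_ext {V : NormedModule C_AbsRing} (n : nat) (f g : C -> V) (r : R) : 0 < r ->
  (forall z, Cmod z < r -> f z = g z) -> small n f -> small n g.
Proof.
intros Hr E Hf eps He; destruct (Hf eps He) as [d [Hd K]].
exists (Rmin d r); split; [now apply Rmin_glb_lt|]; intros z Hz.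
rewrite <- E by (apply Rlt_le_trans with (1 := Hz), Rmin_r).
apply K, Rlt_le_trans with (1 := Hz), Rmin_l.
Qed.

Lemma small_bounded {V W : NormedModule C_AbsRing} (n : nat) (f : C -> V) (g : C -> W) (d K : R) : 0 < d -> 0 <= K ->
  (forall z, Cmod z < d -> norm (g z) <= K * norm (f z)) -> small n f -> small n g.
Proof.
intros Hd HK H Hf eps He.
assert (He' : 0 < eps / (K + 1)) by (apply Rdiv_lt_0_compat; lra).
destruct (Hf _ He') as [d' [Hd' K']].
exists (Rmin d d'); split; [now apply Rmin_glb_lt|]; intros z Hz.
apply Rle_trans with (1 := H z (Rlt_le_trans _ _ _ Hz (Rmin_l _ _))).
assert (Q := K' z (Rlt_le_trans _ _ _ Hz (Rmin_r _ _))).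
assert (Hz0 : 0 <= Cmod z ^ n) by (apply pow_le, Cmod_ge_0).
apply Rle_trans with (K * (eps / (K + 1) * Cmod z ^ n)); [now apply Rmult_le_compat_l|].
apply Rle_trans with ((K + 1) * (eps / (K + 1) * Cmod z ^ n)).
- apply Rmult_le_compat_r; [|lra]; apply Rmult_le_pos; lra.
- right; field; lra.
Qed.

Lemma smallC_mult (n : nat) (f h : C -> C) : smallC n f -> bounded_near0 h -> smallC n (fun z => f z * h z)%C.
Proof.
intros Hf [d [K [Hd [HK Hh]]]].
apply (small_bounded n f _ d K Hd HK); [|exact Hf].
intros z Hz; change (Cmod (f z * h z) <= K * Cmod (f z)).
rewrite Cmod_mult, Rmult_comm; apply Rmult_le_compat_r; [apply Cmod_ge_0|auto].
Qed.

Lemma smallC_z4 : smallC 3 (fun z => z * z * z * z)%C.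
Proof.
intros eps He; exists eps; split; [exact He|]; intros z Hz.
change (Cmod (z * z * z * z) <= eps * Cmod z ^ 3); rewrite !Cmod_mult.
pose proof (Cmod_ge_0 z); assert (0 <= Cmod z ^ 3) by (apply pow_le; lra).
replace (Cmod z * Cmod z * Cmod z * Cmod z) with (Cmod z * Cmod z ^ 3) by ring.
apply Rmult_le_compat_r; lra.
Qed.

Ltac bnd := repeat first [apply bounded_near0_plus | apply bounded_near0_mult | apply bounded_near0_const | apply bounded_near0_id].

Lemma unit_phase (w : C) : exists v, Cmod v = 1 /\ w = (RtoC (Cmod w) * v)%C.
Proof.
destruct (Ceq_dec w (RtoC 0)) as [->|H].
- exists (RtoC 1); split; [apply Cmod_1|]; rewrite Cmod_0; ring.
- assert (H0 : 0 < Cmod w) by now apply Cmod_gt_0.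
  assert (H1 : RtoC (Cmod w) <> RtoC 0) by (intros E; apply RtoC_inj in E; lra).
  exists (w / RtoC (Cmod w))%C; split; [|field; auto].
  rewrite Cmod_div, Cmod_R, Rabs_pos_eq by (auto; lra); field; lra.
Qed.

Lemma Cmod_conj_sqr (z : C) : (z * Cconj z)%C = RtoC (Cmod z ^ 2).
Proof. symmetry; apply Cmod2_conj. Qed.

Lemma le_Cmod_phase (v : C) (E : R) : Cmod v = 1 -> E <= Cmod (v * RtoC E).
Proof. intros Hv; rewrite Cmod_mult, Hv, Cmod_R, Rmult_1_l; apply Rle_abs. Qed.

(** * Coefficient inequalities from test polynomials *)

Section Schur.

Context (om : C -> C) (w1 w2 w3 : C)
  (Hd : forall z, 0 < Cmod z < 1 -> exists l, cderC om z l)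
  (Hb : forall z, 0 < Cmod z < 1 -> Cmod (om z) <= 1)
  (Hs : smallC 3 (fun z => om z - (w1 * z + w2 * z * z + w3 * z * z * z))%C).

(** The two expressions are the coefficients of [z^2] and [z^3] in [om * a^2], where [a] is the
    quadratic; as [|om| <= 1], this product is dominated by [|a|^2]. *)
Lemma schur_quad (n : nat) (a0 a1 a2 : C) : (n = 2%nat \/ n = 3%nat) ->
  Cmod (if Nat.eqb n 2 then w2 * a0 * a0 + RtoC 2 * w1 * a0 * a1
        else w3 * a0 * a0 + RtoC 2 * w2 * a0 * a1 + w1 * (a1 * a1 + RtoC 2 * a0 * a2))%C
  <= Cmod a0 ^ 2 + Cmod a1 ^ 2 + Cmod a2 ^ 2.
Proof.
intros Hn.
apply (coefficient_bound (fun z => om z * (quad a0 a1 a2 z * quad a0 a1 a2 z))%C n (w1 * a0 * a0)%C); auto.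
- intros z Hz; destruct (Hd z Hz) as [l Hl].
  assert (Hq : exists m, cderC (quad a0 a1 a2) z m).
  { eexists; unfold quad.
    apply (cder_plus (V := CV)); [apply (cder_plus (V := CV))|].
    - apply (cder_const (V := CV)).
    - apply (cder_scal (V := CV) (fun _ => a1) (fun z => z)); [apply (cder_const (V := CV))|apply cder_id].
    - apply (cder_scal (V := CV) (fun z => a2 * z)%C (fun z => z)); [|apply cder_id].
      apply (cder_scal (V := CV) (fun _ => a2) (fun z => z)); [apply (cder_const (V := CV))|apply cder_id]. }
  destruct Hq as [m Hm].
  eexists; exact (cder_scal (V := CV) om (fun z => quad a0 a1 a2 z * quad a0 a1 a2 z)%C z _ _ Hl
    (cder_scal (V := CV) (quad a0 a1 a2) (quad a0 a1 a2) z _ _ Hm Hm)).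
- intros z Hz; rewrite !Cmod_mult; specialize (Hb z Hz).
  pose proof (Cmod_ge_0 (quad a0 a1 a2 z)); pose proof (Cmod_ge_0 (om z)).
  replace (Cmod (quad a0 a1 a2 z) ^ 2) with (1 * (Cmod (quad a0 a1 a2 z) * Cmod (quad a0 a1 a2 z))) by ring.
  apply Rmult_le_compat_r; nra.
- assert (S1 := smallC_mult 3 _ (fun z => quad a0 a1 a2 z * quad a0 a1 a2 z)%C Hs ltac:(unfold quad; bnd)).
  (* The terms of degree at least 4 of the cubic times [a^2], collected behind a factor [z^4]. *)
  assert (S2 := smallC_mult 3 _ (fun z => (w1 * (RtoC 2 * a1 * a2 + a2 * a2 * z) + w2 * (a1 * a1 + RtoC 2 * a0 * a2 + RtoC 2 * a1 * a2 * z + a2 * a2 * z * z)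
     + w3 * (RtoC 2 * a0 * a1 + (a1 * a1 + RtoC 2 * a0 * a2) * z + RtoC 2 * a1 * a2 * z * z + a2 * a2 * z * z * z)))%C smallC_z4 ltac:(bnd)).
  refine (small_ext 3 _ _ 1 Rlt_0_1 _ (small_plus 3 _ _ S1 S2)).
  intros z _; cfold; unfold quad; ring.
Qed.

(** The test polynomial is [z], which shifts [w1] to the coefficient of [z^3]. *)
Lemma schur_w1 : Cmod w1 <= 1.
Proof.
assert (Q := schur_quad 3 (RtoC 0) (RtoC 1) (RtoC 0) (or_intror eq_refl)); simpl Nat.eqb in Q; cbv iota in Q.
rewrite Cmod_0, Cmod_1 in Q.
match type of Q with Cmod ?X <= _ => replace X with w1 in Q by ring end.
lra.
Qed.

(** The test polynomial is [1 + v conj(w1) z], with [v] the phase of [w2]: the two terms align and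
    [|w2| + 2 |w1|^2 <= 1 + |w1|^2]. *)
Lemma schur_w2 : Cmod w2 <= 1 - Cmod w1 ^ 2.
Proof.
destruct (unit_phase w2) as [v [Hv E]].
assert (Q := schur_quad 2 (RtoC 1) (v * Cconj w1)%C (RtoC 0) (or_introl eq_refl)); simpl Nat.eqb in Q; cbv iota in Q.
match type of Q with Cmod ?X <= _ => replace X with (v * RtoC (Cmod w2 + 2 * Cmod w1 ^ 2))%C in Q end.
2:{ rewrite RtoC_plus, RtoC_mult, <- Cmod_conj_sqr; rewrite E at 2; ring. }
rewrite Cmod_0, Cmod_1, (Cmod_mult v (Cconj w1)), Hv, Cmod_conj in Q.
assert (Q2 := le_Cmod_phase v (Cmod w2 + 2 * Cmod w1 ^ 2) Hv); lra.
Qed.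

(** The same with [1 + v conj(w1) z^2]. It serves the case [|w1| = 1], which [schur_w3] excludes. *)
Lemma schur_w3_weak : Cmod w3 <= 1 - Cmod w1 ^ 2.
Proof.
destruct (unit_phase w3) as [v [Hv E]].
assert (Q := schur_quad 3 (RtoC 1) (RtoC 0) (v * Cconj w1)%C (or_intror eq_refl)); simpl Nat.eqb in Q; cbv iota in Q.
match type of Q with Cmod ?X <= _ => replace X with (v * RtoC (Cmod w3 + 2 * Cmod w1 ^ 2))%C in Q end.
2:{ rewrite RtoC_plus, RtoC_mult, <- Cmod_conj_sqr; rewrite E at 2; ring. }
rewrite Cmod_0, Cmod_1, (Cmod_mult v (Cconj w1)), Hv, Cmod_conj in Q.
assert (Q2 := le_Cmod_phase v (Cmod w3 + 2 * Cmod w1 ^ 2) Hv); lra.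
Qed.

(* The test polynomial has coefficients [D], [v conj w2 + conj w1 w2], [D v conj w1] with
   [D = 1 - |w1|^2] and [v] the phase of the left-hand side. *)
Lemma schur_w3 : Cmod w1 < 1 ->
  Cmod (w3 * RtoC (1 - Cmod w1 ^ 2) + Cconj w1 * w2 * w2) <= (1 - Cmod w1 ^ 2) ^ 2 - Cmod w2 ^ 2.
Proof.
intros Hw; set (D := 1 - Cmod w1 ^ 2).
pose proof (Cmod_ge_0 w1) as Hw0.
assert (HD : 0 < D) by (unfold D; nra).
destruct (unit_phase (w3 * RtoC D + Cconj w1 * w2 * w2)%C) as [v [Hv E]].
set (K := Cmod (w3 * RtoC D + Cconj w1 * w2 * w2)%C) in *.
(* [X] is the phase-dependent cross term; it occurs once on each side of the test inequality and
   cancels, leaving [D K <= D (D^2 - |w2|^2)]. *)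
set (X := 2 * Re (v * w1 * Cconj w2 * Cconj w2)).
set (al := (v * Cconj w2 + Cconj w1 * w2)%C).
assert (Q := schur_quad 3 (RtoC D) al (RtoC D * v * Cconj w1)%C (or_intror eq_refl)); simpl Nat.eqb in Q; cbv iota in Q.
assert (Ev : (v * Cconj v)%C = RtoC 1) by (rewrite Cmod_conj_sqr, Hv; f_equal; ring).
assert (EX : RtoC X = (v * w1 * Cconj w2 * Cconj w2 + Cconj v * Cconj w1 * w2 * w2)%C).
{ assert (Hre : forall y : C, RtoC (2 * Re y) = (y + Cconj y)%C).
  { intros [a b]; unfold RtoC, Cconj, Cplus, Re; simpl; f_equal; ring. }
  unfold X; rewrite Hre; rewrite !Cmult_conj, !Cconj_conj; ring. }
assert (ED : RtoC D = (RtoC 1 - w1 * Cconj w1)%C) by (unfold D; rewrite RtoC_minus, Cmod_conj_sqr; reflexivity).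
assert (E2 : (v * v * Cconj v * Cconj v)%C = RtoC 1) by (replace (v * v * Cconj v * Cconj v)%C with ((v * Cconj v) * (v * Cconj v))%C by ring; rewrite Ev; ring).
match type of Q with Cmod ?Y <= _ => replace Y with
  (v * RtoC (D * K + 2 * Cmod w2 ^ 2 + 2 * D ^ 2 * Cmod w1 ^ 2 + X))%C in Q end.
2:{ rewrite !RtoC_plus, !RtoC_mult, EX, !RtoC_pow, <- (RtoC_pow (Cmod w2)), <- (RtoC_pow (Cmod w1)), <- !Cmod_conj_sqr.
    transitivity (RtoC D * (RtoC K * v) + RtoC 2 * v * (w2 * Cconj w2) + RtoC 2 * v * (RtoC D * RtoC D) * (w1 * Cconj w1)
       + v * v * w1 * Cconj w2 * Cconj w2 + (v * Cconj v) * Cconj w1 * w2 * w2)%C; [simpl; ring|].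
    rewrite <- E, Ev; unfold al; rewrite ED; ring. }
assert (EA : Cmod al ^ 2 = (1 + Cmod w1 ^ 2) * Cmod w2 ^ 2 + X).
{ apply RtoC_inj; rewrite <- Cmod_conj_sqr, RtoC_plus, RtoC_mult, RtoC_plus, <- !Cmod_conj_sqr, EX.
  unfold al; rewrite Cplus_conj, !Cmult_conj, !Cconj_conj.
  transitivity ((v * Cconj v) * (w2 * Cconj w2) + (w1 * Cconj w1) * (w2 * Cconj w2) + v * w1 * Cconj w2 * Cconj w2 + Cconj v * Cconj w1 * w2 * w2)%C; [ring|].
  rewrite Ev; ring. }
rewrite EA in Q; rewrite !Cmod_mult, Cmod_conj, Hv, !Cmod_R, (Rabs_pos_eq D), Rmult_1_r in Q by lra.
assert (Q2 := Rle_abs (D * K + 2 * Cmod w2 ^ 2 + 2 * D ^ 2 * Cmod w1 ^ 2 + X)).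
apply Rmult_le_reg_l with D; [exact HD|].
assert (ED' : Cmod w1 ^ 2 = 1 - D) by (unfold D; ring).
rewrite Rmult_1_l in Q; rewrite Rpow_mult_distr, !ED' in Q; rewrite ED' in Q2.
nra.
Qed.

End Schur.

(** * The optimisation problem *)

Section Optimisation.

Context (m : R) (Hm : 2 <= m <= 3).

Let mu := 2 + m / 2.
Let n := (m - 2) * (m + 1) / 2.
Let P := mu + 1.
Let N := P - n.

(** The critical point of the cubic [P t - N t^3], to which the two-variable problem reduces on the
    edge [x = 1]. *)
Definition extremal_t : R := sqrt (P / (3 * N)).

Lemma opt_params : 0 <= n <= 2 /\ 3 <= mu <= 7 / 2 /\ n = (mu - 3) * (2 * mu - 3) /\ 5 / 2 <= N <= 4.
Proof.
unfold N, P, n, mu; repeat split; try nra.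
Qed.

Lemma extremal_t_sqr : 0 < extremal_t /\ P = 3 * N * extremal_t ^ 2.
Proof.
destruct opt_params as [H1 [H2 [H3 H4]]].
assert (H : 0 < P / (3 * N)) by (apply Rdiv_lt_0_compat; unfold P; lra).
unfold extremal_t; split; [now apply sqrt_lt_R0|].
rewrite pow2_sqrt by lra; field; lra.
Qed.

(** With [s = extremal_t] and [P = 3 N s^2], the gap is [N (t - s)^2 (t + 2 s)]. *)
Lemma cubic_max (t : R) : 0 <= t -> P * t - N * t ^ 3 <= 2 / 3 * P * extremal_t.
Proof.
intros Ht; destruct opt_params as [_ [_ [_ HN]]]; destruct extremal_t_sqr as [H0 HP].
rewrite HP; set (s := extremal_t) in *.
assert (0 <= N * ((t - s) ^ 2 * (t + 2 * s))).
{ apply Rmult_le_pos; [lra|]; apply Rmult_le_pos; [apply pow2_ge_0|lra]. }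
nra.
Qed.

(** Here [t] stands for [|w1|] and [x] for [|w2| / (1 - t^2)]. If [2 (1 - t) <= mu t], the quadratic
    in [x] increases on [[0, 1]], so [x = 1] is the worst case and [cubic_max] applies. Otherwise
    [t <= 4/10], and a crude numerical bound suffices. *)
Lemma two_variable_max (t x : R) : 0 <= t <= 1 -> 0 <= x <= 1 ->
  (1 - t ^ 2) * (1 - (1 - t) * x ^ 2 + mu * t * x) + n * t ^ 3 <= 2 / 3 * P * extremal_t.
Proof.
intros Ht Hx; destruct opt_params as [Hn [Hmu [En HN]]].
destruct (Rle_dec (2 * (1 - t)) (mu * t)) as [H|H].
- apply Rle_trans with (2 := cubic_max t (proj1 Ht)).
  assert (H1 : 1 - (1 - t) * x ^ 2 + mu * t * x <= P * t).
  { assert (0 <= (1 - x) * (mu * t - (1 - t) * (1 + x))) by (apply Rmult_le_pos; nra).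
    unfold P; nra. }
  assert (H2 : 0 <= 1 - t ^ 2) by nra.
  apply Rle_trans with ((1 - t ^ 2) * (P * t) + n * t ^ 3).
  + apply Rplus_le_compat_r, Rmult_le_compat_l; assumption.
  + unfold N; right; ring.
(* [58 / 100] is close to [1 / sqrt 3], the critical point for [m = 2], where the right-hand side is
   smallest. *)
- assert (Hb : 153 / 100 <= 2 / 3 * P * extremal_t).
  { apply Rle_trans with (2 := cubic_max (58 / 100) ltac:(lra)); unfold N, P; nra. }
  apply Rle_trans with (2 := Hb).
  apply Rnot_le_lt in H.
  assert (Ht4 : t <= 4 / 10) by nra.
  set (s := mu * t) in *.
  assert (Hs0 : 3 * t <= s <= 7 / 2 * t) by (unfold s; split; nra).
  (* The maximum of the quadratic over all real [x], found by completing the square. *)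
  assert (Hv : (1 - t ^ 2) * (1 - (1 - t) * x ^ 2 + s * x) <= 1 - t ^ 2 + (1 + t) * (s * s / 4)).
  { replace (1 - t ^ 2) with ((1 + t) * (1 - t)) by ring.
    assert (0 <= (1 + t) * (((1 - t) * x - s / 2) ^ 2)) by (apply Rmult_le_pos; [lra|apply pow2_ge_0]).
    nra. }
  assert (En' : n * t ^ 3 = t * ((s - 3 * t) * (2 * s - 3 * t))) by (rewrite En; unfold s; ring).
  rewrite En'; apply Rle_trans with (1 - t ^ 2 + (1 + t) * (s * s / 4) + t * ((s - 3 * t) * (2 * s - 3 * t))); [lra|].
  clear Hv En' En.
  (* [4 / 11] is where the two upper bounds [7 / 2 * t] and [2 * (1 - t)] for [s] coincide; each is
     used on the side where it is the smaller one. *)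
  destruct (Rle_dec t (4 / 11)) as [Hc|Hc].
  + assert (Q1 : s * s <= (7 / 2 * t) * (7 / 2 * t)) by nra.
    assert (Q2 : (s - 3 * t) * (2 * s - 3 * t) <= (t / 2) * (4 * t)) by (apply Rmult_le_compat; lra).
    apply Rle_trans with (1 - t ^ 2 + (1 + t) * (7 / 2 * t * (7 / 2 * t) / 4) + t * (t / 2 * (4 * t))).
    * apply Rplus_le_compat; [apply Rplus_le_compat_l, Rmult_le_compat_l; lra|apply Rmult_le_compat_l; lra].
    * assert (t ^ 2 <= 16 / 121) by nra; assert (t ^ 3 <= 64 / 1331) by nra; nra.
  + assert (Hs1 : s <= 2 * (1 - t)) by lra.
    assert (Q1 : s * s <= (2 * (1 - t)) * (2 * (1 - t))) by nra.
    assert (Q2 : (s - 3 * t) * (2 * s - 3 * t) <= (2 - 5 * t) * (4 - 7 * t)) by (apply Rmult_le_compat; lra).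
    apply Rle_trans with (1 - t ^ 2 + (1 + t) * (2 * (1 - t) * (2 * (1 - t)) / 4) + t * ((2 - 5 * t) * (4 - 7 * t))).
    * apply Rplus_le_compat; [apply Rplus_le_compat_l, Rmult_le_compat_l; lra|apply Rmult_le_compat_l; lra].
    * assert (4 / 11 < t) by lra.
      assert (A1 : (2 - 5 * t) * (4 - 7 * t) <= (2 / 11) * (16 / 11)) by (apply Rmult_le_compat; lra).
      assert (A2 : t * ((2 - 5 * t) * (4 - 7 * t)) <= 4 / 10 * (2 / 11 * (16 / 11))) by (apply Rmult_le_compat; nra).
      assert (A3 : (1 - t) * (1 - t) <= 49 / 121) by nra.
      nra.
Qed.

(** After multiplication by [D = 1 - |w1|^2], the last hypothesis controls [w3 D] at the cost of the
    term [conj(w1) w2^2]; the triangle inequality with [|w2| = D x] leads to [two_variable_max].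
    When [|w1| = 1], the other two coefficients vanish. *)
Lemma schur_functional_bound (w1 w2 w3 : C) :
  Cmod w1 <= 1 -> Cmod w2 <= 1 - Cmod w1 ^ 2 -> Cmod w3 <= 1 - Cmod w1 ^ 2 ->
  (Cmod w1 < 1 -> Cmod (w3 * RtoC (1 - Cmod w1 ^ 2) + Cconj w1 * w2 * w2) <= (1 - Cmod w1 ^ 2) ^ 2 - Cmod w2 ^ 2) ->
  Cmod (w3 + RtoC mu * w1 * w2 - RtoC n * w1 * w1 * w1) <= 2 / 3 * P * extremal_t.
Proof.
intros H1 H2 H3 H4; destruct opt_params as [Hn [Hmu [En HN]]].
pose proof (Cmod_ge_0 w1) as G1; pose proof (Cmod_ge_0 w2) as G2; pose proof (Cmod_ge_0 w3) as G3.
set (t := Cmod w1) in *; set (y := Cmod w2) in *.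
assert (Hcub : Cmod (RtoC n * w1 * w1 * w1) = n * t ^ 3).
{ rewrite !Cmod_mult, Cmod_R, Rabs_pos_eq by lra; fold t; ring. }
assert (Hmid : Cmod (RtoC mu * w1 * w2) = mu * t * y).
{ rewrite !Cmod_mult, Cmod_R, Rabs_pos_eq by lra; reflexivity. }
destruct (Rle_lt_or_eq_dec t 1 H1) as [Ht|Ht].
- specialize (H4 Ht); set (D := 1 - t ^ 2) in *.
  assert (HD : 0 < D) by (unfold D; nra).
  assert (Hx : 0 <= y / D <= 1).
  { split; [apply Rmult_le_pos; [lra|left; now apply Rinv_0_lt_compat]|].
    apply Rmult_le_reg_r with D; [exact HD|]; unfold Rdiv; rewrite Rmult_assoc, Rinv_l by lra; lra. }
  assert (Q := two_variable_max t (y / D) (conj G1 H1) Hx); fold D in Q.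
  apply Rle_trans with (2 := Q).
  apply Rmult_le_reg_l with D; [exact HD|].
  rewrite <- (Rabs_pos_eq D) at 1 by lra; rewrite <- Cmod_R, <- Cmod_mult.
  replace (RtoC D * (w3 + RtoC mu * w1 * w2 - RtoC n * w1 * w1 * w1))%C
    with ((w3 * RtoC D + Cconj w1 * w2 * w2) + (- (Cconj w1 * w2 * w2)
      + (RtoC D * (RtoC mu * w1 * w2) + - (RtoC D * (RtoC n * w1 * w1 * w1)))))%C by ring.
  apply Rle_trans with (D ^ 2 - y ^ 2 + (t * y * y + (D * (mu * t * y) + D * (n * t ^ 3)))).
  + apply Rle_trans with (1 := Cmod_triangle _ _); apply Rplus_le_compat; [exact H4|].
    apply Rle_trans with (1 := Cmod_triangle _ _); apply Rplus_le_compat.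
    { rewrite Cmod_opp, !Cmod_mult, Cmod_conj; fold t y; lra. }
    apply Rle_trans with (1 := Cmod_triangle _ _); rewrite Cmod_opp.
    rewrite (Cmod_mult (RtoC D)), (Cmod_mult (RtoC D) (RtoC n * w1 * w1 * w1)), Hmid, Hcub, Cmod_R, Rabs_pos_eq; lra.
  + right; field; lra.
- assert (E2 : w2 = RtoC 0) by (apply Cmod_eq_0; fold y; rewrite Ht in H2; lra).
  assert (E3 : w3 = RtoC 0) by (apply Cmod_eq_0; rewrite Ht in H3; lra).
  rewrite E2, E3; replace (RtoC 0 + RtoC mu * w1 * RtoC 0 - RtoC n * w1 * w1 * w1)%C with (- (RtoC n * w1 * w1 * w1))%C by ring.
  rewrite Cmod_opp, Hcub; apply Rle_trans with (2 := cubic_max t G1); rewrite Ht; unfold N; lra.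
Qed.

End Optimisation.

(** With [m = 1 + 2 lambda] one has [P = (7 + 2 lambda) / 2] and [N = (9 - 4 lambda^2) / 2]; the
    exponent [3 / 2] is [P] times the square root in [extremal_t]. *)
Lemma J23_bound_eq (lambda : R) : 1 / 2 <= lambda <= 1 ->
  J23_bound lambda = (1 + 2 * lambda) / 12 *
    (2 / 3 * (2 + (1 + 2 * lambda) / 2 + 1) * extremal_t (1 + 2 * lambda)).
Proof.
intros Hl; unfold J23_bound, extremal_t.
replace (3 / 2) with (1 + / 2) by field.
rewrite Rpower_plus, Rpower_1, Rpower_sqrt by lra.
replace ((2 + (1 + 2 * lambda) / 2 + 1) / (3 * (2 + (1 + 2 * lambda) / 2 + 1 - (1 + 2 * lambda - 2) * (1 + 2 * lambda + 1) / 2)))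
  with ((7 + 2 * lambda) / (3 * (9 - 4 * lambda ^ 2))) by (field; nra).
assert (H9 : 0 < 3 * (9 - 4 * lambda ^ 2)) by nra.
rewrite sqrt_div_alt by exact H9.
assert (0 < sqrt (3 * (9 - 4 * lambda ^ 2))) by now apply sqrt_lt_R0.
field; lra.
Qed.

(** * The upper bound *)

(** Mean value inequality along the ray [s |-> f (s z)], whose velocity brings the extra factor
    [|z|]. *)
Lemma small_primitive {V : NormedModule C_AbsRing} (n : nat) (f f' : C -> V) :
  (forall z, Cmod z < 1 -> cder f z (f' z)) -> f (RtoC 0) = zero -> small n f' -> small (S n) f.
Proof.
intros Hf H0 Hs eps He; destruct (Hs eps He) as [d [Hd K]].
exists (Rmin d 1); split; [apply Rmin_glb_lt; lra|]; intros z Hz.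
assert (Hz1 : Cmod z < d) by (apply Rlt_le_trans with (1 := Hz), Rmin_l).
assert (Hz2 : Cmod z < 1) by (apply Rlt_le_trans with (1 := Hz), Rmin_r).
pose proof (Cmod_ge_0 z) as Hz0.
assert (Q := cder_mean_value (fun s => f (s * z)%C) (fun s => z *: (f' (s * z)%C)) (eps * Cmod z ^ S n)).
cbv beta in Q.
replace (RtoC 1 * z)%C with z in Q by ring; replace (RtoC 0 * z)%C with (RtoC 0) in Q by ring.
assert (Ez : f z = minus (f z) (f (RtoC 0))) by (rewrite H0; vring).
rewrite Ez; apply Q; intros s Hs'.
assert (Hsz : Cmod (RtoC s * z) <= Cmod z).
{ rewrite Cmod_mult, Cmod_R, Rabs_pos_eq by lra; nra. }
split.
- assert (Hmul : cderC (fun s => s * z)%C (RtoC s) z).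
  { apply (cder_eq _ _ _ _ (cder_scal (V := CV) (fun s => s) (fun _ => z) (RtoC s) _ _ (cder_id _) (cder_const (V := CV) z _))).
    cfold; ring. }
  exact (cder_comp f (fun s => s * z)%C (RtoC s) z _ (Hf (RtoC s * z)%C (Rle_lt_trans _ _ _ Hsz Hz2)) Hmul).
- rewrite norm_scalC; apply Rle_trans with (Cmod z * (eps * Cmod (RtoC s * z) ^ n)).
  + apply Rmult_le_compat_l; [lra|]; apply K; lra.
  + assert (Cmod (RtoC s * z) ^ n <= Cmod z ^ n) by (apply pow_incr; split; [apply Cmod_ge_0|exact Hsz]).
    replace (eps * Cmod z ^ S n) with (Cmod z * (eps * Cmod z ^ n)) by (simpl; ring).
    apply Rmult_le_compat_l; [lra|]; apply Rmult_le_compat_l; lra.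
Qed.

Lemma cder_small0 {V : NormedModule C_AbsRing} (f : C -> V) (l : V) :
  cder f (RtoC 0) l -> f (RtoC 0) = zero -> small 0 f.
Proof.
intros Hf H0 eps He; destruct (cder_continuous f _ l Hf eps He) as [d [Hd K]].
exists d; split; [exact Hd|]; intros z Hz; simpl; rewrite Rmult_1_r; left.
replace (f z) with (minus (f z) (f (RtoC 0))) by (rewrite H0; vring).
apply K; replace (z - RtoC 0)%C with z by ring; exact Hz.
Qed.

(** * Differentiability of inverse operators along a curve *)

Section Inverse.

Context {V : NormedModule C_AbsRing} (A : C -> Lin V V) (B : C -> Lin V V) (z : C) (r : R) (Hr : 0 < r)
  (HB : forall w, Cmod (w - z) < r -> is_inverse (A w) (B w)) (A' : Lin V V)
  (HA : cder (V := Lin_NormedModule V V) A z A').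

(** Near [z], [A w] differs from [A z] by less than [1 / (2 (beta + 1))] in norm, so in
    [u = B z (v - (A w - A z) u)] the contribution of [u] is at most half of [norm u] and is
    absorbed on the left. *)
Lemma inverse_bounded_near : exists d K, 0 < d /\ 0 <= K /\
  forall w, Cmod (w - z) < d -> forall v, norm (B w v) <= K * norm v.
Proof.
set (beta := Lin_norm (B z)); assert (Hbeta : 0 <= beta) by apply Lin_norm_ge_0.
destruct (cder_continuous A z A' HA (/ (2 * (beta + 1)))) as [d [Hd K]].
{ apply Rinv_0_lt_compat; lra. }
exists (Rmin d r), (2 * beta); repeat split; [now apply Rmin_glb_lt|lra|].
intros w Hw v.
assert (Hw1 := K w (Rlt_le_trans _ _ _ Hw (Rmin_l _ _))).
destruct (HB w (Rlt_le_trans _ _ _ Hw (Rmin_r _ _))) as [_ Hinv].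
assert (Hzz : Cmod (z - z) < r) by (replace (z - z)%C with (RtoC 0) by ring; rewrite Cmod_0; exact Hr).
destruct (HB z Hzz) as [Hinvz _].
set (u := B w v).
assert (Ev : A w u = v) by apply Hinv.
assert (E1 : u = B z (minus v (minus (A w u) (A z u)))).
{ rewrite Ev; replace (minus v (minus v (A z u))) with (A z u) by vring; symmetry; apply Hinvz. }
assert (E2 : norm (minus (A w u) (A z u)) <= / (2 * (beta + 1)) * norm u).
{ apply Rle_trans with (1 := Lin_norm_apply (Lin_plus (A w) (Lin_opp (A z))) u).
  apply Rmult_le_compat_r; [apply norm_ge_0|left; exact Hw1]. }
assert (E3 : norm u <= beta * (norm v + / (2 * (beta + 1)) * norm u)).
{ rewrite E1 at 1; apply Rle_trans with (1 := Lin_norm_apply _ _); apply Rmult_le_compat_l; [exact Hbeta|].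
  apply Rle_trans with (norm v + norm (minus (A w u) (A z u))); [|lra].
  rewrite <- (norm_opp (minus (A w u) (A z u))); apply norm_triangle. }
assert (E4 : beta * / (2 * (beta + 1)) <= / 2).
{ apply Rmult_le_reg_r with (2 * (beta + 1)); [lra|]; rewrite Rmult_assoc, Rinv_l by lra; lra. }
pose proof (norm_ge_0 u); nra.
Qed.

(** The rule for differentiating [A^-1 y]. Only the value at the moving vector is differentiated, so
    the local bound on [B w] is enough: the remainder is [B w] applied to the first-order error
    [rem]. *)
Lemma cder_inverse_apply (y : C -> V) (y' : V) : cder y z y' ->
  cder (fun w => B w (y w)) z (B z (minus y' (A' (B z (y z))))).
Proof.
intros Hy.
destruct inverse_bounded_near as [d0 [K [Hd0 [HK Hbd]]]].
set (u := B z (y z)); set (l := B z (minus y' (A' u))).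
assert (Hzz : Cmod (z - z) < r) by (replace (z - z)%C with (RtoC 0) by ring; rewrite Cmod_0; exact Hr).
destruct (HB z Hzz) as [_ Hinvz].
intros eps He.
pose proof (norm_ge_0 u) as Hu; pose proof (norm_ge_0 l) as Hl.
set (e := eps / ((K + 1) * (1 + norm u + norm l))).
assert (He' : 0 < e) by (apply Rdiv_lt_0_compat; [lra|apply Rmult_lt_0_compat; lra]).
assert (Ee : e * ((K + 1) * (1 + norm u + norm l)) = eps) by (unfold e; field; lra).
destruct (Hy e He') as [d1 [Hd1 K1]]; destruct (HA e He') as [d2 [Hd2 K2]].
destruct (cder_continuous A z A' HA e He') as [d3 [Hd3 K3]].
exists (Rmin (Rmin r d0) (Rmin d1 (Rmin d2 d3))); split; [repeat apply Rmin_glb_lt; auto|]; intros w Hw.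
assert (Hwr : Cmod (w - z) < r) by (eapply Rlt_le_trans; [exact Hw|eapply Rle_trans; [apply Rmin_l|apply Rmin_l]]).
assert (Hw0 : Cmod (w - z) < d0) by (eapply Rlt_le_trans; [exact Hw|eapply Rle_trans; [apply Rmin_l|apply Rmin_r]]).
assert (Hw1 : Cmod (w - z) < d1) by (eapply Rlt_le_trans; [exact Hw|eapply Rle_trans; [apply Rmin_r|apply Rmin_l]]).
assert (Hw2 : Cmod (w - z) < d2) by (eapply Rlt_le_trans; [exact Hw|eapply Rle_trans; [apply Rmin_r|eapply Rle_trans; [apply Rmin_r|apply Rmin_l]]]).
assert (Hw3 : Cmod (w - z) < d3) by (eapply Rlt_le_trans; [exact Hw|eapply Rle_trans; [apply Rmin_r|eapply Rle_trans; [apply Rmin_r|apply Rmin_r]]]).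
specialize (K1 w Hw1); specialize (K2 w Hw2); specialize (K3 w Hw3).
destruct (HB w Hwr) as [Hl' Hr'].
set (s := (w - z)%C) in *; pose proof (Cmod_ge_0 s) as Hs.
assert (K2' : norm (minus (minus (A w u) (A z u)) (s *: (A' u))) <= e * Cmod s * norm u).
{ apply Rle_trans with (1 := Lin_norm_apply (Lin_plus (Lin_plus (A w) (Lin_opp (A z))) (Lin_opp (Lin_scal s A'))) u).
  apply Rmult_le_compat_r; [lra|exact K2]. }
assert (K3' : norm (minus (A w l) (A z l)) <= e * norm l).
{ apply Rle_trans with (1 := Lin_norm_apply (Lin_plus (A w) (Lin_opp (A z))) l).
  apply Rmult_le_compat_r; [lra|left; exact K3]. }
assert (Eu : A z u = y z) by apply Hinvz.
assert (El : A z l = minus y' (A' u)) by apply Hinvz.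
pose (rem := plus (minus (minus (y w) (y z)) (s *: y'))
   (plus (opp (minus (minus (A w u) (A z u)) (s *: (A' u))))
     (opp (s *: (minus (A w l) (A z l)))))).
assert (E : minus (minus (B w (y w)) u) (s *: l) = B w rem).
{ rewrite <- (Hl' (minus (minus (B w (y w)) u) (s *: l))); f_equal.
  transitivity (minus (minus (A w (B w (y w))) (A w u)) (s *: (A w l))).
  { unfold minus; rewrite !(linear_plus _ (lin_prop (A w))), !(linear_opp _ _ (lin_prop (A w))), (linear_scal _ (lin_prop (A w))); reflexivity. }
  rewrite Hr'; unfold rem; rewrite Eu, El; vring. }
change (norm (minus (minus (B w (y w)) u) (s *: l)) <= eps * Cmod s).
rewrite E; apply Rle_trans with (1 := Hbd w Hw0 rem).
assert (Hrem : norm rem <= e * Cmod s * (1 + norm u + norm l)).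
{ unfold rem; apply Rle_trans with (1 := norm_triangle _ _).
  replace (e * Cmod s * (1 + norm u + norm l)) with (e * Cmod s + (e * Cmod s * norm u + Cmod s * (e * norm l))) by ring.
  apply Rplus_le_compat; [exact K1|].
  apply Rle_trans with (1 := norm_triangle _ _).
  apply Rplus_le_compat; (eapply Rle_trans; [right; apply norm_opp|]); [exact K2'|].
  eapply Rle_trans; [right; apply norm_scalC|apply Rmult_le_compat_l; assumption]. }
apply Rle_trans with ((K + 1) * (e * Cmod s * (1 + norm u + norm l))).
- apply Rle_trans with (K * (e * Cmod s * (1 + norm u + norm l))); [now apply Rmult_le_compat_l|].
  apply Rmult_le_compat_r; [|lra]; apply Rle_trans with (2 := Hrem); apply norm_ge_0.
- rewrite <- Ee; right; ring.
Qed.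

End Inverse.

(** * Coefficients of the Schwarz function *)

Section OmegaExpansion.

Context (m : R) (Hm : 2 <= m) (a2 a3 a4 : C) (p : C -> C).

Definition lin_N (z : C) : C := (RtoC 1 + RtoC 2 * a2 * z + RtoC 3 * a3 * z * z + RtoC 4 * a4 * z * z * z)%C.
Definition lin_P (z : C) : C := (RtoC 1 + RtoC 4 * a2 * z + RtoC 9 * a3 * z * z + RtoC 16 * a4 * z * z * z)%C.

(** The Möbius map sending [1] to [0] and the half-plane [Re p >= 1 - m / 2] into the closed unit
    disc; for [m = 1 + 2 lambda] this is the half-plane of the class condition. *)
Definition omega (z : C) : C := ((p z - RtoC 1) / (p z - RtoC 1 + RtoC m))%C.
(** With the next two, the solution degree by degree of [lin_P - lin_N = omega (lin_P - lin_N + m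
    lin_N)] modulo [z^4]. *)
Definition omega1 : C := (RtoC 2 * a2 / RtoC m)%C.
Definition omega2 : C := (RtoC 6 * a3 / RtoC m - (RtoC 1 + RtoC m) * omega1 * omega1)%C.
Definition omega3 : C := (RtoC 12 * a4 / RtoC m - (RtoC 2 + RtoC 3 * RtoC m / RtoC 2) * omega1 * omega2
  - (RtoC 1 + RtoC m / RtoC 2) * (RtoC 1 + RtoC m) * omega1 * omega1 * omega1)%C.

Lemma RtoC_neq_0 (x : R) : x <> 0 -> RtoC x <> RtoC 0.
Proof. intros H E; apply RtoC_inj in E; auto. Qed.

Lemma omega_a2 : a2 = (RtoC m * omega1 / RtoC 2)%C.
Proof. unfold omega1; field; repeat split; apply RtoC_neq_0; lra. Qed.

Lemma omega_a3 : a3 = (RtoC m * (omega2 + (RtoC 1 + RtoC m) * omega1 * omega1) / RtoC 6)%C.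
Proof. unfold omega2; field; repeat split; apply RtoC_neq_0; lra. Qed.

Lemma omega_a4 : a4 = (RtoC m * (omega3 + (RtoC 2 + RtoC 3 * RtoC m / RtoC 2) * omega1 * omega2
  + (RtoC 1 + RtoC m / RtoC 2) * (RtoC 1 + RtoC m) * omega1 * omega1 * omega1) / RtoC 12)%C.
Proof. unfold omega3; field; repeat split; apply RtoC_neq_0; lra. Qed.

Lemma J_omega : (a2 * a3 - a4)%C = (- (RtoC m / RtoC 12) *
  (omega3 + RtoC (2 + m / 2) * omega1 * omega2 - RtoC ((m - 2) * (m + 1) / 2) * omega1 * omega1 * omega1))%C.
Proof.
rewrite omega_a4; rewrite omega_a3 at 1; rewrite omega_a2 at 1.
unfold Rdiv; rewrite ?RtoC_plus, ?RtoC_mult, ?RtoC_minus, ?RtoC_plus, !RtoC_inv by lra.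
field; repeat split; apply RtoC_neq_0; lra.
Qed.

Lemma omega_expansion : smallC 3 (fun z => lin_N z * p z - lin_P z)%C ->
  smallC 3 (fun z => omega z - (omega1 * z + omega2 * z * z + omega3 * z * z * z))%C.
Proof.
intros Hs; set (s := fun z => (lin_N z * p z - lin_P z)%C) in *.
pose (W := fun z => (omega1 * z + omega2 * z * z + omega3 * z * z * z)%C).
(* This is [lin_N (p - 1 + m)] written as a polynomial plus the small term [s]. It is
   [m - 1/2 - 1/2 >= 1] in modulus near 0, which keeps both of its factors away from zero. *)
pose (den := fun z => (lin_P z - lin_N z + RtoC m * lin_N z + s z)%C).
pose (g := fun z => ((RtoC 2 + RtoC 2 * RtoC m) * a2 + (RtoC 6 + RtoC 3 * RtoC m) * a3 * z + (RtoC 12 + RtoC 4 * RtoC m) * a4 * z * z)%C).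
assert (Hm0 : RtoC m <> RtoC 0) by (apply RtoC_neq_0; lra).
assert (Hden : exists d, 0 < d /\ forall z, Cmod z < d -> 1 <= Cmod (den z)).
{ assert (Hg : bounded_near0 g) by (unfold g; bnd).
  destruct Hg as [d1 [K [Hd1 [HK Hg]]]].
  destruct (Hs (1 / 2) ltac:(lra)) as [d2 [Hd2 K2]].
  set (d3 := / (2 * (K + 1))).
  assert (Hd3 : 0 < d3) by (apply Rinv_0_lt_compat; lra).
  assert (Ed3 : d3 * (K + 1) = 1 / 2) by (unfold d3; field; lra).
  exists (Rmin (Rmin d1 1) (Rmin d2 d3)); split; [repeat apply Rmin_glb_lt; lra|]; intros z Hz.
  assert (Hz1 : Cmod z < d1) by (eapply Rlt_le_trans; [exact Hz|eapply Rle_trans; [apply Rmin_l|apply Rmin_l]]).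
  assert (Hz4 : Cmod z < 1) by (eapply Rlt_le_trans; [exact Hz|eapply Rle_trans; [apply Rmin_l|apply Rmin_r]]).
  assert (Hz2 : Cmod z < d2) by (eapply Rlt_le_trans; [exact Hz|eapply Rle_trans; [apply Rmin_r|apply Rmin_l]]).
  assert (Hz3 : Cmod z < d3) by (eapply Rlt_le_trans; [exact Hz|eapply Rle_trans; [apply Rmin_r|apply Rmin_r]]).
  specialize (Hg z Hz1); specialize (K2 z Hz2); change (Cmod (s z) <= 1 / 2 * Cmod z ^ 3) in K2.
  pose proof (Cmod_ge_0 z) as Hz0.
  assert (H3 : Cmod z ^ 3 <= 1) by (rewrite <- (pow1 3); apply pow_incr; lra).
  assert (E : RtoC m = (den z + (- (g z * z) + - s z))%C) by (unfold den, g, lin_P, lin_N; ring).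
  assert (T1 : Cmod (RtoC m) <= Cmod (den z) + (Cmod (g z) * Cmod z + Cmod (s z))).
  { rewrite E; apply Rle_trans with (1 := Cmod_triangle _ _); apply Rplus_le_compat_l.
    apply Rle_trans with (1 := Cmod_triangle _ _); rewrite !Cmod_opp, Cmod_mult; lra. }
  rewrite Cmod_R, Rabs_pos_eq in T1 by lra.
  assert (Cmod (g z) * Cmod z <= 1 / 2) by (pose proof (Cmod_ge_0 (g z)); nra).
  lra. }
destruct Hden as [d [Hd Hden]].
(* This is [lin_N (p - 1) - W den]: by the choice of the three coefficients, all powers below [z^4]
   cancel, up to multiples of [s]. *)
pose (num := fun z => (s z * (RtoC 1 + - RtoC 1 * W z) + (z * z * z * z) *
  (- (RtoC 1) * (omega1 * (RtoC 12 + RtoC 4 * RtoC m) * a4 + omega2 * (RtoC 6 + RtoC 3 * RtoC m) * a3 + omega3 * (RtoC 2 + RtoC 2 * RtoC m) * a2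
   + (omega2 * (RtoC 12 + RtoC 4 * RtoC m) * a4 + omega3 * (RtoC 6 + RtoC 3 * RtoC m) * a3) * z + omega3 * (RtoC 12 + RtoC 4 * RtoC m) * a4 * z * z)))%C).
assert (Hnum : smallC 3 num).
{ unfold num; apply smallC_plus; [apply smallC_mult; [exact Hs|unfold W; bnd]|apply smallC_mult; [apply smallC_z4|bnd]]. }
apply (small_bounded (V := CV) (W := CV) 3 num _ d 1 Hd Rle_0_1); [|exact Hnum].
intros z Hz; specialize (Hden z Hz).
assert (Hden0 : den z <> RtoC 0) by (apply Cmod_gt_0; lra).
assert (Eden : den z = (lin_N z * (p z - RtoC 1 + RtoC m))%C) by (unfold den, s; ring).
assert (HN0 : lin_N z <> RtoC 0) by (intros E; apply Hden0; rewrite Eden, E; ring).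
assert (Hq0 : (p z - RtoC 1 + RtoC m)%C <> RtoC 0) by (intros E; apply Hden0; rewrite Eden, E; ring).
assert (Enum : num z = (lin_N z * (p z - RtoC 1) - W z * den z)%C).
{ unfold num, den; replace (lin_N z * (p z - RtoC 1))%C with (s z + (lin_P z - lin_N z))%C by (unfold s; ring).
  assert (E1 : (RtoC 2 * a2 = RtoC m * omega1)%C) by (unfold omega1; field; auto).
  assert (E2 : (RtoC 6 * a3 = RtoC m * omega2 + (RtoC 2 + RtoC 2 * RtoC m) * a2 * omega1)%C) by (unfold omega2, omega1; field; auto).
  assert (E3 : (RtoC 12 * a4 = RtoC m * omega3 + (RtoC 2 + RtoC 2 * RtoC m) * a2 * omega2 + (RtoC 6 + RtoC 3 * RtoC m) * a3 * omega1)%C).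
  { rewrite omega_a4; rewrite omega_a3 at 1; rewrite omega_a2 at 1.
    field; repeat split; apply RtoC_neq_0; lra. }
  match goal with |- ?X = ?Y => assert (E : (X - Y)%C = (z * (RtoC m * omega1 - RtoC 2 * a2)
     + z * z * (RtoC m * omega2 + (RtoC 2 + RtoC 2 * RtoC m) * a2 * omega1 - RtoC 6 * a3)
     + z * z * z * (RtoC m * omega3 + (RtoC 2 + RtoC 2 * RtoC m) * a2 * omega2 + (RtoC 6 + RtoC 3 * RtoC m) * a3 * omega1 - RtoC 12 * a4))%C);
    [|replace X with (X - Y + Y)%C by ring; rewrite E, <- E1, <- E2, <- E3; ring] end.
  unfold lin_P, lin_N, W; ring. }
replace (omega z - (omega1 * z + omega2 * z * z + omega3 * z * z * z))%C with (num z / den z)%C.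
2:{ rewrite Enum; unfold omega; rewrite Eden; fold (W z); field; auto. }
change (Cmod (num z / den z) <= 1 * Cmod (num z)).
rewrite Cmod_div by exact Hden0; rewrite Rmult_1_l.
pose proof (Cmod_ge_0 (num z)).
apply Rmult_le_reg_r with (Cmod (den z)); [lra|]; unfold Rdiv; rewrite Rmult_assoc, Rinv_l by lra; nra.
Qed.

End OmegaExpansion.

Definition complete_data (X : CompleteNormedModule C_AbsRing) : completion_data X :=
  CompleteNormedModule.mixin C_AbsRing X (CompleteNormedModule.class C_AbsRing X).

Lemma holomorphic_holo {X : CompleteNormedModule C_AbsRing} (F : X -> X) : holomorphic F -> holo F.
Proof.
intros H x Hx; destruct (H x Hx) as [L HL]; exists L; apply filterdiff_fder; exact HL.
Qed.

Lemma Lin_inv_spec {U V : NormedModule C_AbsRing} (A : Lin U V) :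
  (exists B, is_inverse A B) -> is_inverse A (Lin_inv A).
Proof. exact (epsilon_spec (inhabits Lin_zero) (is_inverse A)). Qed.

Lemma line_deriv_0 {U V : NormedModule C_AbsRing} (F : U -> V) (x : U) (n : nat) :
  line_deriv F x n (RtoC 0) = MLin_diag n (frechet_n F n zero) x.
Proof. unfold line_deriv; replace ((RtoC 0) *: x) with (zero : U) by vring; reflexivity. Qed.

(** * The class condition on a complex line *)

Section Bound.

Context {X : CompleteNormedModule C_AbsRing}.

Notation V := (CompleteNormedModule.NormedModule C_AbsRing X).

Context (lambda : R) (Hl : 1 / 2 <= lambda <= 1) (F : V -> V)
  (HE : scalar_type_expansion F) (HF : class_Fhat lambda F) (x0 : V) (T : Lin V CV)
  (Hx0 : norm x0 = 1) (HT : support_functional x0 T).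

Let m := 1 + 2 * lambda.
Let phi (n : nat) (z : C) : V := line_deriv F x0 n z.
Let A (z : C) : Lin V V := frechet F (z *: x0).
Let B (z : C) : Lin V V := Lin_inv (A z).
Let a (n : nat) : C := coefA F x0 T n.

Lemma class_holo : holo F.
Proof. apply holomorphic_holo, HF. Qed.

Lemma norm_line (z : C) : norm (z *: x0) = Cmod z.
Proof. rewrite norm_scalC, Hx0; ring. Qed.

Lemma line_inverse (z : C) : Cmod z < 1 -> is_inverse (A z) (B z).
Proof.
intros Hz; apply Lin_inv_spec.
destruct HF as [_ [[_ H] _]]; apply H; unfold in_ball; rewrite norm_line; exact Hz.
Qed.

Lemma phi_cder (n : nat) (z : C) : Cmod z < 1 -> cder (phi n) z (phi (S n) z).
Proof.
intros Hz; apply (cder_line_deriv (complete_data X)); [apply class_holo|rewrite Hx0; lra].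
Qed.

Lemma A_cder (z : C) : Cmod z < 1 -> exists A', cder (V := Lin_NormedModule V V) A z A'.
Proof.
intros Hz; eexists.
apply (cder_frechet_n_line (complete_data X) F x0 1 z); [apply class_holo|rewrite Hx0; lra].
Qed.

Lemma T_x0 : T x0 = RtoC 1.
Proof. destruct HT as [E _]; rewrite E, Hx0; reflexivity. Qed.

Lemma phi_1_0 : phi 1 (RtoC 0) = x0.
Proof.
unfold phi; rewrite line_deriv_0; simpl.
destruct HF as [[_ E] _]; rewrite E; reflexivity.
Qed.

(** At 0 the derivatives in direction [x0] are multiples of [x0] by the expansion hypothesis;
    applying [T] with [T x0 = 1] identifies the factor. *)
Lemma phi_0 (k : nat) : (1 <= k <= 3)%nat ->
  phi (k + 1) (RtoC 0) = (RtoC (INR (fact (k + 1))) * a (k + 1)) *: x0.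
Proof.
intros Hk; destruct (HE k Hk) as [H [_ HH]]; specialize (HH x0).
unfold phi; rewrite line_deriv_0; set (D := MLin_diag (k + 1) (frechet_n F (k + 1) zero) x0) in *.
assert (Hf : RtoC (INR (fact (k + 1))) <> RtoC 0) by (apply RtoC_neq_0, INR_fact_neq_0).
assert (ED : D = (RtoC (INR (fact (k + 1))) * H x0) *: x0).
{ replace D with ((RtoC (INR (fact (k + 1)))) *: ((RtoC (/ INR (fact (k + 1)))) *: D)).
  - rewrite HH; vring.
  - rewrite RtoC_inv by apply INR_fact_neq_0; vcoefs; field; exact Hf. }
assert (Ea : a (k + 1) = H x0).
{ unfold a, coefA; fold D; rewrite ED, (linear_scal _ (lin_prop T)), T_x0.
  rewrite RtoC_inv by apply INR_fact_neq_0; cfold; field; exact Hf. }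
rewrite Ea; exact ED.
Qed.

Lemma phi_2_0 : phi 2 (RtoC 0) = (RtoC 2 * a 2) *: x0.
Proof.
assert (E := phi_0 1 ltac:(lia)); change (1 + 1)%nat with 2%nat in E.
replace (INR (fact 2)) with 2 in E by (simpl; lra); exact E.
Qed.

Lemma phi_3_0 : phi 3 (RtoC 0) = (RtoC 6 * a 3) *: x0.
Proof.
assert (E := phi_0 2 ltac:(lia)); change (2 + 1)%nat with 3%nat in E.
replace (INR (fact 3)) with 6 in E by (simpl; lra); exact E.
Qed.

Lemma phi_4_0 : phi 4 (RtoC 0) = (RtoC 24 * a 4) *: x0.
Proof.
assert (E := phi_0 3 ltac:(lia)); change (3 + 1)%nat with 4%nat in E.
replace (INR (fact 4)) with 24 in E by (simpl; lra); exact E.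
Qed.

Let q3 (z : C) : C := (RtoC 6 * a 3 + RtoC 24 * a 4 * z)%C.
Let q2 (z : C) : C := (RtoC 2 * a 2 + RtoC 6 * a 3 * z + RtoC 12 * a 4 * z * z)%C.
Let q1 (z : C) : C := lin_N (a 2) (a 3) (a 4) z.

Lemma cder_poly (c0 c1 c2 c3 z : C) : cderC (fun z => c0 + c1 * z + c2 * z * z + c3 * z * z * z)%C z
  (c1 + RtoC 2 * c2 * z + RtoC 3 * c3 * z * z)%C.
Proof.
assert (M : forall (f : C -> C) (l : C), cderC f z l -> cderC (fun z => f z * z)%C z (l * z + f z)%C).
{ intros f l Hf; apply (cder_eq _ _ _ _ (cder_scal (V := CV) f (fun z => z) z _ _ Hf (cder_id z))); cfold; ring. }
assert (K : forall c, cderC (fun _ => c) z (RtoC 0)) by (intros c; exact (cder_const (V := CV) c z)).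
assert (Q := cder_plus (V := CV) _ _ _ _ _ (cder_plus (V := CV) _ _ _ _ _ (cder_plus (V := CV) _ _ _ _ _ (K c0) (M _ _ (K c1)))
  (M _ _ (M _ _ (K c2)))) (M _ _ (M _ _ (M _ _ (K c3))))).
apply (cder_eq _ _ _ _ Q); cfold; ring.
Qed.

(** One integration step: the Taylor expansion of [phi n] from that of [phi (S n)]. The chain starts
    at [taylor_phi4], where continuity at 0 is enough. *)
Lemma small_phi_poly (n k : nat) (f f' : C -> C) :
  (forall z, cderC f z (f' z)) -> phi n (RtoC 0) = (f (RtoC 0)) *: x0 ->
  small k (fun z => minus (phi (S n) z) ((f' z) *: x0)) ->
  small (S k) (fun z => minus (phi n z) ((f z) *: x0)).
Proof.
intros Hf H0 Hs; apply (small_primitive k _ (fun z => minus (phi (S n) z) ((f' z) *: x0))).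
- intros z Hz; apply cder_minus; [apply phi_cder; exact Hz|].
  apply (cder_eq _ _ _ _ (cder_scal f (fun _ => x0) z _ _ (Hf z) (cder_const x0 z))); vring.
- rewrite H0; vring.
- exact Hs.
Qed.

Lemma taylor_phi4 : small 0 (fun z => minus (phi 4 z) ((RtoC 24 * a 4) *: x0)).
Proof.
eapply cder_small0.
- apply cder_minus; [apply phi_cder; rewrite Cmod_0; lra|apply cder_const].
- rewrite phi_4_0; vring.
Qed.

Lemma taylor_phi3 : small 1 (fun z => minus (phi 3 z) ((q3 z) *: x0)).
Proof.
apply (small_phi_poly 3 0 q3 (fun _ => RtoC 24 * a 4)%C); [| |exact taylor_phi4].
- intros z; assert (Q := cder_poly (RtoC 6 * a 3) (RtoC 24 * a 4) (RtoC 0) (RtoC 0) z).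
  apply (cder_ext _ q3 _ _ 1 Rlt_0_1) in Q; [apply (cder_eq _ _ _ _ Q); cfold; ring|intros; unfold q3; cfold; ring].
- rewrite phi_3_0; f_equal; unfold q3; ring.
Qed.

Lemma taylor_phi2 : small 2 (fun z => minus (phi 2 z) ((q2 z) *: x0)).
Proof.
apply (small_phi_poly 2 1 q2 q3); [| |exact taylor_phi3].
- intros z; assert (Q := cder_poly (RtoC 2 * a 2) (RtoC 6 * a 3) (RtoC 12 * a 4) (RtoC 0) z).
  apply (cder_ext _ q2 _ _ 1 Rlt_0_1) in Q; [apply (cder_eq _ _ _ _ Q); unfold q3; cfold; ring|intros; unfold q2; cfold; ring].
- rewrite phi_2_0; f_equal; unfold q2; ring.
Qed.

Lemma taylor_phi1 : small 3 (fun z => minus (phi 1 z) ((q1 z) *: x0)).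
Proof.
apply (small_phi_poly 1 2 q1 q2); [| |exact taylor_phi2].
- intros z; assert (Q := cder_poly (RtoC 1) (RtoC 2 * a 2) (RtoC 3 * a 3) (RtoC 4 * a 4) z).
  apply (cder_ext _ q1 _ _ 1 Rlt_0_1) in Q; [apply (cder_eq _ _ _ _ Q); unfold q2; cfold; ring|intros; unfold q1, lin_N; cfold; ring].
- rewrite phi_1_0; unfold q1, lin_N; vring.
Qed.

Let p (z : C) : C := T (B z (plus (z *: (phi 2 z)) (phi 1 z))).

Lemma p_cder (z : C) : Cmod z < 1 -> exists l, cderC p z l.
Proof.
intros Hz; destruct (A_cder z Hz) as [A' HA'].
eexists; apply (cder_lin T).
apply (cder_inverse_apply A B z (1 - Cmod z) ltac:(lra)) with (A' := A'); [|exact HA'|].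
- intros w Hw; apply line_inverse; generalize (Cmod_ball_sub z w); lra.
- apply cder_plus; [|apply phi_cder; exact Hz].
  apply (cder_scal (fun w => w)); [apply cder_id|apply phi_cder; exact Hz].
Qed.

(** Let [tau = T (B z x0)]. The remainders [r1] of [phi 1] and [r2] of [z phi 2 + phi 1] satisfy
    [T (B r1) = 1 - N tau] and [T (B r2) = p - P tau]. The unknown [tau] drops out of
    [N T (B r2) - P T (B r1) = N p - P], which is small because [B] is bounded near 0. *)
Lemma p_expansion : smallC 3 (fun z => lin_N (a 2) (a 3) (a 4) z * p z - lin_P (a 2) (a 3) (a 4) z)%C.
Proof.
destruct (A_cder (RtoC 0)) as [A' HA']; [rewrite Cmod_0; lra|].
destruct (inverse_bounded_near A B (RtoC 0) 1 Rlt_0_1) with (A' := A') as [d [K [Hd [HK HB]]]]; [|exact HA'|].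
{ intros w Hw; apply line_inverse; replace (w - RtoC 0)%C with w in Hw by ring; exact Hw. }
pose (r1 := fun z => minus (phi 1 z) ((q1 z) *: x0)).
pose (r2 := fun z => plus (z *: (minus (phi 2 z) ((q2 z) *: x0))) (r1 z)).
assert (Hr1 : small 3 r1) by exact taylor_phi1.
assert (Hr2 : small 3 r2).
{ apply small_plus; [|exact Hr1].
  intros eps He; destruct (taylor_phi2 eps He) as [d' [Hd' K']]; exists d'; split; [exact Hd'|]; intros z Hz.
  rewrite norm_scalC; specialize (K' z Hz); simpl; simpl in K'; pose proof (Cmod_ge_0 z); nra. }
assert (HS : forall r : C -> V, small 3 r -> smallC 3 (fun z => T (B z (r z)))).
{ intros r Hr; apply (small_bounded (V := V) (W := CV) 3 r _ d (norm T * K) Hd); [|intros z Hz|exact Hr].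
  - apply Rmult_le_pos; [apply norm_ge_0|exact HK].
  - apply Rle_trans with (1 := Lin_norm_apply T _); rewrite Rmult_assoc; apply Rmult_le_compat_l; [apply norm_ge_0|].
    apply HB; replace (z - RtoC 0)%C with z by ring; exact Hz. }
assert (S1 := smallC_mult 3 _ (fun z => lin_N (a 2) (a 3) (a 4) z) (HS r2 Hr2) ltac:(unfold lin_N; bnd)).
assert (S2 := smallC_mult 3 _ (fun z => - RtoC 1 * lin_P (a 2) (a 3) (a 4) z)%C (HS r1 Hr1) ltac:(unfold lin_P; bnd)).
refine (small_ext (V := CV) 3 _ _ 1 Rlt_0_1 _ (smallC_plus 3 _ _ S1 S2)).
intros z Hz; destruct (line_inverse z Hz) as [Hinv _].
set (N := lin_N (a 2) (a 3) (a 4) z); set (P := lin_P (a 2) (a 3) (a 4) z).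
assert (EBx : (T (B z (phi 1 z)) = RtoC 1)%C) by (rewrite <- T_x0; f_equal; apply (Hinv x0)).
assert (E1 : (T (B z (r1 z)) = RtoC 1 - N * T (B z x0))%C).
{ rewrite <- EBx; unfold r1; change (q1 z) with N.
  unfold minus; rewrite (linear_plus _ (lin_prop (B z))), (linear_opp _ _ (lin_prop (B z))), (linear_scal _ (lin_prop (B z))).
  rewrite (linear_plus _ (lin_prop T)), (linear_opp _ _ (lin_prop T)), (linear_scal _ (lin_prop T)); reflexivity. }
assert (E2 : (T (B z (r2 z)) = p z - P * T (B z x0))%C).
{ unfold p; replace (r2 z) with (minus (plus (z *: (phi 2 z)) (phi 1 z)) (P *: x0)).
  - unfold minus; rewrite (linear_plus _ (lin_prop (B z))), (linear_opp _ _ (lin_prop (B z))), (linear_scal _ (lin_prop (B z)) P).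
    rewrite (linear_plus _ (lin_prop T)), (linear_opp _ _ (lin_prop T)), (linear_scal _ (lin_prop T)); reflexivity.
  - unfold r2, r1; vcoefs; unfold P, q2, q1, lin_P, lin_N; ring. }
rewrite E1, E2; cfold; ring.
Qed.

(** The functional supporting [z x0] is [T] rotated by [|z| / z]; the rotation, the factor [1 / |z|]
    and the [z] pulled out of the derivatives cancel. *)
Lemma p_real_part (z : C) : 0 < Cmod z < 1 -> 1 / 2 - lambda <= Re (p z).
Proof.
intros Hz; destruct HF as [_ [_ H]].
set (x := z *: x0).
assert (Hz0 : z <> RtoC 0) by (apply Cmod_gt_0; lra).
assert (Hzm : RtoC (Cmod z) <> RtoC 0) by (apply RtoC_neq_0; lra).
assert (Hx : norm x = Cmod z) by apply norm_line.
specialize (H x (Lin_scal (RtoC (Cmod z) / z)%C T)).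
assert (Q : Re (Lin_scal (RtoC (Cmod z) / z)%C T ((RtoC (/ norm x)) *:
             (Lin_inv (frechet F x) (plus (MLin_diag 2 (frechet_n F 2 x) x) (frechet F x x))))) >= 1 / 2 - lambda).
{ apply H.
  - unfold in_ball; rewrite Hx; lra.
  - intros E; assert (E0 : norm x = 0) by (rewrite E; exact (norm_zero (V := V))); lra.
  - split.
    + change ((RtoC (Cmod z) / z) * T x = RtoC (norm x))%C; unfold x at 1.
      rewrite (linear_scal _ (lin_prop T)), T_x0, Hx; cfold; field; exact Hz0.
    + change (norm ((RtoC (Cmod z) / z) *: (T : Lin_NormedModule V C_NormedModule)) = 1).
      rewrite norm_scalC; destruct HT as [_ ->].
      rewrite Cmod_div, Cmod_R, Rabs_pos_eq by (auto; lra); field; lra. }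
apply Rge_le in Q; refine (eq_ind _ (fun r => 1 / 2 - lambda <= r) Q _ _); f_equal.
assert (E1 : MLin_diag 2 (frechet_n F 2 x) x = (z * z) *: (phi 2 z)).
{ unfold phi, line_deriv; fold x; simpl.
  set (D2 := frechet (frechet F) x); unfold x at 1 2.
  rewrite (linear_scal _ (lin_prop (D2 _))), (linear_scal _ (lin_prop D2)).
  change (z *: (z *: (D2 x0 x0)) = (z * z) *: (D2 x0 x0)); vring. }
assert (E2 : frechet F x x = z *: (phi 1 z)).
{ unfold phi, line_deriv; fold x; simpl; unfold x at 2; apply (linear_scal _ (lin_prop (frechet F x))). }
rewrite E1, E2.
transitivity ((RtoC (Cmod z) / z) * T ((RtoC (/ norm x)) *:
  (B z (plus ((z * z) *: (phi 2 z)) (z *: (phi 1 z))))))%C; [reflexivity|].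
replace (plus ((z * z) *: (phi 2 z)) (z *: (phi 1 z)))
  with (z *: (plus (z *: (phi 2 z)) (phi 1 z))) by vring.
rewrite (linear_scal _ (lin_prop (B z))).
rewrite !(linear_scal _ (lin_prop T)); fold (p z); rewrite Hx, RtoC_inv by lra.
cfold; field; auto.
Qed.

Lemma omega_den (z : C) : 0 < Cmod z < 1 -> (p z - RtoC 1 + RtoC m)%C <> RtoC 0.
Proof.
intros Hz E; assert (Q := p_real_part z Hz); apply (f_equal Re) in E.
destruct (p z) as [u v]; unfold Re, m in *; simpl in *; lra.
Qed.

Lemma omega_cder (z : C) : 0 < Cmod z < 1 -> exists l, cderC (omega m p) z l.
Proof.
intros Hz; destruct (p_cder z (proj2 Hz)) as [l Hp].
assert (Hq : cderC (fun w => p w - RtoC 1)%C z l).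
{ apply (cder_eq _ _ _ _ (cder_minus (V := CV) _ _ _ _ _ Hp (cder_const (V := CV) (RtoC 1) z))); cfold; ring. }
assert (Hq2 : cderC (fun w => p w - RtoC 1 + RtoC m)%C z l).
{ apply (cder_eq _ _ _ _ (cder_plus (V := CV) _ _ _ _ _ Hq (cder_const (V := CV) (RtoC m) z))); cfold; ring. }
eexists; unfold omega, Cdiv.
exact (cder_scal (V := CV) (fun w => p w - RtoC 1)%C (fun w => / (p w - RtoC 1 + RtoC m))%C z _ _ Hq
  (cder_comp (V := CV) (fun w => / w)%C (fun w => p w - RtoC 1 + RtoC m)%C z _ _ (cder_inv _ (omega_den z Hz)) Hq2)).
Qed.

(** With [q = p - 1], the inequality [|q| <= |q + m|] amounts to [Re q >= - m / 2]. *)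
Lemma omega_le_1 (z : C) : 0 < Cmod z < 1 -> Cmod (omega m p z) <= 1.
Proof.
intros Hz; assert (Hd := omega_den z Hz); assert (Q := p_real_part z Hz).
unfold omega; rewrite Cmod_div by exact Hd.
assert (H0 : 0 < Cmod (p z - RtoC 1 + RtoC m)) by now apply Cmod_gt_0.
apply Rmult_le_reg_r with (Cmod (p z - RtoC 1 + RtoC m)); [exact H0|].
unfold Rdiv; rewrite Rmult_assoc, Rinv_l by lra; rewrite Rmult_1_l, Rmult_1_r.

apply Rsqr_incr_0_var; [|lra]; rewrite !Rsqr_pow2, !Cmod_sqr.
destruct (p z) as [u v]; unfold Re, m in *; simpl in *; nra.
Qed.

Lemma J23_le : Cmod (J23 F x0 T) <= J23_bound lambda.
Proof.
assert (Hm : 2 <= m <= 3) by (unfold m; lra).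
assert (Hexp := omega_expansion m (proj1 Hm) (a 2) (a 3) (a 4) p p_expansion).
assert (Q := schur_functional_bound m Hm _ _ _
  (schur_w1 _ _ _ _ omega_cder omega_le_1 Hexp) (schur_w2 _ _ _ _ omega_cder omega_le_1 Hexp)
  (schur_w3_weak _ _ _ _ omega_cder omega_le_1 Hexp) (schur_w3 _ _ _ _ omega_cder omega_le_1 Hexp)).
unfold J23; fold (a 2) (a 3) (a 4); rewrite (J_omega m (proj1 Hm)), J23_bound_eq by exact Hl.
fold m; rewrite Cmod_mult, Cmod_opp, <- RtoC_div, Cmod_R, Rabs_pos_eq by lra.
apply Rmult_le_compat_l; [lra|exact Q].
Qed.

End Bound.

(** * Norming functionals *)

(** The version for a [Prop]-valued order, obtained from the boolean-valued one by deciding [le]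
    classically. *)
Lemma Zorn_Prop {E : Type} (le : E -> E -> Prop) :
  (forall t, le t t) -> (forall r s t, le r s -> le s t -> le r t) ->
  (forall s t, le s t -> le t s -> s = t) ->
  (forall A : E -> Prop, (forall s t, A s -> A t -> le s t \/ le t s) ->
     exists t, forall s, A s -> le s t) ->
  exists t, forall s, le t s -> s = t.
Proof.
intros Hrefl Htrans Hanti Hchain.
pose (leb := fun s t => if excluded_middle_informative (le s t) then true else false).
assert (leP : forall s t, is_true (leb s t) <-> le s t).
{ intros s t; unfold leb, is_true; destruct excluded_middle_informative; split; easy. }
destruct (@classical_sets.Zorn E leb) as [t Ht].
- intros t; apply leP, Hrefl.
- intros r s t; rewrite !leP; apply Htrans.
- intros s t; rewrite !leP; apply Hanti.
- intros A HA; destruct (Hchain A) as [t Ht].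
  + intros s t Hs Ht; generalize (HA s t Hs Ht); now rewrite !leP.
  + exists t; intros s Hs; apply leP; auto.
- exists t; intros s Hs; apply Ht, leP, Hs.
Qed.

Section HahnBanach.

Context {V : NormedModule C_AbsRing} (x0 : V).

Notation "r *r x" := ((RtoC r) *: x) (at level 40).

(* Graph of a real-linear functional on a real subspace, dominated by the norm. *)
Definition dominated_graph (G : V -> R -> Prop) : Prop :=
  G x0 (norm x0) /\
  (forall x y a b r, G x a -> G y b -> G (plus x (r *r y)) (a + r * b)) /\
  (forall x a, G x a -> a <= norm x).

Definition base_graph (x : V) (a : R) : Prop := exists r, x = r *r x0 /\ a = r * norm x0.

Lemma base_graph_dominated : dominated_graph base_graph.
Proof.
repeat split.
- exists 1; split; [vring|ring].
- intros x y a b r [s [-> ->]] [t [-> ->]]; exists (s + r * t); split; [|ring].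
  vcoefs; rewrite RtoC_plus, RtoC_mult; ring.
- intros x a [r [-> ->]]; rewrite norm_scalC, Cmod_R.
  apply Rmult_le_compat_r; [apply norm_ge_0|apply Rle_abs].
Qed.

Lemma base_graph_least (G : V -> R -> Prop) : dominated_graph G -> forall x a, base_graph x a -> G x a.
Proof.
intros [H0 [Hlin _]] x a [r [-> ->]].
(* Closure is stated only for [x + r y], so the zero vector is first produced as [x0 + (-1) x0]. *)
replace (r *r x0) with (plus (plus x0 ((-1) *r x0)) (r *r x0)) by vring.
replace (r * norm x0) with (norm x0 + (-1) * norm x0 + r * norm x0) by ring.
repeat apply Hlin; exact H0.
Qed.

Lemma dominated_graph_0 (G : V -> R -> Prop) : dominated_graph G -> G zero 0.
Proof. intros HG; apply (base_graph_least G HG); exists 0; split; [vring|ring]. Qed.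

Lemma dominated_graph_scal (G : V -> R -> Prop) (x : V) (a r : R) : dominated_graph G -> G x a -> G (r *r x) (r * a).
Proof.
intros HG Hx; replace (r *r x) with (plus zero (r *r x)) by vring; replace (r * a) with (0 + r * a) by ring.
apply (proj1 (proj2 HG)); [exact (dominated_graph_0 G HG)|exact Hx].
Qed.

Lemma dominated_graph_functional (G : V -> R -> Prop) (x : V) (a b : R) :
  dominated_graph G -> G x a -> G x b -> a = b.
Proof.
intros HG Ha Hb.
assert (H : forall a b, G x a -> G x b -> a <= b).
{ clear a b Ha Hb; intros a b Ha Hb.
  assert (Hz : G (plus x ((-1) *r x)) (a + (-1) * b)) by now apply HG.
  apply HG in Hz; replace (plus x ((-1) *r x)) with (zero : V) in Hz by vring.
  rewrite norm_zero in Hz; lra. }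
apply Rle_antisym; auto.
Qed.

(** One-dimensional extension: the triangle inequality places every [a - norm (x - y)] below every
    [norm (x' + y) - a'], and the supremum [c] of the former is an admissible value at [y]. *)
Lemma dominated_graph_extend (G : V -> R -> Prop) (y : V) : dominated_graph G ->
  exists G', dominated_graph G' /\ (forall x a, G x a -> G' x a) /\ exists c, G' y c.
Proof.
intros HG; pose proof HG as [H0 [Hlin Hdom]].
assert (Hsep : forall x x' a a', G x a -> G x' a' -> a - norm (minus x y) <= norm (plus x' y) - a').
{ intros x x' a a' Hx Hx'.
  assert (Q := Hdom _ _ (Hlin _ _ _ _ 1 Hx Hx')).
  replace (plus x (1 *r x')) with (plus (minus x y) (plus x' y)) in Q by vring.
  rewrite Rmult_1_l in Q.
  assert (Q2 : a + a' <= norm (minus x y) + norm (plus x' y)) by exact (Rle_trans _ _ _ Q (norm_triangle (minus x y) (plus x' y))).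
  lra. }
destruct (completeness (fun r => exists x a, G x a /\ r = a - norm (minus x y))) as [c [Hc1 Hc2]].
- exists (norm (plus zero y) - 0); intros r [x [a [Hx ->]]]; apply Hsep; [exact Hx|now apply dominated_graph_0].
- exists (norm x0 - norm (minus x0 y)), x0, (norm x0); auto.
- assert (Hlow : forall x a, G x a -> a - norm (minus x y) <= c).
  { intros x a Hx; apply Hc1; now exists x, a. }
  assert (Hup : forall x a, G x a -> c <= norm (plus x y) - a).
  { intros x a Hx; apply Hc2; intros r [x' [a' [Hx' ->]]]; now apply Hsep. }
  exists (fun z b => exists x a r, G x a /\ z = plus x (r *r y) /\ b = a + r * c).
  split; [split; [|split]|split].
  + exists x0, (norm x0), 0; split; [exact H0|split; [vring|ring]].
  + intros z1 z2 b1 b2 r [x1 [a1 [r1 [G1 [-> ->]]]]] [x2 [a2 [r2 [G2 [-> ->]]]]].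
    exists (plus x1 (r *r x2)), (a1 + r * a2), (r1 + r * r2); split; [now apply Hlin|split; [|ring]].
    vcoefs; rewrite ?RtoC_plus, ?RtoC_mult; ring.
  + intros z b [x [a [r [Hx [-> ->]]]]].
    (* For [r <> 0], division by [|r|] reduces domination to the lower ([r < 0]) or the upper
       ([r > 0]) constraint on [c]. *)
    destruct (Rtotal_order r 0) as [Hr|[->|Hr]].
    * assert (Hn0 : RtoC r <> RtoC 0) by (apply RtoC_neq_0; lra).
      pose (x' := (/ (- r)) *r x : V).
      assert (Q := Hlow x' _ (dominated_graph_scal G x a (/ (- r)) HG Hx)).
      replace (plus x (r *r y)) with ((- r) *r (minus x' y)).
      2:{ unfold x'; rewrite RtoC_inv, RtoC_opp by lra; vcoefs; field; auto. }
      rewrite scal_div_pos by lra.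
      apply Rmult_le_compat_l with (r := - r) in Q; [|lra].
      replace (- r * (/ - r * a - norm (minus x' y))) with (a - - r * norm (minus x' y)) in Q by (field; lra).
      lra.
    * replace (plus x (0 *r y)) with x by vring; generalize (Hdom x a Hx); lra.
    * assert (Hn0 : RtoC r <> RtoC 0) by (apply RtoC_neq_0; lra).
      pose (x' := (/ r) *r x : V).
      assert (Q := Hup x' _ (dominated_graph_scal G x a (/ r) HG Hx)).
      replace (plus x (r *r y)) with (r *r (plus x' y)).
      2:{ unfold x'; rewrite RtoC_inv by lra; vcoefs; field; auto. }
      rewrite scal_div_pos by lra.
      apply Rmult_le_compat_l with (r := r) in Q; [|lra].
      replace (r * (norm (plus x' y) - / r * a)) with (r * norm (plus x' y) - a) in Q by (field; lra).
      lra.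
  + intros x a Hx; exists x, a, 0; split; [exact Hx|split; [vring|ring]].
  + exists c, zero, 0, 1; split; [now apply dominated_graph_0|split; [vring|ring]].
Qed.

Lemma dominated_graph_total : exists G, dominated_graph G /\ forall y, exists c, G y c.
Proof.
destruct (Zorn_Prop (fun G H : {G | dominated_graph G} => forall x a, proj1_sig G x a -> proj1_sig H x a)) as [[G HG] Hmax].
- auto.
- auto.
- intros [G HG] [H HH] H1 H2; simpl in *.
  assert (E : G = H).
  { apply functional_extensionality; intros x; apply functional_extensionality; intros a.
    apply propositional_extensionality; split; auto. }
  subst H; f_equal; apply proof_irrelevance.
- intros A HA.
  (* Adding [base_graph] to the union of the chain gives the empty chain an upper bound as well. *)
  pose (W := fun x a => base_graph x a \/ exists G, A G /\ proj1_sig G x a).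
  assert (HW : dominated_graph W).
  { split; [left; exists 1; split; [vring|ring]|split].
    - intros x y a b r [Hx|[G [HG Hx]]] [Hy|[H [HH Hy]]].
      + left; apply base_graph_dominated; auto.
      + right; exists H; split; [exact HH|]; apply (proj2_sig H); auto.
        apply base_graph_least; [apply (proj2_sig H)|auto].
      + right; exists G; split; [exact HG|]; apply (proj2_sig G); auto.
        apply base_graph_least; [apply (proj2_sig G)|auto].
      + destruct (HA G H HG HH) as [L|L].
        * right; exists H; split; [exact HH|]; apply (proj2_sig H); auto.
        * right; exists G; split; [exact HG|]; apply (proj2_sig G); auto.
    - intros x a [Hx|[G [HG Hx]]]; [now apply base_graph_dominated|now apply (proj2_sig G)]. }
  exists (exist _ W HW); intros G HG x a Hx; simpl; right; now exists G.
- exists G; split; [exact HG|]; intros y.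
  destruct (dominated_graph_extend G y HG) as [G' [HG' [Hsub [c Hc]]]].
  assert (E := Hmax (exist _ G' HG') Hsub); apply (f_equal (@proj1_sig _ _)) in E; simpl in E; subst G'.
  now exists c.
Qed.

Lemma real_functional : exists u : V -> R, (forall x y r, u (plus x (r *r y)) = u x + r * u y) /\
  (forall x, u x <= norm x) /\ u x0 = norm x0.
Proof.
destruct dominated_graph_total as [G [HG Htot]].
pose (u := fun x => epsilon (inhabits 0) (G x)).
assert (Hu : forall x, G x (u x)) by (intros x; apply (epsilon_spec (inhabits 0) (G x)), Htot).
exists u; repeat split.
- intros x y r; apply (dominated_graph_functional G _ _ _ HG (Hu _)); apply HG; apply Hu.
- intros x; apply HG, Hu.
- apply (dominated_graph_functional G _ _ _ HG (Hu _)); apply HG.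
Qed.

(** Complexification [u x - i u (i x)]. A rotation making [T x] a nonnegative real turns the
    domination of [u] into [|T x| <= norm x]. *)
Lemma norming_functional : x0 <> zero -> exists T : Lin V CV, T x0 = RtoC (norm x0) /\ norm T = 1.
Proof.
intros Hx0; destruct real_functional as [u [Hlin [Hdom Hux0]]].
pose (T := fun x => (u x, - u (Ci *: x))).
assert (Hu0 : u (zero : V) = 0).
{ assert (Q : u (zero : V) = u (zero : V) + 1 * u (zero : V)); [|lra].
  rewrite <- Hlin; f_equal; vring. }
assert (Hplus : forall x y, u (plus x y) = u x + u y).
{ intros x y; replace (plus x y) with (plus x (1 *r y)) by vring; rewrite Hlin; ring. }
assert (Hscal : forall r x, u (r *r x) = r * u x).
{ intros r x; transitivity (u (zero : V) + r * u x); [rewrite <- Hlin; f_equal; vring|rewrite Hu0; ring]. }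
assert (Tplus : forall x y, T (plus x y) = (T x + T y)%C).
{ intros x y; unfold T; replace (Ci *: (plus x y)) with (plus (Ci *: x) (Ci *: y)) by vring.
  rewrite !Hplus; unfold Cplus; simpl; f_equal; ring. }
assert (Tscal : forall (c : C) x, T (c *: x) = (c * T x)%C).
{ intros [p q] x; unfold T.
  assert (E : (p, q) = (RtoC p + RtoC q * Ci)%C) by (unfold Cplus, Cmult, RtoC, Ci; simpl; f_equal; ring).
  assert (Ei : (Ci * Ci)%C = (- RtoC 1)%C) by (unfold Cmult, Copp, RtoC, Ci; simpl; f_equal; ring).
  replace ((p, q) *: x) with (plus (p *r x) (q *r (Ci *: x))) by (rewrite E; vring).
  replace (Ci *: (plus (p *r x) (q *r (Ci *: x))))
    with (plus (p *r (Ci *: x)) ((- q) *r x)).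
  2:{ transitivity (plus (p *r (Ci *: x)) ((Ci * Ci * RtoC q) *: x)); [|vring].
      rewrite Ei, RtoC_opp; vring. }
  rewrite !Hplus, !Hscal; unfold Cmult; simpl; f_equal; ring. }
assert (Tle : forall x, Cmod (T x) <= norm x).
{ intros x; destruct (unit_phase (T x)) as [v [Hv Ev]].
  assert (E : T ((Cconj v) *: x) = RtoC (Cmod (T x))).
  { rewrite Tscal; rewrite Ev at 1; replace (Cconj v * (RtoC (Cmod (T x)) * v))%C with (RtoC (Cmod (T x)) * (v * Cconj v))%C by (cfold; ring).
    rewrite Cmod_conj_sqr, Hv; replace (1 ^ 2) with 1 by ring; cfold; ring. }
  apply (f_equal fst) in E; simpl in E; rewrite <- E.
  apply Rle_trans with (1 := Hdom _); rewrite norm_scalC, Cmod_conj, Hv; lra. }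
assert (HT : is_linear (V := CV) T).
{ split; [exact Tplus|exact Tscal|]; exists 1; split; [lra|]; intros x; rewrite Rmult_1_l; apply Tle. }
(* The real part at [x0] is already [norm x0], so the bound on the modulus forces the imaginary part
   to vanish. *)
assert (Tx0 : T x0 = RtoC (norm x0)).
{ assert (Q := Tle x0); assert (Q2 := Cmod_sqr (T x0)).
  unfold T in *; simpl fst in *; simpl snd in *; rewrite Hux0 in *.
  set (w := u (Ci *: x0)) in *.
  pose proof (Cmod_ge_0 (norm x0, - w)); pose proof (norm_ge_0 x0).
  assert (w = 0) by nra; unfold RtoC; f_equal; lra. }
exists (mkLin (V := CV) T HT); split; [exact Tx0|].
assert (Hp : 0 < norm x0).
{ destruct (Rle_lt_or_eq_dec _ _ (norm_ge_0 x0)) as [H|H]; [exact H|exfalso; apply Hx0, norm_eq_zero; auto]. }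
apply Rle_antisym.
- apply Lin_norm_least; intros x Hx; apply Rle_trans with (1 := Tle x); exact Hx.
- assert (Q := Lin_norm_apply (mkLin (V := CV) T HT) x0).
  change (Cmod (T x0) <= Lin_norm (mkLin (V := CV) T HT) * norm x0) in Q.
  rewrite Tx0, Cmod_R, Rabs_pos_eq in Q by lra.
  apply Rmult_le_reg_r with (norm x0); [exact Hp|]; rewrite Rmult_1_l; exact Q.
Qed.

End HahnBanach.

(** * The extremal function *)

(* The principal logarithm on the right half-plane, junk elsewhere. *)
Definition clog (w : C) : C := (ln (Cmod w), atan (snd w / fst w)).

Lemma cexp_clog (w : C) : 0 < fst w -> cexp (clog w) = w.
Proof.
destruct w as [x y]; simpl fst; intros Hx.
assert (Hs : 0 < sqrt (1 + (y / x)²)) by (apply sqrt_lt_R0; generalize (Rle_0_sqr (y / x)); lra).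
assert (Hm : Cmod (x, y) = x * sqrt (1 + (y / x)²)).
{ unfold Cmod; simpl fst; simpl snd.
  rewrite <- (sqrt_pow2 x) at 2 by lra; rewrite <- sqrt_mult_alt by nra.
  f_equal; unfold Rsqr; field; lra. }
unfold cexp, clog; simpl fst; simpl snd.
rewrite exp_ln by (rewrite Hm; nra).
rewrite cos_atan, sin_atan, Hm; f_equal; field; lra.
Qed.

Lemma clog_im_bound (w : C) : - (PI / 2) < snd (clog w) < PI / 2.
Proof. generalize (atan_bound (snd w / fst w)); simpl; lra. Qed.

Lemma clog_continuous (w : C) : 0 < fst w -> forall eps, 0 < eps -> exists d, 0 < d /\
  forall w', Cmod (w' - w) < d -> 0 < fst w' /\ Cmod (clog w' - clog w) < eps.
Proof.
destruct w as [x y]; simpl fst; intros Hx eps He.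
assert (Hm : 0 < Cmod (x, y)).
{ eapply Rlt_le_trans; [exact Hx|]; eapply Rle_trans; [apply Rle_abs|].
  eapply Rle_trans; [|apply (Rmax_Cmod (x, y))]; apply Rmax_l. }
assert (Hc : continuous ln (Cmod (x, y))) by (apply (ex_derive_continuous ln); auto_derive; lra).
assert (He2 : 0 < eps / 2) by lra.
destruct (proj1 (filterlim_locally _ _) Hc (mkposreal _ He2)) as [d1 Hd1].
assert (Hc2 : continuous atan (y / x)) by (apply (ex_derive_continuous atan); auto_derive; auto).
destruct (proj1 (filterlim_locally _ _) Hc2 (mkposreal _ He2)) as [d2 Hd2].
assert (Hc3 : continuous (fun u : R * R => snd u / fst u) (x, y)).
{ apply (continuous_mult (fun u : R * R => snd u) (fun u : R * R => / fst u)).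
  - apply continuous_snd.
  - apply (continuous_comp (fun u : R * R => fst u) Rinv); [apply continuous_fst|].
    apply (ex_derive_continuous Rinv); auto_derive; simpl; lra. }
destruct (proj1 (filterlim_locally _ _) Hc3 d2) as [d3 Hd3].
pose proof (cond_pos d1); pose proof (cond_pos d3).
exists (Rmin x (Rmin d1 d3)); split; [repeat apply Rmin_glb_lt; auto|].
intros [x' y'] Hw.
assert (H1 : Cmod ((x', y') - (x, y)) < x) by (apply Rlt_le_trans with (1 := Hw), Rmin_l).
assert (H2 : Cmod ((x', y') - (x, y)) < d1) by (apply Rlt_le_trans with (1 := Hw); eapply Rle_trans; [apply Rmin_r|apply Rmin_l]).
assert (H3 : Cmod ((x', y') - (x, y)) < d3) by (apply Rlt_le_trans with (1 := Hw); eapply Rle_trans; [apply Rmin_r|apply Rmin_r]).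
assert (Hmax := Rmax_Cmod ((x', y') - (x, y))%C); simpl in Hmax.
assert (Gx : Rabs (x' + - x) <= Cmod ((x', y') - (x, y))) by (eapply Rle_trans; [apply Rmax_l|exact Hmax]).
assert (Gy : Rabs (y' + - y) <= Cmod ((x', y') - (x, y))) by (eapply Rle_trans; [apply Rmax_r|exact Hmax]).
split.
- simpl; destruct (Rabs_def2 (x' + - x) x); lra.
- replace (clog (x', y') - clog (x, y))%C with (ln (Cmod (x', y')) - ln (Cmod (x, y)), atan (y' / x') - atan (y / x))
    by (unfold clog, Cminus, Cplus, Copp; simpl; f_equal; ring).
  apply Rle_lt_trans with (1 := Cmod_le_Rabs _ _).
  assert (Q1 : Rabs (ln (Cmod (x', y')) - ln (Cmod (x, y))) < eps / 2).
  { apply (Hd1 (Cmod (x', y'))).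
    change (Rabs (Cmod (x', y') - Cmod (x, y)) < d1); apply Rle_lt_trans with (2 := H2).
    apply Rabs_le; split.
    - generalize (Cmod_ball_sub (x', y') (x, y)); replace ((x, y) - (x', y'))%C with (- ((x', y') - (x, y)))%C by ring.
      rewrite Cmod_opp; lra.
    - generalize (Cmod_ball_sub (x, y) (x', y')); lra. }
  assert (Q2 : Rabs (atan (y' / x') - atan (y / x)) < eps / 2).
  { apply (Hd2 (y' / x')); apply (Hd3 (x', y')); split; simpl; [apply Rle_lt_trans with (1 := Gx)|apply Rle_lt_trans with (1 := Gy)]; exact H3. }
  lra.
Qed.

(** The inverse function rule by hand: the increment [h] of [clog] satisfies
    [cexp h - 1 = (w' - w) / w], and [cexp_taylor1_bound] compares [h] with this quotient. *)
Lemma cder_clog (w : C) : 0 < fst w -> cderC clog w (/ w)%C.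
Proof.
intros Hw eps He.
assert (Hw0 : w <> RtoC 0) by (intros E; rewrite E in Hw; simpl in Hw; lra).
assert (Hm : 0 < Cmod w) by now apply Cmod_gt_0.
(* [|h| <= 1 / 20] gives [10 |h|^2 <= |h| / 2], hence [|h| <= 2 |w' - w| / |w|]; the second bound
   then makes [10 |h|^2] at most [eps |w' - w|]. *)
set (eta := Rmin (1 / 20) (eps * Cmod w / 20)).
assert (Heta : 0 < eta) by (apply Rmin_glb_lt; nra).
destruct (clog_continuous w Hw eta Heta) as [d [Hd K]].
exists d; split; [exact Hd|]; intros w' Hw'.
destruct (K w' Hw') as [Hp Hh].
set (h := (clog w' - clog w)%C) in *.
assert (Hh1 : Cmod h < 1 / 20) by (apply Rlt_le_trans with (1 := Hh), Rmin_l).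
assert (Hh2 : Cmod h < eps * Cmod w / 20) by (apply Rlt_le_trans with (1 := Hh), Rmin_r).
assert (T := cexp_taylor1_bound h ltac:(lra)).
assert (Ew : (cexp h - RtoC 1)%C = ((w' - w) * / w)%C).
{ assert (E : (cexp h * w)%C = w').
  { rewrite <- (cexp_clog w Hw) at 1; rewrite <- cexp_plus, <- (cexp_clog w' Hp); f_equal; unfold h; ring. }
  rewrite <- E; field; exact Hw0. }
rewrite Ew in T.
change (Cmod (h - (w' - w) * / w) <= eps * Cmod (w' - w)).
replace (h - (w' - w) * / w)%C with (- ((w' - w) * / w - h))%C by ring; rewrite Cmod_opp.
set (q := Cmod (w' - w)) in *; pose proof (Cmod_ge_0 h) as Hh0.
assert (Hq : Cmod ((w' - w) * / w) = q / Cmod w) by (rewrite Cmod_mult, Cmod_inv by auto; reflexivity).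
assert (H2 : Cmod h <= 2 * (q / Cmod w)).
{ assert (T2 := Cmod_ball_sub ((w' - w) * / w) h).
  replace (h - (w' - w) * / w)%C with (- ((w' - w) * / w - h))%C in T2 by ring; rewrite Cmod_opp, Hq in T2; nra. }
apply Rle_trans with (1 := T).
apply Rle_trans with (10 * (2 * (q / Cmod w)) * (eps * Cmod w / 20)); [nra|].
right; field; lra.
Qed.

(** * Primitives by integration along rays *)

Section Primitive.

Context (h : C -> C) (Hh : holo (U := CV) (V := CV) h)
  (Hbd : forall R, R < 1 -> exists M, forall z, Cmod z <= R -> Cmod (h z) <= M).

Definition deriv_n (n : nat) (z : C) : C := line_deriv (U := CV) (V := CV) h (RtoC 1) n z.

Lemma deriv_n_0 (z : C) : deriv_n 0 z = h z.
Proof. unfold deriv_n, line_deriv; simpl; f_equal; change (z * RtoC 1 = z)%C; ring. Qed.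

Lemma deriv_n_cder (n : nat) (z : C) : Cmod z < 1 -> cderC (deriv_n n) z (deriv_n (S n) z).
Proof.
intros Hz; apply (cder_line_deriv (U := CV) C_complete); [exact Hh|].
change (Cmod z * Cmod (RtoC 1) < 1); rewrite Cmod_1; lra.
Qed.

Lemma h_cder (z : C) : Cmod z < 1 -> cderC h z (deriv_n 1 z).
Proof.
intros Hz; apply (cder_ext _ _ _ _ 1 Rlt_0_1 (fun w _ => deriv_n_0 w)); apply deriv_n_cder; exact Hz.
Qed.

(** The constants depend only on [R], as differentiation under the integral over a ray requires; the
    bound [Hbd] on a slightly larger disc replaces a compactness argument. *)
Lemma taylor1_uniform (R : R) : R < 1 -> exists d K, 0 < d /\ 0 <= K /\ forall z k, Cmod z <= R -> Cmod k < d ->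
  Cmod (h (z + k) - h z - k * deriv_n 1 z) <= K * Cmod k ^ 2.
Proof.
intros HR; destruct (Hbd ((1 + R) / 2)) as [M HM]; [lra|].
set (rho := (1 - R) / 6); assert (Hrho : 0 < rho) by (unfold rho; lra).
assert (HM' : forall z, Cmod z <= R -> forall y : C, Cmod (y - z) < 3 * rho -> Cmod y < 1 /\ Cmod (h y) <= Rabs M).
{ intros z Hz y Hy; assert (Cmod y <= (1 + R) / 2) by (generalize (Cmod_ball_sub z y); unfold rho in Hy; lra).
  split; [lra|]; apply Rle_trans with (1 := HM y ltac:(assumption)), Rle_abs. }
exists rho, (Rabs M / (rho * rho)); split; [exact Hrho|split].
{ apply Rmult_le_pos; [apply Rabs_pos|left; apply Rinv_0_lt_compat; nra]. }
intros z k Hz Hk.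
assert (Q := taylor1_bound (U := CV) C_complete h Hh z rho (Rabs M) Hrho (HM' z Hz) z k).
assert (E : frechet (U := CV) (V := CV) h z k = (k * deriv_n 1 z)%C).
{ unfold deriv_n, line_deriv; simpl.
  replace (z *: (RtoC 1 : CV)) with (z : CV) by (cfold; ring).
  replace (k : CV) with (k *: (RtoC 1 : CV)) at 1 by (cfold; ring).
  rewrite (linear_scal _ (lin_prop (frechet h z))); reflexivity. }
rewrite E in Q; apply Q.
- change (Cmod (z - z) < rho); replace (z - z)%C with (RtoC 0) by ring; rewrite Cmod_0; exact Hrho.
- change (Cmod (z + k - z) < rho); replace (z + k - z)%C with k by ring; exact Hk.
Qed.

Lemma ray_cder (c : C -> C) (c' z : C) (s : R) : cderC c (RtoC s * z)%C c' ->
  cderC (fun w => c (w * z)%C) (RtoC s) (z * c')%C.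
Proof.
intros Hc.
assert (Hmul : cderC (fun s => s * z)%C (RtoC s) z).
{ apply (cder_eq _ _ _ _ (cder_scal (V := CV) (fun s => s) (fun _ => z) (RtoC s) _ _ (cder_id _) (cder_const (V := CV) z _))).
  cfold; ring. }
exact (cder_comp (V := CV) c (fun s => s * z)%C (RtoC s) z _ Hc Hmul).
Qed.

Lemma real_line_affine (s t : R) : (RtoC s = RtoC t + RtoC (s - t) * RtoC 1)%C.
Proof. rewrite RtoC_minus; ring. Qed.

Lemma ray_int_exists (c : C -> C) : (forall s, 0 <= s <= 1 -> exists l, cderC c (RtoC s) l) ->
  exists l, is_int (V := CV) (fun s => c (RtoC s)) 0 1 l.
Proof.
intros H; apply (int_exists C_complete); intros s Hs; rewrite Rmin_left, Rmax_right in Hs by lra.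
destruct (H s Hs) as [l Hl].
exact (cder_cont_at (V := CV) c RtoC s (RtoC 1) l (fun t => real_line_affine t s) Hl).
Qed.

Lemma ray_in_disc (z : C) (s : R) : Cmod z < 1 -> 0 <= s <= 1 -> Cmod (RtoC s * z) < 1.
Proof. intros Hz Hs; rewrite Cmod_mult, Cmod_R, Rabs_pos_eq by lra; pose proof (Cmod_ge_0 z); nra. Qed.

(** The primitive of [h] divided by [z], written as a mean over the ray so that it makes sense at
    0. *)
Definition ray_mean (z : C) : C :=
  epsilon (inhabits (RtoC 0)) (fun l => is_int (V := CV) (fun s => h (RtoC s * z)%C) 0 1 l).

Lemma ray_mean_spec (z : C) : Cmod z < 1 -> is_int (V := CV) (fun s => h (RtoC s * z)%C) 0 1 (ray_mean z).
Proof.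
intros Hz; apply (epsilon_spec (inhabits (RtoC 0)) (fun l => is_int (V := CV) (fun s => h (RtoC s * z)%C) 0 1 l)).
apply (ray_int_exists (fun w => h (w * z)%C)).
intros s Hs; eexists; apply ray_cder, h_cder, ray_in_disc; auto.
Qed.

(* d/dz of z * ray_mean z is the integral over s of d/ds (s h (s z)). *)
Lemma ray_mean_cder (z : C) : Cmod z < 1 -> exists g', cderC ray_mean z g' /\
  (ray_mean z + z * g')%C = h z.
Proof.
intros Hz.
destruct (ray_int_exists (fun w => w * deriv_n 1 (w * z))%C) as [g' Hg'].
{ intros s Hs; eexists; apply (cder_scal (V := CV) (fun w => w)); [apply cder_id|].
  apply ray_cder, deriv_n_cder, ray_in_disc; auto. }
exists g'; split.
- destruct (taylor1_uniform ((1 + Cmod z) / 2)) as [d [K [Hd [HK HT]]]]; [lra|].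
  intros eps He.
  set (d' := Rmin (Rmin d ((1 - Cmod z) / 2)) (eps / (K + 1))).
  assert (Hd' : 0 < d') by (repeat apply Rmin_glb_lt; [lra|lra|apply Rdiv_lt_0_compat; lra]).
  exists d'; split; [exact Hd'|]; intros w Hw.
  assert (H1 : Cmod (w - z) < d) by (apply Rlt_le_trans with (1 := Hw); eapply Rle_trans; [apply Rmin_l|apply Rmin_l]).
  assert (H2 : Cmod (w - z) < (1 - Cmod z) / 2) by (apply Rlt_le_trans with (1 := Hw); eapply Rle_trans; [apply Rmin_l|apply Rmin_r]).
  assert (H3 : Cmod (w - z) < eps / (K + 1)) by (apply Rlt_le_trans with (1 := Hw); apply Rmin_r).
  assert (Hw1 : Cmod w < 1) by (generalize (Cmod_ball_sub z w); lra).
  assert (I := int_minus (V := CV) _ _ _ _ _ _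
    (int_minus (V := CV) _ _ _ _ _ _ (ray_mean_spec w Hw1) (ray_mean_spec z Hz)) (int_scal (V := CV) (w - z)%C _ _ _ _ Hg')).
  pose proof (Cmod_ge_0 (w - z)) as Hq.
  apply Rle_trans with ((1 - 0) * (K * Cmod (w - z) ^ 2)).
  + refine (int_norm_le (V := CV) _ 0 1 _ _ Rle_0_1 _ I); intros s Hs.
    change (Cmod (h (RtoC s * w) - h (RtoC s * z) - (w - z) * (RtoC s * deriv_n 1 (RtoC s * z))) <= K * Cmod (w - z) ^ 2)%C.
    assert (Hsk : Cmod (RtoC s * (w - z)) <= Cmod (w - z)) by (rewrite Cmod_mult, Cmod_R, Rabs_pos_eq by lra; nra).
    assert (Hsz : Cmod (RtoC s * z) <= Cmod z) by (rewrite Cmod_mult, Cmod_R, Rabs_pos_eq by lra; pose proof (Cmod_ge_0 z); nra).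
    assert (Q := HT (RtoC s * z)%C (RtoC s * (w - z))%C ltac:(lra) ltac:(lra)).
    replace (RtoC s * z + RtoC s * (w - z))%C with (RtoC s * w)%C in Q by ring.
    replace ((w - z) * (RtoC s * deriv_n 1 (RtoC s * z)))%C with (RtoC s * (w - z) * deriv_n 1 (RtoC s * z))%C by ring.
    apply Rle_trans with (1 := Q), Rmult_le_compat_l; [exact HK|].
    apply pow_incr; split; [apply Cmod_ge_0|exact Hsk].
  + assert (H4 : Cmod (w - z) * (K + 1) < eps).
    { apply lt_div_mult; [lra|exact H3]. }
    nra.
- pose (f := fun w => (w * h (w * z))%C); pose (g := fun w => (h (w * z) + z * (w * deriv_n 1 (w * z)))%C).
  assert (Hs0 : forall s, 0 <= s <= 1 -> cderC (fun w => h (w * z)%C) (RtoC s) (z * deriv_n 1 (RtoC s * z))%C).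
  { intros s Hs; apply ray_cder, h_cder, ray_in_disc; auto. }
  assert (I := int_derive (V := CV) C_complete f g RtoC 0 1 (RtoC 1) real_line_affine).
  assert (I' : is_int (V := CV) (fun t => (RtoC 1) *: (g (RtoC t) : CV)) 0 1 (minus (f (RtoC 1) : CV) (f (RtoC 0)))).
  { apply I; intros s Hs; rewrite Rmin_left, Rmax_right in Hs by lra.
    - apply (cder_eq _ _ _ _ (cder_scal (V := CV) _ _ _ _ _ (cder_id (RtoC s)) (Hs0 s Hs))); unfold g; cfold; ring.
    - eexists; unfold g; apply (cder_plus (V := CV)); [exact (Hs0 s Hs)|].
      apply (cder_scal (V := CV) (fun _ => z)); [apply (cder_const (V := CV))|].
      apply (cder_scal (V := CV) (fun w => w)); [apply cder_id|].
      apply ray_cder, deriv_n_cder, ray_in_disc; auto. }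
  assert (I2 := int_plus (V := CV) _ _ _ _ _ _ (ray_mean_spec z Hz) (int_scal (V := CV) z _ _ _ _ Hg')).
  apply (int_ext _ (fun t => (RtoC 1) *: (g (RtoC t) : CV))) in I2.
  2:{ intros t _; unfold g; cfold; ring. }
  assert (E := int_unique (V := CV) C_complete _ _ _ _ _ I2 I').
  change (ray_mean z + z * g' = f (RtoC 1) - f (RtoC 0))%C in E; rewrite E; unfold f.
  replace (RtoC 1 * z)%C with z by ring; ring.
Qed.

Lemma ray_mean_0 : ray_mean (RtoC 0) = h (RtoC 0).
Proof.
assert (H0 : Cmod (RtoC 0) < 1) by (rewrite Cmod_0; lra).
destruct (ray_mean_cder (RtoC 0) H0) as [g' [_ E]]; rewrite <- E; ring.
Qed.

Lemma primitive_cder (z : C) : Cmod z < 1 -> cderC (fun w => w * ray_mean w)%C z (h z).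
Proof.
intros Hz; destruct (ray_mean_cder z Hz) as [g' [Hg E]].
apply (cder_eq _ _ _ _ (cder_scal (V := CV) _ _ _ _ _ (cder_id z) Hg)).
rewrite <- E; cfold; ring.
Qed.

End Primitive.

Lemma cder_holo (h h' : C -> C) : (forall z, Cmod z < 1 -> cderC h z (h' z)) ->
  holo (U := CV) (V := CV) h.
Proof.
intros H z Hz; exists (lin_smul (V := CV) (h' z)); exact (H z Hz).
Qed.

Lemma fst_one_minus_pos (w : C) : Cmod w < 1 -> 0 < fst (RtoC 1 - w)%C.
Proof.
intros Hw; assert (Q := Rmax_Cmod w); assert (Q2 := Rmax_l (Rabs (fst w)) (Rabs (snd w))).
assert (Q3 := Rle_abs (fst w)); destruct w as [a b]; simpl in *; lra.
Qed.

Lemma derivable_pt_lim_fst (f : C -> C) (s : R) (l : C) :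
  cderC f (RtoC s) l -> derivable_pt_lim (fun r => fst (f (RtoC r))) s (fst l).
Proof.
intros H eps He; destruct (H (eps / 2) ltac:(lra)) as [d [Hd K]].
exists (mkposreal d Hd); intros r Hr0 Hr; simpl in Hr.
specialize (K (RtoC (s + r))); replace (RtoC (s + r) - RtoC s)%C with (RtoC r) in K by (rewrite RtoC_plus; ring).
rewrite Cmod_R in K; specialize (K Hr).
change (Cmod (f (RtoC (s + r)) - f (RtoC s) - RtoC r * l) <= eps / 2 * Rabs r) in K.
assert (Q := Rle_trans _ _ _ (Rle_trans _ _ _ (Rmax_l _ _) (Rmax_Cmod (f (RtoC (s + r)) - f (RtoC s) - RtoC r * l)%C)) K).
destruct (f (RtoC (s + r))) as [a a'], (f (RtoC s)) as [b b'], l as [c c']; simpl in *.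
assert (Hrp : 0 < Rabs r) by now apply Rabs_pos_lt.
replace ((a - b) / r - c) with ((a - b - r * c) / r) by (field; exact Hr0).
unfold Rdiv at 1; rewrite Rabs_mult, Rabs_inv.
apply Rle_lt_trans with (eps / 2 * Rabs r * / Rabs r).
- apply Rmult_le_compat_r; [left; now apply Rinv_0_lt_compat|].
  replace (a - b - r * c) with (a + - b + - (r * c - 0 * c')) by ring; exact Q.
- rewrite Rmult_assoc, Rinv_r by lra; lra.
Qed.

Section ExtremalFunction.

Context (m : R) (Hm : 2 <= m <= 3).

Let t := extremal_t m.

(** The point of the unit circle with real part [t]; it and its conjugate are the zeros of
    [extremal_Q]. *)
Definition extremal_unit : C := (t, sqrt (1 - t ^ 2)).

Let e := extremal_unit.
Let sg := snd e.

Lemma extremal_t_lt_1 : 0 < t < 1 /\ 0 < sg /\ sg ^ 2 = 1 - t ^ 2.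
Proof.
destruct (extremal_t_sqr m Hm) as [H0 HP]; destruct (opt_params m Hm) as [H1 [H2 [H3 H4]]].
fold t in H0, HP.
assert (H5 : t ^ 2 < 1).
{ assert (t ^ 2 * (3 * (2 + m / 2 + 1 - (m - 2) * (m + 1) / 2)) < 1 * (3 * (2 + m / 2 + 1 - (m - 2) * (m + 1) / 2))) by nra.
  nra. }
assert (H6 : t < 1) by nra.
split; [lra|]; unfold sg, e, extremal_unit; simpl snd.
split; [apply sqrt_lt_R0; lra|apply pow2_sqrt; lra].
Qed.

Lemma extremal_unit_conj : (e * Cconj e)%C = RtoC 1.
Proof.
destruct extremal_t_lt_1 as [H1 [H2 H3]]; unfold e, extremal_unit, Cconj, Cmult, RtoC; cbn [fst snd].
change (sqrt (1 - t ^ 2)) with sg; f_equal; [|ring]; transitivity (t ^ 2 + sg ^ 2); [ring|lra].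
Qed.

Lemma Cmod_extremal_unit : Cmod e = 1.
Proof.
assert (H : Cmod e ^ 2 = 1) by (apply RtoC_inj; rewrite <- Cmod_conj_sqr; apply extremal_unit_conj).
pose proof (Cmod_ge_0 e); nra.
Qed.

Lemma extremal_unit_plus_conj : (e + Cconj e)%C = RtoC (2 * t).
Proof. unfold e, extremal_unit, Cconj, Cplus, RtoC; simpl; f_equal; ring. Qed.

Lemma extremal_unit_minus_conj : (e - Cconj e)%C = (RtoC (2 * sg) * Ci)%C.
Proof. unfold sg, e, extremal_unit, Cconj, Cminus, Cplus, Copp, Cmult, Ci, RtoC; simpl; f_equal; ring. Qed.

Lemma extremal_unit_minus_conj_neq_0 : (e - Cconj e)%C <> RtoC 0.
Proof.
destruct extremal_t_lt_1 as [_ [H _]]; rewrite extremal_unit_minus_conj.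
apply Cmult_neq_0; [apply RtoC_neq_0; lra|]; intros E; apply (f_equal snd) in E; simpl in E; lra.
Qed.

Lemma factor_small (c z : C) : Cmod c = 1 -> Cmod z < 1 -> Cmod (c * z) < 1.
Proof. intros Hc Hz; rewrite Cmod_mult, Hc; lra. Qed.

Lemma Cmod_conj_unit : Cmod (Cconj e) = 1.
Proof. rewrite Cmod_conj; apply Cmod_extremal_unit. Qed.

Lemma factor_pos (c z : C) : Cmod c = 1 -> Cmod z < 1 -> 0 < fst (RtoC 1 - c * z)%C.
Proof. intros; apply fst_one_minus_pos, factor_small; auto. Qed.

Lemma fst_pos_neq_0 (w : C) : 0 < fst w -> w <> RtoC 0.
Proof. intros H E; rewrite E in H; simpl in H; lra. Qed.

Lemma factor_neq_0 (c z : C) : Cmod c = 1 -> Cmod z < 1 -> (RtoC 1 - c * z)%C <> RtoC 0.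
Proof. intros; apply fst_pos_neq_0, factor_pos; auto. Qed.

Definition extremal_Q (z : C) : C := (RtoC 1 - RtoC (2 * t) * z + z * z)%C.

Lemma extremal_Q_factor (z : C) : extremal_Q z = ((RtoC 1 - e * z) * (RtoC 1 - Cconj e * z))%C.
Proof.
unfold extremal_Q; rewrite <- extremal_unit_plus_conj.
replace ((RtoC 1 - e * z) * (RtoC 1 - Cconj e * z))%C with (RtoC 1 - (e + Cconj e) * z + (e * Cconj e) * (z * z))%C by ring.
rewrite extremal_unit_conj; ring.
Qed.

Lemma extremal_Q_neq_0 (z : C) : Cmod z < 1 -> extremal_Q z <> RtoC 0.
Proof.
intros Hz; rewrite extremal_Q_factor; apply Cmult_neq_0; apply factor_neq_0; auto;
  [apply Cmod_extremal_unit|apply Cmod_conj_unit].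
Qed.

(** A logarithm of [extremal_Q]: each linear factor lies in the right half-plane, where the
    principal branch is differentiable, while their product may leave it. *)
Definition extremal_log (z : C) : C := (clog (RtoC 1 - e * z) + clog (RtoC 1 - Cconj e * z))%C.

Lemma cder_factor_log (c z : C) : Cmod c = 1 -> Cmod z < 1 ->
  cderC (fun z => clog (RtoC 1 - c * z))%C z (- c / (RtoC 1 - c * z))%C.
Proof.
intros Hc Hz.
assert (H1 : cderC (fun z => RtoC 1 - c * z)%C z (- c)%C).
{ assert (Q := cder_poly (RtoC 1) (- c)%C (RtoC 0) (RtoC 0) z).
  apply (cder_ext _ (fun z => RtoC 1 - c * z)%C _ _ 1 Rlt_0_1) in Q; [apply (cder_eq _ _ _ _ Q); cfold; ring|intros; cfold; ring]. }
assert (Q := cder_comp (V := CV) clog (fun z => RtoC 1 - c * z)%C z _ _ (cder_clog _ (factor_pos c z Hc Hz)) H1).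
apply (cder_eq _ _ _ _ Q); cfold; unfold Cdiv; ring.
Qed.

Lemma extremal_log_cder (z : C) : Cmod z < 1 ->
  cderC extremal_log z (RtoC 2 * (z - RtoC t) / extremal_Q z)%C.
Proof.
intros Hz.
assert (Q := cder_plus (V := CV) _ _ _ _ _ (cder_factor_log e z Cmod_extremal_unit Hz) (cder_factor_log (Cconj e) z Cmod_conj_unit Hz)).
apply (cder_eq _ _ _ _ Q); cfold.
assert (N1 := factor_neq_0 e z Cmod_extremal_unit Hz); assert (N2 := factor_neq_0 (Cconj e) z Cmod_conj_unit Hz).
replace (RtoC 2 * (z - RtoC t))%C with (- (e + Cconj e) + (e * Cconj e) * z + (e * Cconj e) * z)%C.
- rewrite extremal_Q_factor; field; auto.
- rewrite extremal_unit_conj, extremal_unit_plus_conj, RtoC_mult; ring.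
Qed.

Definition extremal_h (z : C) : C := cexp (RtoC (- (m / 2)) * extremal_log z).

Lemma extremal_h_cder (z : C) : Cmod z < 1 ->
  cderC extremal_h z (extremal_h z * (RtoC m * (RtoC t - z) / extremal_Q z))%C.
Proof.
intros Hz.
assert (H1 := cder_scal (V := CV) (fun _ => RtoC (- (m / 2))) extremal_log z _ _ (cder_const (V := CV) (RtoC (- (m / 2))) z) (extremal_log_cder z Hz)).
assert (H2 := cder_comp (V := CV) cexp (fun z => RtoC (- (m / 2)) * extremal_log z)%C z _ _ (cder_cexp _) H1).
apply (cder_eq _ _ _ _ H2); cfold; change (cexp (RtoC (- (m / 2)) * extremal_log z)) with (extremal_h z).
assert (N := extremal_Q_neq_0 z Hz).
unfold Rdiv; rewrite RtoC_opp, RtoC_mult, RtoC_inv by lra; field; repeat split; auto; apply RtoC_neq_0; lra.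
Qed.

Lemma extremal_h_holo : holo (U := CV) (V := CV) extremal_h.
Proof. exact (cder_holo _ _ extremal_h_cder). Qed.

Lemma extremal_h_neq_0 (z : C) : extremal_h z <> RtoC 0.
Proof. apply cexp_neq_0. Qed.

Lemma extremal_h_0 : extremal_h (RtoC 0) = RtoC 1.
Proof.
unfold extremal_h, extremal_log.
replace (RtoC 1 - e * RtoC 0)%C with (RtoC 1) by ring; replace (RtoC 1 - Cconj e * RtoC 0)%C with (RtoC 1) by ring.
replace (clog (RtoC 1)) with (RtoC 0).
- replace (RtoC (- (m / 2)) * (RtoC 0 + RtoC 0))%C with (RtoC 0) by ring; apply cexp_0.
- unfold clog; rewrite Cmod_1, ln_1; simpl; unfold Rdiv; rewrite Rmult_0_l, atan_0; reflexivity.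
Qed.

Lemma extremal_h_bounded (R : R) : R < 1 -> exists M, forall z, Cmod z <= R -> Cmod (extremal_h z) <= M.
Proof.
intros HR; exists (exp (m / 2 * (- ln (1 - R) - ln (1 - R)))); intros z Hz.
unfold extremal_h; rewrite Cmod_cexp.
assert (Hln : forall c, Cmod c = 1 -> ln (1 - R) <= ln (Cmod (RtoC 1 - c * z))).
{ intros c Hc; apply ln_le; [lra|].
  assert (Q := Cmod_ball_sub (c * z) (RtoC 1)); rewrite Cmod_1, Cmod_mult, Hc in Q; lra. }
assert (L1 := Hln e Cmod_extremal_unit); assert (L2 := Hln (Cconj e) Cmod_conj_unit).
match goal with |- exp ?x <= exp ?y => assert (H : x <= y) end.
{ unfold extremal_log, clog, Cmult, Cplus, RtoC at 1; simpl fst.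
  simpl fst in *; simpl snd. 
  match goal with |- - (m / 2) * (?a + ?b) - 0 * _ <= _ => assert (ln (1 - R) <= a) by exact L1; assert (ln (1 - R) <= b) by exact L2 end.
  nra. }
destruct H as [H|H]; [left; now apply exp_increasing|rewrite H; lra].
Qed.

Definition extremal_g : C -> C := ray_mean extremal_h.

(* The segment [0, Log W] transported by the inverse of the convex map
   z |-> (Log (1 - conj e z) - Log (1 - e z)) / (e - conj e), whose derivative is 1 / Q:
   along this path d/ds (z g(z)) is a constant times Q^(1 - m/2), of positive real part. *)
Lemma extremal_g_neq_0 (z : C) : Cmod z < 1 -> extremal_g z <> RtoC 0.
Proof.
intros Hz.
destruct (Ceq_dec z (RtoC 0)) as [->|Hz0].
{ unfold extremal_g; rewrite (ray_mean_0 _ extremal_h_holo extremal_h_bounded), extremal_h_0; apply RtoC_neq_0; lra. }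
destruct extremal_t_lt_1 as [Ht [Hsg Hsg2]]; pose proof PI_RGT_0 as HPI.
set (L := (clog (RtoC 1 - Cconj e * z) - clog (RtoC 1 - e * z))%C).
set (th := snd L).
assert (P1 := factor_pos e z Cmod_extremal_unit Hz); assert (P2 := factor_pos (Cconj e) z Cmod_conj_unit Hz).
assert (N1 := fst_pos_neq_0 _ P1); assert (N2 := fst_pos_neq_0 _ P2).
assert (Hd := extremal_unit_minus_conj_neq_0).
assert (HW : cexp L = ((RtoC 1 - Cconj e * z) / (RtoC 1 - e * z))%C).
{ unfold L, Cminus at 1; rewrite cexp_plus, cexp_opp, !cexp_clog by assumption; reflexivity. }
assert (HL0 : L <> RtoC 0).
{ intros E; rewrite E, cexp_0 in HW.
  assert (E2 : (z * (e - Cconj e) = RtoC 0)%C).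
  { replace (z * (e - Cconj e))%C with ((RtoC 1 - Cconj e * z) / (RtoC 1 - e * z) * (RtoC 1 - e * z) - (RtoC 1 - e * z))%C by (field; exact N1).
    rewrite <- HW; ring. }
  revert E2; apply Cmult_neq_0; assumption. }
assert (Hth : - PI < th < PI).
{ unfold th, L; generalize (clog_im_bound (RtoC 1 - Cconj e * z)%C) (clog_im_bound (RtoC 1 - e * z)%C); intros [A1 A2] [B1 B2].
  replace (snd (clog (RtoC 1 - Cconj e * z) - clog (RtoC 1 - e * z))%C)
    with (snd (clog (RtoC 1 - Cconj e * z)%C) - snd (clog (RtoC 1 - e * z)%C)) by (unfold Cminus, Cplus, Copp; simpl; ring).
  lra. }
pose (Y := fun s : C => cexp (s * L)).
pose (den := fun s : C => (Y s * e - Cconj e)%C).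
(* Solving [y = (1 - conj e z) / (1 - e z)] gives [z = (y - 1) / (y e - conj e)]. By this identity
   [|z| < 1] means [sg Re y + t Im y > 0]: the disc corresponds to a half-plane in [y], hence to a
   strip, which is convex, in the logarithm of [y]. *)
assert (Hdiff : forall y : C, Cmod (y * e - Cconj e) ^ 2 - Cmod (y - RtoC 1) ^ 2 = 4 * sg * (sg * fst y + t * snd y)).
{ intros [p q]; rewrite !Cmod_sqr; unfold Cmult, Cminus, Cplus, Copp, Cconj, RtoC, e, extremal_unit; cbn [fst snd].
  change (sqrt (1 - t ^ 2)) with sg; assert (H : t * t + sg * sg = 1) by (transitivity (t ^ 2 + sg ^ 2); [ring|lra]).
  transitivity ((p * p + q * q) * (t * t + sg * sg - 1) + (t * t + sg * sg - 1) + 2 * p * (1 - t * t + sg * sg) + 4 * t * sg * q); [ring|].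
  replace (1 - t * t + sg * sg) with (2 * (sg * sg)) by lra; rewrite H; ring. }
destruct (clog_im_bound e) as [Al1 Al2].
set (al := snd (clog e)) in *.
assert (Hal : sg = sin al /\ t = cos al).
{ assert (E := cexp_clog e (proj1 Ht)); unfold cexp in E.
  assert (E0 : exp (fst (clog e)) = 1) by (simpl; rewrite Cmod_extremal_unit, ln_1; apply exp_0).
  rewrite E0 in E; fold al in E; split.
  - apply (f_equal snd) in E; simpl snd at 1 in E; fold sg in E; lra.
  - apply (f_equal fst) in E; simpl fst at 1 in E; change (fst e) with t in E; lra. }
assert (Hal0 : 0 < al).
{ apply Rnot_le_lt; intros H; assert (sin al <= 0); [|lra].
  rewrite <- (Ropp_involutive al), sin_neg.
  assert (0 <= sin (- al)) by (apply sin_ge_0; lra); lra. }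
assert (HYs : forall s, Y (RtoC s) = (exp (s * fst L) * cos (s * th), exp (s * fst L) * sin (s * th))).
{ intros s; unfold Y, cexp; replace (RtoC s * L)%C with (s * fst L, s * th) by (unfold th, Cmult, RtoC; simpl; f_equal; ring); reflexivity. }
assert (HY1 : Y (RtoC 1) = cexp L) by (unfold Y; f_equal; ring).
assert (Hend : 0 < sin (al + th)).
{ assert (D1 : den (RtoC 1) = ((e - Cconj e) / (RtoC 1 - e * z))%C).
  { unfold den; rewrite HY1, HW.
    replace ((RtoC 1 - Cconj e * z) / (RtoC 1 - e * z) * e - Cconj e)%C with ((e - (e * Cconj e) * z - Cconj e + (e * Cconj e) * z) / (RtoC 1 - e * z))%C by (field; exact N1).
    rewrite extremal_unit_conj; field; exact N1. }
  assert (D2 : (Y (RtoC 1) - RtoC 1)%C = (z * den (RtoC 1))%C) by (rewrite D1, HY1, HW; field; exact N1).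
  assert (Q := Hdiff (Y (RtoC 1))); fold (den (RtoC 1)) in Q; rewrite D2, Cmod_mult in Q.
  assert (HD : 0 < Cmod (den (RtoC 1))) by (rewrite D1; apply Cmod_gt_0; apply Cmult_neq_0; [exact Hd|]; intros E; apply (RtoC_neq_0 1); [lra|]; rewrite <- (Cinv_r _ N1), E; ring).
  rewrite HYs in Q; clearbody L; cbn [fst snd] in Q; rewrite !Rmult_1_l in Q.
  assert (E : sg * (exp (fst L) * cos th) + t * (exp (fst L) * sin th) = exp (fst L) * sin (al + th)).
  { rewrite sin_plus; destruct Hal as [-> ->]; ring. }
  rewrite E in Q; pose proof (exp_pos (fst L)); pose proof (Cmod_ge_0 z).
  assert (Pos : 0 < Cmod (den (RtoC 1)) ^ 2 - (Cmod z * Cmod (den (RtoC 1))) ^ 2).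
  { replace (Cmod (den (RtoC 1)) ^ 2 - (Cmod z * Cmod (den (RtoC 1))) ^ 2) with (Cmod (den (RtoC 1)) ^ 2 * (1 - Cmod z ^ 2)) by ring.
    apply Rmult_lt_0_compat; nra. }
  rewrite Q in Pos.
  apply Rmult_lt_reg_l with (4 * sg * exp (fst L)); [apply Rmult_lt_0_compat; lra|].
  rewrite Rmult_0_r, Rmult_assoc; exact Pos. }
(* With [al] the argument of [e], the half-plane is [sin (al + arg y) > 0]; since [0 < al < PI / 2]
   and [|th| < PI], a positive sine leaves only this interval. *)
assert (Hrange : 0 < al + th < PI).
{ split; apply Rnot_le_lt; intros H.
  - assert (0 <= sin (- (al + th))) by (apply sin_ge_0; lra); rewrite sin_neg in *; lra.
  - assert (0 <= sin (al + th - PI)) by (apply sin_ge_0; lra).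
    replace (sin (al + th - PI)) with (- sin (al + th)) in * by (rewrite sin_minus, cos_PI, sin_PI; ring); lra. }
(* The angle [al + s th] is a convex combination of [al] and [al + th], both in the strip, so the
   whole path stays in the disc. *)
assert (Hin : forall s, 0 <= s <= 1 -> Cmod (Y (RtoC s) - RtoC 1) < Cmod (den (RtoC s))).
{ intros s Hs.
  assert (Q := Hdiff (Y (RtoC s))); fold (den (RtoC s)) in Q.
  assert (Pos : 0 < sg * fst (Y (RtoC s)) + t * snd (Y (RtoC s))).
  { rewrite HYs; clearbody L; cbn [fst snd].
    replace (sg * (exp (s * fst L) * cos (s * th)) + t * (exp (s * fst L) * sin (s * th))) with (exp (s * fst L) * sin (al + s * th))
      by (rewrite sin_plus; destruct Hal as [-> ->]; ring).
    apply Rmult_lt_0_compat; [apply exp_pos|apply sin_gt_0].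
    - replace (al + s * th) with ((1 - s) * al + s * (al + th)) by ring.
      destruct (Rle_lt_or_eq_dec 0 s (proj1 Hs)) as [H|<-]; [|lra].
      assert (0 < s * (al + th)) by (apply Rmult_lt_0_compat; lra); assert (0 <= (1 - s) * al) by (apply Rmult_le_pos; lra); lra.
    - replace (al + s * th) with ((1 - s) * al + s * (al + th)) by ring.
      assert ((1 - s) * al <= (1 - s) * (PI / 2)) by (apply Rmult_le_compat_l; lra).
      assert (s * (al + th) <= s * PI) by (apply Rmult_le_compat_l; lra).
      destruct (Rle_lt_or_eq_dec s 1 (proj2 Hs)) as [H1|H1]; [nra|subst s; lra]. }
  pose proof (Cmod_ge_0 (Y (RtoC s) - RtoC 1)); pose proof (Cmod_ge_0 (den (RtoC s))).
  assert (0 < 4 * sg * (sg * fst (Y (RtoC s)) + t * snd (Y (RtoC s)))) by (apply Rmult_lt_0_compat; lra).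
  nra. }
assert (Hden : forall s, 0 <= s <= 1 -> den (RtoC s) <> RtoC 0).
{ intros s Hs; apply Cmod_gt_0; generalize (Hin s Hs) (Cmod_ge_0 (Y (RtoC s) - RtoC 1)); lra. }
pose (zeta := fun s : C => ((Y s - RtoC 1) * / den s)%C).
assert (Hzin : forall s, 0 <= s <= 1 -> Cmod (zeta (RtoC s)) < 1).
{ intros s Hs; unfold zeta; rewrite Cmod_mult, Cmod_inv by (apply Hden; exact Hs).
  assert (Q := Hin s Hs); pose proof (Cmod_ge_0 (Y (RtoC s) - RtoC 1)).
  apply Rmult_lt_reg_r with (Cmod (den (RtoC s))); [lra|].
  rewrite Rmult_assoc, Rinv_l by lra; lra. }
assert (Hz1 : zeta (RtoC 1) = z).
{ unfold zeta, den; rewrite HY1, HW.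
  replace ((RtoC 1 - Cconj e * z) / (RtoC 1 - e * z) * e - Cconj e)%C with ((e - (e * Cconj e) * z - Cconj e + (e * Cconj e) * z) / (RtoC 1 - e * z))%C by (field; exact N1).
  replace (e - (e * Cconj e) * z - Cconj e + (e * Cconj e) * z)%C with (e - Cconj e)%C by ring.
  field; auto. }
assert (HY : forall s, cderC Y s (L * Y s)%C).
{ intros s.
  assert (Q := cder_scal (V := CV) (fun s => s) (fun _ => L) s _ _ (cder_id s) (cder_const (V := CV) L s)).
  apply (cder_eq _ _ _ _ (cder_comp (V := CV) cexp (fun s => s * L)%C s _ _ (cder_cexp _) Q)); cfold; unfold Y; ring. }
assert (Hzc : forall s, 0 <= s <= 1 -> cderC zeta (RtoC s) (L / (e - Cconj e) * extremal_Q (zeta (RtoC s)))%C).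
{ intros s Hs; assert (Hds := Hden s Hs).
  assert (C1 : cderC (fun s => Y s - RtoC 1)%C (RtoC s) (L * Y (RtoC s))%C).
  { apply (cder_eq _ _ _ _ (cder_minus (V := CV) _ _ _ _ _ (HY _) (cder_const (V := CV) (RtoC 1) _))); cfold; ring. }
  assert (C2 : cderC den (RtoC s) (L * Y (RtoC s) * e)%C).
  { apply (cder_eq _ _ _ _ (cder_minus (V := CV) _ _ _ _ _
      (cder_scal (V := CV) _ _ _ _ _ (HY (RtoC s)) (cder_const (V := CV) e _)) (cder_const (V := CV) (Cconj e) _))); cfold; ring. }
  assert (C3 := cder_comp (V := CV) (fun w => / w)%C den (RtoC s) _ _ (cder_inv _ Hds) C2).
  apply (cder_eq _ _ _ _ (cder_scal (V := CV) _ _ _ _ _ C1 C3)); cfold.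
  rewrite extremal_Q_factor; unfold zeta; set (y := Y (RtoC s)) in *; set (dn := den (RtoC s)) in *.
  replace (RtoC 1 - e * ((y - RtoC 1) * / dn))%C with ((e - Cconj e) * / dn)%C
    by (replace (e - Cconj e)%C with (dn - e * (y - RtoC 1))%C by (unfold dn, den; fold y; ring); field; exact Hds).
  replace (RtoC 1 - Cconj e * ((y - RtoC 1) * / dn))%C with (y * (e - Cconj e) * / dn)%C
    by (replace (y * (e - Cconj e))%C with (dn - Cconj e * (y - RtoC 1))%C by (unfold dn, den; fold y; ring); field; exact Hds).
  replace (L * y * / dn + (y - RtoC 1) * (L * y * e * - (/ dn * / dn)))%C with (L * y * (dn - e * (y - RtoC 1)) * / dn * / dn)%C by (field; exact Hds).
  replace (dn - e * (y - RtoC 1))%C with (e - Cconj e)%C by (unfold dn, den; fold y; ring).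
  field; auto. }
(* The derivative of [zeta] is a constant times [Q (zeta)]; the prefactor cancels that constant, so
   that [k' = h Q] along the path. *)
pose (k := fun s : C => ((e - Cconj e) / L * (zeta s * extremal_g (zeta s)))%C).
assert (Hk : forall s, 0 <= s <= 1 -> cderC k (RtoC s) (extremal_h (zeta (RtoC s)) * extremal_Q (zeta (RtoC s)))%C).
{ intros s Hs.
  assert (C1 := cder_comp (V := CV) (fun w => w * extremal_g w)%C zeta (RtoC s) _ _
    (primitive_cder extremal_h extremal_h_holo extremal_h_bounded _ (Hzin s Hs)) (Hzc s Hs)).
  apply (cder_eq _ _ _ _ (cder_scal (V := CV) (fun _ => (e - Cconj e) / L)%C _ _ _ _ (cder_const (V := CV) _ _) C1)); cfold.
  field; auto. }
(* [h Q = Q^(1 - m / 2)] has exponent in [[-1/2, 0]], and the argument of [Q] lies in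
   [(-PI, PI)]. *)
assert (Hpos : forall w, Cmod w < 1 -> 0 < fst (extremal_h w * extremal_Q w)%C).
{ intros w Hw.
  assert (EQ : extremal_Q w = cexp (extremal_log w)).
  { unfold extremal_log; rewrite cexp_plus, !cexp_clog by (apply factor_pos; auto; [apply Cmod_extremal_unit || apply Cmod_conj_unit]).
    apply extremal_Q_factor. }
  rewrite EQ; unfold extremal_h; rewrite <- cexp_plus.
  replace (RtoC (- (m / 2)) * extremal_log w + extremal_log w)%C with (RtoC (1 - m / 2) * extremal_log w)%C
    by (rewrite RtoC_minus, RtoC_opp; ring).
  set (v := (RtoC (1 - m / 2) * extremal_log w)%C); change (0 < exp (fst v) * cos (snd v)).
  apply Rmult_lt_0_compat; [apply exp_pos|]; unfold v.
  replace (snd (RtoC (1 - m / 2) * extremal_log w)%C) with ((1 - m / 2) * snd (extremal_log w)) by (unfold Cmult, RtoC; simpl; ring).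
  assert (Hb : - PI < snd (extremal_log w) < PI).
  { unfold extremal_log; generalize (clog_im_bound (RtoC 1 - Cconj e * w)%C) (clog_im_bound (RtoC 1 - e * w)%C); intros [A1 A2] [B1 B2].
    replace (snd (clog (RtoC 1 - e * w) + clog (RtoC 1 - Cconj e * w))%C)
      with (snd (clog (RtoC 1 - e * w)%C) + snd (clog (RtoC 1 - Cconj e * w)%C)) by reflexivity.
    lra. }
  assert (Hlt : Rabs ((1 - m / 2) * snd (extremal_log w)) < PI / 2).
  { rewrite Rabs_mult, (Rabs_left1 (1 - m / 2)) by lra.
    assert (Rabs (snd (extremal_log w)) < PI) by (apply Rabs_def1; lra).
    assert (- (1 - m / 2) * Rabs (snd (extremal_log w)) <= / 2 * Rabs (snd (extremal_log w))) by (apply Rmult_le_compat_r; [apply Rabs_pos|lra]).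
    lra. }
  destruct (Rabs_def2 _ _ Hlt) as [G1 G2]; apply cos_gt_0; [exact G2|exact G1]. }
intros Eg.
(* If [g z = 0], then [k] vanishes at both ends; the mean value theorem for its real part
   contradicts [Hpos]. *)
destruct (MVT_cor2 (fun s => fst (k (RtoC s))) (fun s => fst (extremal_h (zeta (RtoC s)) * extremal_Q (zeta (RtoC s)))%C) 0 1 Rlt_0_1) as [c [Ec Hc]].
{ intros s Hs; apply derivable_pt_lim_fst, Hk; exact Hs. }
assert (Q := Hpos (zeta (RtoC c)) (Hzin c ltac:(lra))).
assert (K1 : k (RtoC 1) = RtoC 0) by (unfold k; rewrite Hz1, Eg; ring).
assert (K0 : k (RtoC 0) = RtoC 0).
{ unfold k; replace (zeta (RtoC 0)) with (RtoC 0); [ring|].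
  unfold zeta; replace (Y (RtoC 0)) with (RtoC 1); [ring|].
  unfold Y; replace (RtoC 0 * L)%C with (RtoC 0) by ring; symmetry; apply cexp_0. }
rewrite K1, K0 in Ec; simpl fst at 1 2 in Ec; lra.
Qed.

End ExtremalFunction.

(** * Taylor coefficients and half-plane condition of the extremal function *)

Section ExtremalDerivatives.

Context (m : R) (Hm : 2 <= m <= 3).

Let t := extremal_t m.
Let Q := extremal_Q m.

Definition extremal_d (n : nat) (z : C) : C := deriv_n (extremal_h m) n z.

Let d := extremal_d.

Lemma extremal_d_cder (n : nat) (z : C) : Cmod z < 1 -> cderC (d n) z (d (S n) z).
Proof. exact (deriv_n_cder _ (extremal_h_holo m Hm) n z). Qed.

Lemma extremal_d_0 (z : C) : d 0 z = extremal_h m z.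
Proof. apply deriv_n_0. Qed.

Lemma extremal_d_1 (z : C) : Cmod z < 1 -> d 1 z = (extremal_h m z * (RtoC m * (RtoC t - z) / Q z))%C.
Proof.
intros Hz; apply (cder_unique (V := CV) (extremal_h m) z).
- exact (h_cder _ (extremal_h_holo m Hm) z Hz).
- exact (extremal_h_cder m Hm z Hz).
Qed.

(** The logarithmic derivative of [Q^(-m/2)], cleared of its denominator. Differentiating this
    relation twice yields the values of [d 1], [d 2], [d 3] at 0 without expanding a complex
    power. *)
Lemma extremal_ode (z : C) : Cmod z < 1 -> (Q z * d 1 z = RtoC m * (RtoC t - z) * d 0 z)%C.
Proof.
intros Hz; rewrite extremal_d_1, extremal_d_0 by exact Hz.
assert (N := extremal_Q_neq_0 m Hm z Hz); fold Q in N; field; exact N.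
Qed.

Lemma cder_eq_on_disc (f g : C -> C) (z l l' : C) : Cmod z < 1 -> (forall w, Cmod w < 1 -> f w = g w) ->
  cderC f z l -> cderC g z l' -> l = l'.
Proof.
intros Hz E Hf Hg; apply (cder_unique (V := CV) g z); [|exact Hg].
apply (cder_ext f g z l (1 - Cmod z)); [lra|intros w Hw; apply E; generalize (Cmod_ball_sub z w); lra|exact Hf].
Qed.

Lemma cder_mult (f g : C -> C) (z l l' : C) : cderC f z l -> cderC g z l' ->
  cderC (fun w => f w * g w)%C z (l * g z + f z * l')%C.
Proof. exact (cder_scal (V := CV) f g z l l'). Qed.

Lemma cder_add (f g : C -> C) (z l l' : C) : cderC f z l -> cderC g z l' ->
  cderC (fun w => f w + g w)%C z (l + l')%C.
Proof. exact (cder_plus (V := CV) f g z l l'). Qed.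

Lemma cder_affine (a b z : C) : cderC (fun w => a + b * w)%C z b.
Proof.
assert (H := cder_poly a b (RtoC 0) (RtoC 0) z).
apply (cder_ext _ (fun w => a + b * w)%C _ _ 1 Rlt_0_1) in H; [apply (cder_eq _ _ _ _ H); cfold; ring|intros; cfold; ring].
Qed.

Lemma extremal_Q_cder (z : C) : cderC Q z (RtoC 2 * (z - RtoC t))%C.
Proof.
assert (H := cder_poly (RtoC 1) (- RtoC (2 * t))%C (RtoC 1) (RtoC 0) z).
apply (cder_ext _ Q _ _ 1 Rlt_0_1) in H.
- apply (cder_eq _ _ _ _ H); rewrite RtoC_mult; cfold; ring.
- intros; unfold Q, extremal_Q; fold t; cfold; ring.
Qed.

Lemma extremal_ode1 (z : C) : Cmod z < 1 ->
  (Q z * d 2 z + RtoC 2 * (z - RtoC t) * d 1 z = RtoC m * (RtoC t - z) * d 1 z - RtoC m * d 0 z)%C.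
Proof.
intros Hz.
assert (H : forall w, Cmod w < 1 -> (Q w * d 1 w)%C = ((RtoC m * RtoC t + - RtoC m * w) * d 0 w)%C).
{ intros w Hw; rewrite extremal_ode by exact Hw; ring. }
assert (E := cder_eq_on_disc (fun z => Q z * d 1 z)%C (fun z => (RtoC m * RtoC t + - RtoC m * z) * d 0 z)%C z _ _ Hz H
  (cder_mult _ _ _ _ _ (extremal_Q_cder z) (extremal_d_cder 1 z Hz))
  (cder_mult _ _ _ _ _ (cder_affine _ _ z) (extremal_d_cder 0 z Hz))).
transitivity (RtoC 2 * (z - RtoC t) * d 1 z + Q z * d 2 z)%C; [ring|rewrite E; ring].
Qed.

Lemma extremal_ode2 (z : C) : Cmod z < 1 ->
  (Q z * d 3 z + RtoC 4 * (z - RtoC t) * d 2 z + RtoC 2 * d 1 z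
   = RtoC m * (RtoC t - z) * d 2 z - RtoC 2 * RtoC m * d 1 z)%C.
Proof.
intros Hz.
assert (H : forall w, Cmod w < 1 -> (Q w * d 2 w + (- RtoC 2 * RtoC t + RtoC 2 * w) * d 1 w)%C
   = ((RtoC m * RtoC t + - RtoC m * w) * d 1 w + (- RtoC m + RtoC 0 * w) * d 0 w)%C).
{ intros w Hw; transitivity (Q w * d 2 w + RtoC 2 * (w - RtoC t) * d 1 w)%C; [ring|].
  rewrite extremal_ode1 by exact Hw; ring. }
assert (E := cder_eq_on_disc (fun z => Q z * d 2 z + (- RtoC 2 * RtoC t + RtoC 2 * z) * d 1 z)%C
  (fun z => (RtoC m * RtoC t + - RtoC m * z) * d 1 z + (- RtoC m + RtoC 0 * z) * d 0 z)%C z _ _ Hz H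
  (cder_add _ _ _ _ _ (cder_mult _ _ _ _ _ (extremal_Q_cder z) (extremal_d_cder 2 z Hz))
     (cder_mult _ _ _ _ _ (cder_affine _ _ z) (extremal_d_cder 1 z Hz)))
  (cder_add _ _ _ _ _ (cder_mult _ _ _ _ _ (cder_affine _ _ z) (extremal_d_cder 1 z Hz))
     (cder_mult _ _ _ _ _ (cder_affine _ _ z) (extremal_d_cder 0 z Hz)))).
match type of E with ?a = ?b => transitivity a; [ring|rewrite E; ring] end.
Qed.

Lemma extremal_d0_at_0 : d 0 (RtoC 0) = RtoC 1.
Proof. rewrite extremal_d_0; apply extremal_h_0. Qed.

Lemma zero_in_disc : Cmod (RtoC 0) < 1.
Proof. rewrite Cmod_0; lra. Qed.

Lemma extremal_Q_at_0 : Q (RtoC 0) = RtoC 1.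
Proof. unfold Q, extremal_Q; ring. Qed.

Lemma extremal_d1_at_0 : d 1 (RtoC 0) = RtoC (m * t).
Proof.
assert (E := extremal_ode (RtoC 0) zero_in_disc); rewrite extremal_Q_at_0, extremal_d0_at_0 in E.
rewrite RtoC_mult; transitivity (RtoC 1 * d 1 (RtoC 0))%C; [ring|rewrite E; ring].
Qed.

Lemma extremal_d2_at_0 : d 2 (RtoC 0) = RtoC (m * ((m + 2) * t ^ 2 - 1)).
Proof.
assert (E := extremal_ode1 (RtoC 0) zero_in_disc); rewrite extremal_Q_at_0, extremal_d0_at_0, extremal_d1_at_0 in E.
replace (m * ((m + 2) * t ^ 2 - 1)) with (m * (m * t * t + 2 * t * t - 1)) by ring.
rewrite !RtoC_mult, RtoC_minus, RtoC_plus, !RtoC_mult.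
transitivity (RtoC 1 * d 2 (RtoC 0) + RtoC 2 * (RtoC 0 - RtoC t) * RtoC (m * t) + RtoC 2 * RtoC t * RtoC (m * t))%C; [ring|].
rewrite E, RtoC_mult; ring.
Qed.

Lemma extremal_d3_at_0 : d 3 (RtoC 0) = RtoC ((m + 4) * t * (m * ((m + 2) * t ^ 2 - 1)) - 2 * (m + 1) * (m * t)).
Proof.
assert (E := extremal_ode2 (RtoC 0) zero_in_disc); rewrite extremal_Q_at_0, extremal_d1_at_0, extremal_d2_at_0 in E.
set (u := m * ((m + 2) * t ^ 2 - 1)) in *; set (v := m * t) in *.
rewrite RtoC_minus, !RtoC_mult, !RtoC_plus.
transitivity (RtoC 1 * d 3 (RtoC 0) + RtoC 4 * (RtoC 0 - RtoC t) * RtoC u + RtoC 2 * RtoC v + RtoC 4 * RtoC t * RtoC u - RtoC 2 * RtoC v)%C; [ring|].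
rewrite E; ring.
Qed.

(** The divisors [2], [6], [24] appear because the derivatives of [z g(z)] are those of [h] shifted
    by one. The value is [m / 12 * (P t - N t^3)], and [N t^2 = P / 3] at the critical point. *)
Lemma extremal_J : (d 1 (RtoC 0) / RtoC 2 * (d 2 (RtoC 0) / RtoC 6) - d 3 (RtoC 0) / RtoC 24)%C
  = RtoC (m / 12 * (2 / 3 * (2 + m / 2 + 1) * t)).
Proof.
rewrite extremal_d1_at_0, extremal_d2_at_0, extremal_d3_at_0, <- !RtoC_div, <- RtoC_mult, <- RtoC_minus by lra.
f_equal; destruct (extremal_t_sqr m Hm) as [_ HP]; fold t in HP.
set (P := 2 + m / 2 + 1) in *.
transitivity (m / 12 * (P * t - (P - (m - 2) * (m + 1) / 2) * t ^ 2 * t)); [unfold P; field|].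
replace ((P - (m - 2) * (m + 1) / 2) * t ^ 2) with (P / 3) by (rewrite HP at 1; field); field.
Qed.

Lemma half_plane (w : C) : Cmod w < 1 -> 0 <= Re ((RtoC 1 + w) / (RtoC 1 - w)).
Proof.
intros Hw.
assert (Hp := fst_one_minus_pos w Hw); assert (N := fst_pos_neq_0 _ Hp).
assert (E : ((RtoC 1 + w) / (RtoC 1 - w) = (RtoC 1 + w) * Cconj (RtoC 1 - w) * RtoC (/ Cmod (RtoC 1 - w) ^ 2))%C).
{ assert (H0 : 0 < Cmod (RtoC 1 - w)) by now apply Cmod_gt_0.
  assert (H1 : 0 < Cmod (RtoC 1 - w) ^ 2) by (apply pow_lt; exact H0).
  rewrite RtoC_inv by lra; rewrite <- Cmod_conj_sqr.
  assert (N' : Cconj (RtoC 1 - w) <> RtoC 0) by (apply Cmod_gt_0; rewrite Cmod_conj; exact H0).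
  field; auto. }
rewrite E.
assert (H1 : 0 < / Cmod (RtoC 1 - w) ^ 2) by (apply Rinv_0_lt_compat, pow_lt, Cmod_gt_0; exact N).
assert (H2 := Cmod_sqr w).
replace (Re ((RtoC 1 + w) * Cconj (RtoC 1 - w) * RtoC (/ Cmod (RtoC 1 - w) ^ 2))%C)
  with ((1 - Cmod w ^ 2) * / Cmod (RtoC 1 - w) ^ 2).
- apply Rmult_le_pos; [|lra]; pose proof (Cmod_ge_0 w); nra.
- rewrite H2; generalize (/ Cmod (RtoC 1 - w) ^ 2); intros k.
  destruct w as [a b]; unfold Re, Cconj, Cminus, Cplus, Copp, Cmult, RtoC; simpl; ring.
Qed.

(** [1 + z h' / h] equals [1 - m / 2] plus [m / 4] times the sum of [(1 + w) / (1 - w)] at [w = e z]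
    and [w = conj e z], and both of these have nonnegative real part. *)
Lemma extremal_class (z : C) : Cmod z < 1 -> 1 - m / 2 <= Re (RtoC 1 + z * (d 1 z) / d 0 z)%C.
Proof.
intros Hz; rewrite extremal_d_1, extremal_d_0 by exact Hz.
set (e := extremal_unit m).
assert (N := extremal_Q_neq_0 m Hm z Hz); fold Q in N.
assert (Nh := extremal_h_neq_0 m z).
assert (N1 := factor_neq_0 e z (Cmod_extremal_unit m Hm) Hz); assert (N2 := factor_neq_0 (Cconj e) z (Cmod_conj_unit m Hm) Hz).
assert (E : (RtoC 1 + z * (extremal_h m z * (RtoC m * (RtoC t - z) / Q z)) / extremal_h m z
  = RtoC (1 - m / 2) + RtoC (m / 4) * ((RtoC 1 + e * z) / (RtoC 1 - e * z) + (RtoC 1 + Cconj e * z) / (RtoC 1 - Cconj e * z)))%C).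
{ assert (E2 : ((RtoC 1 + e * z) / (RtoC 1 - e * z) + (RtoC 1 + Cconj e * z) / (RtoC 1 - Cconj e * z) = RtoC 2 * (RtoC 1 - z * z) / Q z)%C).
  { unfold Q; rewrite (extremal_Q_factor m Hm); fold e.
    replace (RtoC 2 * (RtoC 1 - z * z))%C with (RtoC 2 * (RtoC 1 - (e * Cconj e) * (z * z)))%C by (unfold e; rewrite (extremal_unit_conj m Hm); ring).
    field; auto. }
  rewrite E2; unfold Rdiv; rewrite RtoC_minus, !RtoC_mult, !RtoC_inv by lra.
  assert (EQ : Q z = (RtoC 1 - RtoC 2 * RtoC t * z + z * z)%C) by (unfold Q, extremal_Q; fold t; rewrite RtoC_mult; ring).
  replace (RtoC 1 + z * (extremal_h m z * (RtoC m * (RtoC t - z) / Q z)) / extremal_h m z)%C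
    with (RtoC 1 + RtoC m * (RtoC 2 * (z * (RtoC t - z))) / (RtoC 2 * Q z))%C by (field; repeat split; auto; apply RtoC_neq_0; lra).
  replace (RtoC 2 * (z * (RtoC t - z)))%C with (RtoC 1 - z * z - Q z)%C by (rewrite EQ; ring).
  field; repeat split; auto; apply RtoC_neq_0; lra. }
rewrite E.
assert (H1 := half_plane (e * z)%C (factor_small e z (Cmod_extremal_unit m Hm) Hz)).
assert (H2 := half_plane (Cconj e * z)%C (factor_small (Cconj e) z (Cmod_conj_unit m Hm) Hz)).
set (u := ((RtoC 1 + e * z) / (RtoC 1 - e * z))%C) in *; set (v := ((RtoC 1 + Cconj e * z) / (RtoC 1 - Cconj e * z))%C) in *.
clearbody u v; destruct u as [u1 u2], v as [v1 v2]; unfold Re, Cplus, Cmult, RtoC in *; simpl in *.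
assert (0 <= m / 4 * (u1 + v1)) by (apply Rmult_le_pos; lra); lra.
Qed.

End ExtremalDerivatives.

(** * The extremal map *)

Section ExtremalMap.

Context {X : CompleteNormedModule C_AbsRing}.

Notation V := (CompleteNormedModule.NormedModule C_AbsRing X).

Context (lambda : R) (Hl : 1 / 2 <= lambda <= 1) (x0 : V) (Hx0 : norm x0 = 1)
  (T : Lin V CV) (HT : T x0 = RtoC 1) (HTn : norm T = 1).

Let m := 1 + 2 * lambda.
Let g := extremal_g m.
Let d := extremal_d m.

Lemma m_range : 2 <= m <= 3.
Proof. unfold m; lra. Qed.

Let Hm := m_range.

Definition extremal_map (x : V) : V := (g (T x)) *: x.

Let F := extremal_map.

Lemma T_le (x : V) : Cmod (T x) <= norm x.
Proof. assert (Q := Lin_norm_apply T x); change (Cmod (T x) <= norm T * norm x) in Q; rewrite HTn in Q; lra. Qed.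

Lemma T_scal (c : C) (x : V) : T (c *: x) = (c * T x)%C.
Proof. exact (linear_scal _ (lin_prop T) c x). Qed.

Lemma extremal_g_spec (z : C) : Cmod z < 1 -> exists g', cderC g z g' /\ (g z + z * g')%C = d 0 z.
Proof.
intros Hz; destruct (ray_mean_cder (extremal_h m) (extremal_h_holo m Hm) (extremal_h_bounded m Hm) z Hz) as [g' [H1 H2]].
exists g'; split; [exact H1|]; unfold d; rewrite extremal_d_0; exact H2.
Qed.

Definition rank_one (x : V) : Lin V V := mkLin _ (is_linear_comp T (lin_smul x) (lin_prop T) (lin_prop (lin_smul x))).

(** The shape of the derivative of the extremal map at [x]: a multiple of the identity plus a
    multiple of the rank-one operator [k |-> (T k) x]. *)
Definition scaled_id_plus (a b : C) (x : V) : Lin V V := Lin_plus (Lin_scal a (Lin_id V)) (Lin_scal b (rank_one x)).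

Lemma scaled_id_plus_apply (a b : C) (x k : V) :
  scaled_id_plus a b x k = plus (a *: k) ((b * T k) *: x).
Proof.
change (plus (a *: k) (b *: ((T k) *: x)) = plus (a *: k) ((b * T k) *: x)).
vring.
Qed.

Lemma extremal_map_fder (x : V) (g' : C) : norm x < 1 -> cderC g (T x) g' ->
  fder F x (scaled_id_plus (g (T x)) g' x).
Proof.
intros Hx Hg eps He.
destruct (Hg (eps / 2) ltac:(lra)) as [d1 [Hd1 K1]].
destruct (cder_continuous g _ g' Hg (eps / 2) ltac:(lra)) as [d2 [Hd2 K2]].
exists (Rmin d1 d2); split; [now apply Rmin_glb_lt|]; intros y Hy.
assert (ET : (T y - T x)%C = T (minus y x)).
{ unfold minus; rewrite (linear_plus _ (lin_prop T)), (linear_opp _ _ (lin_prop T)); reflexivity. }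
assert (HTk := T_le (minus y x)); rewrite <- ET in HTk.
assert (H1 : Cmod (T y - T x) < d1) by (apply Rle_lt_trans with (1 := HTk), Rlt_le_trans with (1 := Hy), Rmin_l).
assert (H2 : Cmod (T y - T x) < d2) by (apply Rle_lt_trans with (1 := HTk), Rlt_le_trans with (1 := Hy), Rmin_r).
specialize (K1 _ H1); specialize (K2 _ H2).
change (Cmod (g (T y) - g (T x) - (T y - T x) * g') <= eps / 2 * Cmod (T y - T x)) in K1.
change (Cmod (g (T y) - g (T x)) < eps / 2) in K2.
rewrite scaled_id_plus_apply, <- ET; unfold F, extremal_map.
set (k := minus y x) in *; set (w := T y) in *; set (z := T x) in *.
match goal with |- norm ?Z <= _ => replace Z with (plus ((g w - g z - (w - z) * g') *: x) ((g w - g z) *: k)) by (unfold k; vring) end.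
apply Rle_trans with (1 := norm_triangle _ _); rewrite !norm_scalC.
pose proof (norm_ge_0 x); pose proof (norm_ge_0 k); pose proof (Cmod_ge_0 (w - z)).
assert (A1 : Cmod (g w - g z - (w - z) * g') * norm x <= eps / 2 * norm k).
{ apply Rle_trans with (eps / 2 * norm k * norm x).
  - apply Rmult_le_compat_r; [lra|]; apply Rle_trans with (1 := K1); apply Rmult_le_compat_l; lra.
  - rewrite <- (Rmult_1_r (eps / 2 * norm k)) at 2; apply Rmult_le_compat_l; [apply Rmult_le_pos|]; lra. }
assert (A2 : Cmod (g w - g z) * norm k <= eps / 2 * norm k) by (apply Rmult_le_compat_r; lra).
lra.
Qed.

Lemma extremal_map_holo : holo F.
Proof.
intros x Hx.
destruct (extremal_g_spec (T x)) as [g' [Hg _]]; [generalize (T_le x); lra|].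
eexists; apply extremal_map_fder; eauto.
Qed.

Lemma extremal_map_holomorphic : holomorphic (X := X) F.
Proof.
intros x Hx; destruct (extremal_map_holo x Hx) as [L HL]; exists L; exact (fder_filterdiff (U := V) (V := V) F x L (lin_prop L) HL).
Qed.

(** Both operators give the complex derivative of [G] on each line through [x], which is unique. *)
Lemma fder_unique {U W : NormedModule C_AbsRing} (G : U -> W) (x : U) (L M : Lin U W) : fder G x L -> fder G x M -> L = M.
Proof.
intros HL HM; apply Lin_ext; intros k.
assert (E : x = plus x ((RtoC 0) *: k)) by vring.
apply (cder_unique (fun w => G (plus x (w *: k))) (RtoC 0)); apply cder_line; rewrite <- E; assumption.
Qed.

Lemma extremal_map_frechet (x : V) : norm x < 1 -> exists g', (g (T x) + T x * g')%C = d 0 (T x) /\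
  frechet F x = scaled_id_plus (g (T x)) g' x.
Proof.
intros Hx; destruct (extremal_g_spec (T x)) as [g' [Hg E]]; [generalize (T_le x); lra|].
exists g'; split; [exact E|].
apply (fder_unique F x); [apply holo_frechet; [apply extremal_map_holo|exact Hx]|apply extremal_map_fder; auto].
Qed.

Lemma extremal_d0_neq_0 (z : C) : d 0 z <> RtoC 0.
Proof. unfold d; rewrite extremal_d_0; apply extremal_h_neq_0. Qed.

Lemma T_plus (x y : V) : T (plus x y) = (T x + T y)%C.
Proof. exact (linear_plus _ (lin_prop T) x y). Qed.

(** The derivative acts as [g (T x)] on the kernel of [T] and multiplies [x] by
    [g + T x g' = h (T x)]; neither number vanishes. *)
Lemma extremal_map_inverse (x : V) : norm x < 1 -> exists B : Lin V V, is_inverse (frechet F x) B.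
Proof.
intros Hx; destruct (extremal_map_frechet x Hx) as [g' [E ->]].
assert (Hz : Cmod (T x) < 1) by (generalize (T_le x); lra).
assert (Ng := extremal_g_neq_0 m Hm (T x) Hz); fold g in Ng.
assert (Nd := extremal_d0_neq_0 (T x)).
(* The Sherman-Morrison formula for the inverse of a rank-one perturbation. *)
exists (scaled_id_plus (/ g (T x))%C (- (g' / (g (T x) * d 0 (T x))))%C x).
split; intros k; rewrite !scaled_id_plus_apply, T_plus, !T_scal; rewrite <- E in *; vcoefs; try (field; auto).
Qed.

Lemma extremal_map_locally_biholomorphic : locally_biholomorphic (X := X) F.
Proof. split; [exact extremal_map_holomorphic|exact extremal_map_inverse]. Qed.

Definition line_coef (x : V) (n : nat) (z : C) : C := ((T x) ^ n * d n (z * T x))%C.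

(** On the line, [F (z x) = z g(z T x) x], and the derivative of [z g(z)] is [h]; hence the first
    derivative is [h (z T x) x] and each further one produces a factor [T x]. *)
Lemma extremal_line (x : V) (n : nat) (z : C) : Cmod z * norm x < 1 ->
  line_deriv F x (S n) z = (line_coef x n z) *: x.
Proof.
pose proof (norm_ge_0 x) as Hx.
assert (Hnear : forall z : C, Cmod z * norm x < 1 -> exists r, 0 < r /\ forall w, Cmod (w - z) < r -> Cmod w * norm x < 1).
{ intros w0 Hw0; exists ((1 - Cmod w0 * norm x) / (norm x + 1)); split; [apply Rdiv_lt_0_compat; lra|].
  intros w Hw.
  assert (H1 : Cmod (w - w0) * (norm x + 1) < 1 - Cmod w0 * norm x).
  { apply lt_div_mult; [lra|exact Hw]. }
  assert (H2 := Cmod_ball_sub w0 w); pose proof (Cmod_ge_0 (w - w0)); nra. }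
assert (Hin : forall z : C, Cmod z * norm x < 1 -> Cmod (z * T x) < 1).
{ intros w Hw; rewrite Cmod_mult; generalize (T_le x) (Cmod_ge_0 w); nra. }
assert (Hmul : forall w, cderC (fun w => w * T x)%C w (T x)).
{ intros w; apply (cder_eq _ _ _ _ (cder_scal (V := CV) (fun s => s) (fun _ => T x) w _ _ (cder_id _) (cder_const (V := CV) (T x) w))).
  cfold; ring. }
assert (Step : forall n (c : C -> C), (forall z : C, Cmod z * norm x < 1 -> line_deriv F x n z = (c z) *: x) ->
  forall (z c' : C), Cmod z * norm x < 1 -> cderC c z c' -> line_deriv F x (S n) z = c' *: x).
{ intros n' c Hc w c' Hw Hc'.
  apply (cder_unique (line_deriv F x n') w).
  - apply (cder_line_deriv (complete_data X)); [apply extremal_map_holo|exact Hw].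
  - destruct (Hnear w Hw) as [r [Hr Hr']].
    apply (cder_ext (fun z => (c z) *: x) _ _ _ r Hr); [intros v Hv; symmetry; apply Hc, Hr', Hv|].
    apply (cder_eq _ _ _ _ (cder_scal c (fun _ => x) w _ _ Hc' (cder_const x w))); vring. }
revert z; induction n as [|n IH]; intros z Hz.
- destruct (extremal_g_spec (z * T x)%C (Hin z Hz)) as [g' [Hg E]].
  apply (Step 0%nat (fun w => w * g (w * T x))%C); [|exact Hz|].
  + intros w Hw; unfold line_deriv; simpl; unfold F, extremal_map; rewrite T_scal; vring.
  + apply (cder_eq _ _ _ _ (cder_mult _ _ _ _ _ (cder_id z) (cder_comp (V := CV) g (fun w => w * T x)%C z _ _ Hg (Hmul z)))).
    unfold line_coef; rewrite <- E; cfold; simpl; ring.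
- apply (Step (S n) (line_coef x n) IH z _ Hz).
  assert (Q := cder_mult (fun _ => (T x) ^ n)%C _ z _ _ (cder_const (V := CV) ((T x) ^ n)%C z)
     (cder_comp (V := CV) (d n) (fun w => w * T x)%C z _ _ (extremal_d_cder m Hm n _ (Hin z Hz)) (Hmul z))).
  apply (cder_eq _ _ _ _ Q); unfold line_coef; cfold; fold d; simpl; ring.
Qed.

Lemma extremal_diag_0 (x : V) (n : nat) :
  MLin_diag (S n) (frechet_n F (S n) zero) x = ((T x) ^ n * d n (RtoC 0)) *: x.
Proof.
rewrite <- line_deriv_0, extremal_line by (rewrite Cmod_0; lra).
unfold line_coef; do 3 f_equal; ring.
Qed.

Lemma extremal_diag_at (x : V) (n : nat) : norm x < 1 ->
  MLin_diag (S n) (frechet_n F (S n) x) x = ((T x) ^ n * d n (T x)) *: x.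
Proof.
intros Hx.
assert (Q := extremal_line x n (RtoC 1) ltac:(rewrite Cmod_1; lra)).
unfold line_deriv, line_coef in Q.
replace ((RtoC 1) *: x) with x in Q by vring; rewrite (Cmult_1_l (T x)) in Q; exact Q.
Qed.

(** The polarisation of [x |-> (T x)^k], witnessing that this is a homogeneous polynomial. *)
Fixpoint prod_T (k : nat) : (Fin.t k -> V) -> C :=
  match k return (Fin.t k -> V) -> C with
  | O => fun _ => RtoC 1
  | S k' => fun v => (T (v Fin.F1) * prod_T k' (fun i => v (Fin.FS i)))%C
  end.

Lemma slot_same {k : nat} (v : Fin.t k -> X) (i : Fin.t k) (x : X) : slot v i x i = x.
Proof. unfold slot; destruct (Fin.eq_dec i i); congruence. Qed.

Lemma slot_other {k : nat} (v : Fin.t k -> X) (i j : Fin.t k) (x : X) : i <> j -> slot v i x j = v j.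
Proof. intros H; unfold slot; destruct (Fin.eq_dec i j); congruence. Qed.

Lemma slot_FS {k : nat} (v : Fin.t (S k) -> X) (i : Fin.t k) (x : X) :
  (fun j => slot v (Fin.FS i) x (Fin.FS j)) = slot (fun j => v (Fin.FS j)) i x.
Proof.
apply functional_extensionality; intros j; unfold slot.
destruct (Fin.eq_dec i j) as [H|H], (Fin.eq_dec (Fin.FS i) (Fin.FS j)) as [E|E]; try congruence.
Qed.

Lemma slot_F1 {k : nat} (v : Fin.t (S k) -> X) (x : X) :
  (fun j => slot v Fin.F1 x (Fin.FS j)) = (fun j => v (Fin.FS j)).
Proof. apply functional_extensionality; intros j; apply slot_other; discriminate. Qed.

Lemma prod_T_linear (k : nat) : k_linear (X := X) (prod_T k).
Proof.
induction k as [|k IH]; intros v i a x y.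
- inversion i.
- pattern i; apply (Fin.caseS' i); [|clear i; intros i].
  + simpl; rewrite !slot_F1, !slot_same.
    replace (T (plus (scal a x) y)) with (a * T x + T y)%C; [ring|].
    symmetry; etransitivity; [apply T_plus|f_equal; apply T_scal].
  + simpl; rewrite !slot_FS, !(slot_other v (Fin.FS i) Fin.F1) by discriminate.
    rewrite IH; ring.
Qed.

Lemma prod_T_diag (k : nat) (x : V) : prod_T k (fun _ => x) = ((T x) ^ k)%C.
Proof. induction k as [|k IH]; [reflexivity|simpl; now rewrite IH]. Qed.

Lemma extremal_map_scalar_type : scalar_type_expansion (X := X) F.
Proof.
intros k Hk.
set (c := (RtoC (/ INR (fact (k + 1))) * d k (RtoC 0))%C).
exists (fun x => (c * prod_T k (fun _ => x))%C); split.
- exists (fun v => (c * prod_T k v)%C); split; [|reflexivity].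
  intros v i a x y; rewrite prod_T_linear; ring.
- intros x; rewrite prod_T_diag; unfold c; replace (k + 1)%nat with (S k) by lia.
  transitivity ((RtoC (/ INR (fact (S k)))) *: (((T x) ^ k * d k (RtoC 0)) *: x)).
  + f_equal; exact (extremal_diag_0 x k).
  + transitivity ((RtoC (/ INR (fact (S k))) * d k (RtoC 0) * (T x) ^ k) *: x); [vring|reflexivity].
Qed.

Lemma extremal_map_normalized : normalized (X := X) F.
Proof.
assert (T0 : T zero = RtoC 0) by exact (linear_zero _ (lin_prop T)).
split.
- change ((g (T zero)) *: (zero : V) = (zero : V)); vring.
- assert (Hz : norm (zero : V) < 1) by (rewrite norm_zero; lra).
  destruct (extremal_map_frechet zero Hz) as [g' [E Ef]].
  change (frechet F zero = Lin_id V); rewrite Ef; apply Lin_ext; intros k; rewrite scaled_id_plus_apply.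
  rewrite T0 in E |- *.
  assert (E1 : g (RtoC 0) = RtoC 1).
  { transitivity (g (RtoC 0) + RtoC 0 * g')%C; [ring|]; rewrite E; apply (extremal_d0_at_0 m). }
  rewrite E1; change (plus ((RtoC 1) *: k) ((g' * T k) *: (zero : V)) = k).
  vring.
Qed.

(** By [extremal_diag_at], [x] is an eigenvector of [DF(x)] with eigenvalue [h (T x)]. *)
Lemma extremal_map_inv_self (x : V) : norm x < 1 -> Lin_inv (frechet F x) x = (/ d 0 (T x)) *: x.
Proof.
intros Hx.
destruct (Lin_inv_spec _ (extremal_map_inverse x Hx)) as [Hinv _].
assert (E := extremal_diag_at x 0 Hx); simpl in E.
assert (Nd := extremal_d0_neq_0 (T x)).
rewrite <- (Hinv ((/ d 0 (T x)) *: x)); f_equal.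
transitivity ((/ d 0 (T x)) *: (frechet F x x)).
- rewrite E; vcoefs; field; exact Nd.
- symmetry; apply (linear_scal _ (lin_prop (frechet F x))).
Qed.

(** [D^2F(x)(x, x) + DF(x) x] and its preimage under [DF(x)] are multiples of [x], so every support
    functional at [x] returns the same number [1 + z h' / h] with [z = T x], and the one-variable
    estimate [extremal_class] settles all of them. *)
Lemma extremal_map_class : class_Fhat (X := X) lambda F.
Proof.
split; [exact extremal_map_normalized|split; [exact extremal_map_locally_biholomorphic|]].
intros x T' Hx Hx0' [HT' _].
assert (Hn : norm x < 1) by exact Hx.
assert (Hp : 0 < norm (x : V)).
{ destruct (Rle_lt_or_eq_dec _ _ (norm_ge_0 (x : V))) as [H|H]; [exact H|].
  exfalso; apply Hx0'; exact (norm_eq_zero (x : V) (eq_sym H)). }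
set (z := T x).
assert (Hz : Cmod z < 1) by (generalize (T_le x); unfold z; lra).
assert (Nd := extremal_d0_neq_0 z).
assert (E : T' ((RtoC (/ norm (x : V))) *: (Lin_inv (frechet F x) (plus (MLin_diag 2 (frechet_n F 2 x) x : V) (frechet F x x))))
  = (RtoC 1 + z * d 1 z / d 0 z)%C).
{ assert (E1 := extremal_diag_at x 1 Hn); assert (E0 := extremal_diag_at x 0 Hn); fold z in E0, E1.
  change (frechet F x x = ((z ^ 0) * d 0 z) *: (x : V)) in E0.
  assert (Esum : plus (MLin_diag 2 (frechet_n F 2 x) x : V) (frechet F x x) = (z * d 1 z + d 0 z) *: (x : V)).
  { transitivity (plus ((z ^ 1 * d 1 z) *: (x : V)) (((z ^ 0) * d 0 z) *: (x : V))).
    - f_equal; [exact E1|exact E0].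
    - vcoefs; simpl; ring. }
  transitivity (T' ((RtoC (/ norm (x : V))) *: ((z * d 1 z + d 0 z) *: ((/ d 0 z) *: (x : V))))).
  - do 2 f_equal.
    transitivity (Lin_inv (frechet F x) ((z * d 1 z + d 0 z) *: (x : V))); [f_equal; exact Esum|].
    transitivity ((z * d 1 z + d 0 z) *: (Lin_inv (frechet F x) x)); [apply (linear_scal _ (lin_prop (Lin_inv (frechet F x))))|].
    f_equal; exact (extremal_map_inv_self x Hn).
  - assert (HT'' : T' (x : V) = RtoC (norm (x : V))) by exact HT'.
    assert (T's : forall (c : C) (y : V), T' (c *: y) = (c * T' y)%C) by (intros c y; exact (linear_scal _ (lin_prop T') c y)).
    rewrite !T's, HT'', RtoC_inv by lra.
    assert (Nn : RtoC (norm (x : V)) <> RtoC 0) by (apply RtoC_neq_0; lra).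
    cfold; field; auto. }
apply Rle_ge.
assert (Q := extremal_class m Hm z Hz); fold d in Q.
rewrite <- E in Q; replace (1 / 2 - lambda) with (1 - m / 2) by (unfold m; field); exact Q.
Qed.

(** As [T x0 = 1], the coefficients are the Taylor coefficients of [z g(z)], and [extremal_J] gives
    a nonnegative real value. *)
Lemma extremal_map_sharp : Cmod (J23 (X := X) F x0 T) = J23_bound lambda.
Proof.
assert (HJ : J23 (X := X) F x0 T = RtoC (m / 12 * (2 / 3 * (2 + m / 2 + 1) * extremal_t m))).
{ rewrite <- (extremal_J m Hm); unfold J23.
  assert (Ha : forall n, coefA (X := X) F x0 T (S n) = (d n (RtoC 0) / RtoC (INR (fact (S n))))%C).
  { intros n; unfold coefA.
    transitivity (RtoC (/ INR (fact (S n))) * T (((T x0) ^ n * d n (RtoC 0)) *: x0))%C.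
    - do 2 f_equal; exact (extremal_diag_0 x0 n).
    - rewrite T_scal, HT, RtoC_inv by apply INR_fact_neq_0.
      replace ((RtoC 1) ^ n)%C with (RtoC 1) by (induction n as [|n IH]; [reflexivity|simpl; rewrite <- IH; ring]).
      unfold Cdiv; ring. }
  rewrite !Ha; fold d.
  replace (INR (fact 2)) with 2 by (simpl; lra); replace (INR (fact 3)) with 6 by (simpl; lra); replace (INR (fact 4)) with 24 by (simpl; lra).
  reflexivity. }
rewrite HJ, J23_bound_eq by exact Hl; fold m.
rewrite Cmod_R, Rabs_pos_eq; [reflexivity|].
destruct (extremal_t_sqr m Hm) as [Ht _]; generalize m_range; intros.
repeat apply Rmult_le_pos; lra.
Qed.

End ExtremalMap.

Theorem theorem6p2 (X : CompleteNormedModule C_AbsRing)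
    (hX : exists x : X, x <> zero)
    (lambda : R) (hlambda : 1 / 2 <= lambda <= 1) :
  (forall F : X -> X,
     locally_biholomorphic F -> scalar_type_expansion F -> class_Fhat lambda F ->
     forall (x0 : X) (T : Lin X C_NormedModule),
       norm x0 = 1 -> support_functional x0 T ->
       Cmod (J23 F x0 T) <= J23_bound lambda)
  /\
  (exists (F : X -> X) (x0 : X) (T : Lin X C_NormedModule),
     locally_biholomorphic F /\ scalar_type_expansion F /\ class_Fhat lambda F /\
     norm x0 = 1 /\ support_functional x0 T /\
     Cmod (J23 F x0 T) = J23_bound lambda).
Proof.
split.
- intros F _ HE HF x0 T Hx0 HT; exact (J23_le lambda hlambda F HE HF x0 T Hx0 HT).
- destruct hX as [x Hx].
  pose (V := CompleteNormedModule.NormedModule C_AbsRing X).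
  assert (Hp : 0 < norm (x : V)).
  { destruct (Rle_lt_or_eq_dec _ _ (norm_ge_0 (x : V))) as [H|H]; [exact H|].
    exfalso; apply Hx; exact (norm_eq_zero (x : V) (eq_sym H)). }
  pose (x0 := (RtoC (/ norm (x : V))) *: (x : V)).
  assert (Hx0 : norm x0 = 1).
  { unfold x0; rewrite scal_div_pos by (now apply Rinv_0_lt_compat); field; lra. }
  assert (Hn0 : x0 <> zero) by (intros E; assert (E0 : norm x0 = 0) by (rewrite E; exact (norm_zero (V := V))); lra).
  (* The same functional defines the extremal map and serves as the support functional at [x0]. *)
  destruct (norming_functional x0 Hn0) as [T [HT HTn]].
  assert (HT1 : T x0 = RtoC 1) by (rewrite HT, Hx0; reflexivity).
  exists (extremal_map lambda T), x0, T.
  split; [exact (extremal_map_locally_biholomorphic lambda hlambda T HTn)|].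
  split; [exact (extremal_map_scalar_type lambda hlambda T HTn)|].
  split; [exact (extremal_map_class lambda hlambda T HTn)|].
  split; [exact Hx0|].
  split; [split; [exact HT|exact HTn]|].
  exact (extremal_map_sharp lambda hlambda x0 T HT1 HTn).
Qed.
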